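(* Suppose $p\ge1$, $q>0$ and $s>\max\{0,1-\frac qn\}$. Then there exist bounded linear operators $A_1,\dots,A_n$ on $\mathcal{N}(p,q,s)$ such that $$f(z)-f(0)=\sum_{k=1}^nz_kA_kf(z),\qquad\text{for all } f\in\mathcal{N}(p,q,s),\ z\in\mathbb{B}.$$ Here $A_kf(z)=\int_0^1\frac{\partial f}{\partial z_k}(tz)\,dt$.
   Context: $\mathbb{B}$ is the open unit ball of $\mathbb{C}^n$, $H(\mathbb{B})$ is the space of holomorphic functions on $\mathbb{B}$, $dV$ is normalized volume measure on $\mathbb{B}$, and $d\lambda(z)=\frac{dV(z)}{(1-|z|^2)^{n+1}}$. For $a\in\mathbb{B}$, $\Phi_a(z)=\frac{a-P_az-s_aQ_az}{1-\langle z,a\rangle}$, where $s_a=\sqrt{1-|a|^2}$, $P_a$ is the orthogonal projection onto the span of $a$ and $Q_a=I-P_a$. For $p,q,s>0$, $\mathcal{N}(p,q,s)$ is the set of $f\in H(\mathbb{B})$ with $\|f\|^p=\sup_{a\in\mathbb{B}}\int_{\mathbb{B}}|f(z)|^p(1-|z|^2)^q(1-|\Phi_a(z)|^2)^{ns}d\lambda(z)<\infty$, normed by $\|\cdot\|$. *)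

(* Defs.v *)
From HB Require Import structures.
From mathcomp Require Import all_boot all_order all_algebra.
From mathcomp Require Import spectral complex.
From mathcomp Require Import all_classical all_reals all_analysis.
From mathcomp Require Import measurable_realfun.

Set Implicit Arguments.
Unset Strict Implicit.
Unset Printing Implicit Defensive.

Import Order.TTheory GRing.Theory Num.Theory.
Import numFieldNormedType.Exports.

Local Open Scope classical_set_scope.
Local Open Scope ring_scope.
Local Open Scope complex_scope.

(* The n-fold product of a sigma-finite measure, on n-tuples: tuple_measure m n,
   characterized by its value on boxes in tuple_measure_box. *)
Section tuple_cons_measure.
Context d (T : measurableType d) (R : realType) (n : nat).
Variables (m1 : {sigma_finite_measure set T -> \bar R})
          (m2 : {sigma_finite_measure set (n.-tuple T) -> \bar R}).

Definition tuple_cons (x : T * n.-tuple T) : n.+1.-tuple T :=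
  [tuple of x.1 :: x.2].

Lemma measurable_tuple_cons : measurable_fun setT tuple_cons.
Proof. exact: measurable_cons. Qed.

Definition tuple_cons_measure : set (n.+1.-tuple T) -> \bar R :=
  pushforward (m1 \x m2)%E tuple_cons.

Let tcm0 : tuple_cons_measure set0 = 0%E.
Proof. by rewrite /tuple_cons_measure /pushforward preimage_set0 measure0. Qed.

Let tcm_ge0 A : (0 <= tuple_cons_measure A)%E.
Proof. exact: (@measure_ge0 _ _ _ (m1 \x m2)%E). Qed.

Let tcm_sigma_additive : semi_sigma_additive tuple_cons_measure.
Proof.
pose p : {measure set (n.+1.-tuple T) -> \bar R} :=
  measure_function_pushforward__canonical__measure_function_Measure
    (m1 \x m2)%E measurable_tuple_cons.
exact: (@measure_semi_sigma_additive _ _ _ p).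
Qed.

HB.instance Definition _ := isMeasure.Build _ _ _ tuple_cons_measure
  tcm0 tcm_ge0 tcm_sigma_additive.

Let tcm_sigma_finite : sigma_finite setT tuple_cons_measure.
Proof.
have /sigma_finiteP[F [TF ndF Foo]] := sigma_finiteT m1.
have /sigma_finiteP[G [TG ndG Goo]] := sigma_finiteT m2.
exists (fun k => [set t | F k (thead t) /\ G k [tuple of behead t]]).
  apply/esym; rewrite -subTset => t _.
  have [i _ Fi] : (\bigcup_i F i) (thead t) by rewrite -TF.
  have [j _ Gj] : (\bigcup_i G i) [tuple of behead t] by rewrite -TG.
  exists (maxn i j) => //; split.
    by move: (thead t) Fi; exact/subsetPset/ndF/leq_maxl.
  by move: [tuple of behead t] Gj; exact/subsetPset/ndG/leq_maxr.
move=> k; have [mF Fk] := Foo k; have [mG Gk] := Goo k; split.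
  apply: measurableI; rewrite -[X in measurable X]setTI.
    exact: measurable_tnth.
  exact: measurable_behead.
rewrite /tuple_cons_measure /pushforward (_ : _ @^-1` _ = F k `*` G k).
  by rewrite product_measure1E// lte_mul_pinfty// ge0_fin_numE.
have tK (t : n.-tuple T) x : [tuple of behead [tuple of x :: t]] = t.
  exact: val_inj.
by apply/seteqP; split => -[x t] /=; rewrite theadE tK.
Qed.

HB.instance Definition _ := Measure_isSigmaFinite.Build _ _ _
  tuple_cons_measure tcm_sigma_finite.

End tuple_cons_measure.

Section tuple_measure.
Context d (T : measurableType d) (R : realType).
Variable m : {sigma_finite_measure set T -> \bar R}.

Fixpoint tuple_measure n : {sigma_finite_measure set (n.-tuple T) -> \bar R} :=
  match n with
  | 0 => [the {sigma_finite_measure set _ -> \bar R} of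
           @dirac _ (0.-tuple T) [tuple] R]
  | n'.+1 => [the {sigma_finite_measure set _ -> \bar R} of
           tuple_cons_measure m (tuple_measure n')]
  end.

Lemma measurable_tuple_box n (A : 'I_n -> set T) :
  (forall i, measurable (A i)) ->
  measurable [set t : n.-tuple T | forall i, A i (tnth t i)].
Proof.
move=> mA; rewrite [X in measurable X](_ : _ =
    \bigcap_(i in [set: 'I_n]) ((@tnth n T ^~ i) @^-1` A i)); last first.
  by apply/seteqP; split => t /= h i; [move=> _|]; exact: h.
apply: fin_bigcap_measurable => [|i _]; first exact: finite_finset.
by rewrite -[X in measurable X]setTI; exact: measurable_tnth.
Qed.

Lemma tuple_measure_box n (A : 'I_n -> set T) : (forall i, measurable (A i)) ->
  tuple_measure n [set t | forall i, A i (tnth t i)] =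
  (\prod_(i < n) m (A i))%E.
Proof.
elim: n A => [|n IHn] A mA.
  rewrite big_ord0 /= diracE (_ : _ \in _ = true)//.
  by apply/mem_set => -[].
rewrite big_ord_recl -IHn// -product_measure1E//; last first.
  by apply: (@measurable_tuple_box n (fun i => A (lift ord0 i))) => i; exact: mA.
rewrite /= /tuple_cons_measure /pushforward; congr (_ _).
apply/seteqP; split => -[x t] /=; rewrite /tuple_cons/=.
  move=> h; split; first exact: (h ord0).
  by move=> i; have := h (lift ord0 i); rewrite tnthS.
by move=> [Ax At] i; case: (unliftP ord0 i) => [j|] -> //; rewrite tnthS; exact: At.
Qed.

End tuple_measure.

(* The cast makes the normed-module structure of the row space inferable. *)
Notation Cvec R n := 'rV[(complex R : numFieldType)]_n.

Section unit_ball.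
Context {R : realType} {n : nat}.
Implicit Types a z : Cvec R n.

Definition sqnorm z : R := complex.Re (dotmx z z).

Definition unit_ball : set (Cvec R n) := [set z | sqnorm z < 1].

(* Real coordinates of C^n: first the n real parts, then the n imaginary
   parts. Integrals over C^n are taken in these coordinates. *)
Definition complex_of_tuple (t : (n + n).-tuple R) : Cvec R n :=
  \row_k (tnth t (lshift n k) +i* tnth t (rshift n k)).

Definition lebesgueC := tuple_measure (@lebesgue_measure R) (n + n).

Definition volume_unit_ball : \bar R :=
  lebesgueC (complex_of_tuple @^-1` unit_ball).

Lemma sqnorm_complex_of_tuple t :
  sqnorm (complex_of_tuple t) = \sum_i tnth t i ^+ 2.
Proof.
rewrite /sqnorm dotmxE mxE [RHS]big_split_ord /= -big_split /=.
rewrite (big_morph (@complex.Re R) (id1 := 0) (op1 := +%R))//; last first.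
  by move=> [? ?] [? ?].
by apply: eq_bigr => k _; rewrite !mxE /= mulrN opprK -!expr2.
Qed.

Lemma measurable_unit_ball :
  measurable (complex_of_tuple @^-1` unit_ball
    : set ((n + n).-tuple (measurableTypeR R))).
Proof.
pose g (t : (n + n).-tuple (measurableTypeR R)) : measurableTypeR R :=
  \sum_i (tnth t i : R) ^+ 2.
have mg : measurable_fun setT g.
  apply: measurable_sum => i; apply: measurable_funX.
  exact: (@measurable_tnth _ (measurableTypeR R)).
rewrite [X in measurable X](_ : _ = g @^-1` `]-oo, 1[).
  by rewrite -[X in measurable X]setTI; exact: mg.
by apply/seteqP; split => t; rewrite /unit_ball /= in_itv/= sqnorm_complex_of_tuple.
Qed.

Let box (r : R) : set ((n + n).-tuple (measurableTypeR R)) :=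
  [set t | forall i, `]- r, r[%classic (tnth t i)].

Let measurable_box r : measurable (box r).
Proof. by apply: (@measurable_tuple_box _ _ _ (fun=> `]- r, r[%classic)) => i. Qed.

Let volume_box r : 0 < r ->
  (0 < lebesgueC (box r))%E /\ (lebesgueC (box r) < +oo)%E.
Proof.
move=> r0.
pose I : set R := `]- r, r[%classic.
have -> : lebesgueC (box r) = (\prod_(i < n + n) (@lebesgue_measure R) I)%E.
  rewrite -(@tuple_measure_box _ _ _ (@lebesgue_measure R) _ (fun=> I))//.
  by move=> _; exact: measurable_itv.
rewrite /I lebesgue_measure_itv/= lte_fin gtrN// -EFinD opprK; split.
  by elim/big_ind : _ => // *; rewrite ?mule_gt0// lte_fin addr_gt0.
rewrite ltey_eq; apply/orP; left.
by elim/big_ind : _ => // *; rewrite fin_numM.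
Qed.

Lemma volume_unit_ball_gt0 : (0 < volume_unit_ball)%E.
Proof.
pose r : R := (n + n).+1%:R^-1.
have r0 : 0 < r by rewrite invr_gt0.
have [+ _] := volume_box r0; move/lt_le_trans; apply.
apply: le_measure; rewrite ?inE//; first exact: measurable_unit_ball.
move=> t tr; rewrite /= /unit_ball /= sqnorm_complex_of_tuple.
have r1 : r <= 1 by rewrite invf_le1// ler1n.
apply: (@le_lt_trans _ _ (\sum_(i < n + n) r)).
  apply: ler_sum => i _; have := tr i; rewrite /= in_itv/= -ltr_norml => /ltW h.
  rewrite -real_normK ?num_real// expr2.
  by rewrite (le_trans (ler_pM _ _ h (le_trans h r1)))// mulr1.
rewrite sumr_const card_ord -mulr_natr mulrC ltr_pdivrMr// mul1r.
by rewrite ltr_nat.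
Qed.

Lemma volume_unit_ball_lty : (volume_unit_ball < +oo)%E.
Proof.
have [_] := volume_box (@ltr01 R); apply: le_lt_trans.
apply: le_measure; rewrite ?inE//; first exact: measurable_unit_ball.
move=> t; rewrite /= /unit_ball /= sqnorm_complex_of_tuple => t1 i.
rewrite /= in_itv/= -ltr_norml -(@ltr_pXn2r _ 2)// ?nnegrE//.
rewrite expr1n real_normK ?num_real// (le_lt_trans _ t1)//.
by rewrite (bigD1 i)//= lerDl sumr_ge0// => j _; exact: sqr_ge0.
Qed.

Lemma volume_factor_ge0 : 0 <= (fine volume_unit_ball)^-1.
Proof. by rewrite invr_ge0 fine_ge0// measure_ge0. Qed.

Definition dV := mscale (NngNum volume_factor_ge0) lebesgueC.

Lemma dV_unit_ball : dV (complex_of_tuple @^-1` unit_ball) = 1%E.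
Proof.
have vfin : volume_unit_ball \is a fin_num.
  by rewrite ge0_fin_numE ?volume_unit_ball_lty// ltW// volume_unit_ball_gt0.
rewrite /dV /mscale -/volume_unit_ball -[X in (_ * X)%E]fineK// -EFinM /=.
by rewrite mulVf// fine_eq0// gt_eqF// volume_unit_ball_gt0.
Qed.

(* Functions on the unit ball are represented by total functions; their values
   outside the ball are irrelevant. *)
Definition holomorphic_on_ball (f : Cvec R n -> R[i]^o) :=
  forall z, unit_ball z -> differentiable f z.

(* proj_ortho a acts on row vectors from the right; it is 0 when a = 0. *)
Definition Phi a z : Cvec R n :=
  let P := proj_ortho a in
  let Q := 1%:M - P in
  (1 - dotmx z a)^-1 *:
    (a - z *m P - (Num.sqrt (1 - sqnorm a))%:C *: (z *m Q)).

(* The last factor is the density of dlambda with respect to dV. *)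
Definition Nintegral (p q s : R) (f : Cvec R n -> R[i]^o) a : \bar R :=
  (\int[dV]_(t in complex_of_tuple @^-1` unit_ball)
     let z := complex_of_tuple t in
     (ComplexField.Normc.normc (f z) `^ p * (1 - sqnorm z) `^ q
      * (1 - sqnorm (Phi a z)) `^ (n%:R * s)
      / (1 - sqnorm z) ^+ n.+1)%:E)%E.

Definition Nnormp p q s f : \bar R :=
  ereal_sup [set Nintegral p q s f a | a in unit_ball].

Definition Nspace p q s : set (Cvec R n -> R[i]^o) :=
  [set f | holomorphic_on_ball f /\ (Nnormp p q s f < +oo)%E].

Definition Nnorm p q s f : R := fine (Nnormp p q s f) `^ p^-1.

(* bounded_ext makes A an operator on functions restricted to the unit ball. *)
Record bounded_linear_operator (E : set (Cvec R n -> R[i]^o))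
    (nrm : (Cvec R n -> R[i]^o) -> R)
    (A : (Cvec R n -> R[i]^o) -> Cvec R n -> R[i]^o) : Prop := {
  bounded_ext : forall f g, E f -> E g ->
    (forall z, unit_ball z -> f z = g z) ->
    forall z, unit_ball z -> A f z = A g z ;
  bounded_stable : forall f, E f -> E (A f) ;
  bounded_linear : forall (c : R[i]) f g, E f -> E g ->
    forall z, unit_ball z ->
      A (fun w => c * f w + g w) z = c * A f z + A g z ;
  bounded_norm : exists M : R, forall f, E f -> nrm (A f) <= M * nrm f
}.

Definition integral01 (g : R -> R[i]) : R[i] :=
  (\int[lebesgue_measure]_(t in `[0, 1]) complex.Re (g t)) +i*
  (\int[lebesgue_measure]_(t in `[0, 1]) complex.Im (g t)).

Definition partial_derivative (k : 'I_n) (f : Cvec R n -> R[i]^o) z : R[i] :=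
  'D_(delta_mx 0 k) f z.

End unit_ball.

(* Main.v *)
Require Import Defs.
From HB Require Import structures.
From mathcomp Require Import all_boot all_order all_algebra.
From mathcomp Require Import spectral complex ring lra.
From mathcomp Require Import all_classical all_reals all_analysis.
From mathcomp Require Import measurable_realfun.

(** The operator A_k averages the partial derivative d_k f along the ray from
    the origin. By the fundamental theorem of calculus (holo_ray_formula) f z - f 0
    is the sum of the z_k A_k f z, so everything lies in the boundedness of A_k.

    Put delta z = 1 - |z|, X = |1 - <z,a>|, al = q + ns - n - 1 and sg = ns. The
    identity sqnorm_Phi turns the p-th power of the norm, up to constants, into the
    supremum over a of the integral of |f|^p against
      weight = (delta z)^al * (delta a)^sg * X^(- 2 sg),
    and the hypotheses on s say that sg > 0 and al > -1.

    The function |f|^p has the sub-mean value property over circled sets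
    (submean_set). With a = w and a tube around w that is adapted to the geometry of
    the sphere it gives |f w|^p <= C N (delta w)^(-q), N the p-th power of the norm
    of f (growth_estimate). By Cauchy's estimates delta |d_k f| has the same growth
    (derivative_growth), and its p-th power at w is at most a constant times the
    mean of |f|^p over the ball of radius delta w / 2 (derivative_local). Jensen's
    inequality along the ray, with a small power eta of delta z given away, bounds
    |A_k f z|^p by
      (delta z)^(-eta) * integral of (delta (tz))^(eta - 1) (delta |d_k f|)^p (tz) dt
    (ray_jensen), and this is integrated against the weight. The ray is cut where
    delta (tz) = X. Where delta (tz) < X, the point tz and the ball around it are so
    close to z that the weight at z may be replaced, up to powers of delta, by the
    weight at the points of that ball; the local bound on the derivative and
    Tonelli's theorem give back the integral of |f|^p against the weight
    (near_estimate). Where delta (tz) >= X, the growth of the derivative suffices: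
    the integral along the ray is at most a negative power of X, and the
    Forelli-Rudin estimate (forelli_rudin) integrates it over the ball
    (far_estimate).

    Volumes are obtained from the invariance of Lebesgue measure alone. An additive
    bijection multiplies it by a constant (tuple_integral_haar), which is found from
    the ball or from a cube; the volume of a slab is proportional to its width
    (Vol_slab), which gives the volume of tubes; and averaging over dilations
    reduces the integral of a power of delta over a boundary layer to a volume
    (boundary_layer).

    Holomorphy means complex differentiability. The mean value property and Cauchy's
    estimates in one variable are therefore derived from Goursat's theorem
    (goursat_rect, circle_mean, cauchy_estimate) and carried to several variables
    along complex lines. A locally uniform limit of holomorphic functions is
    holomorphic (weierstrass); applied to difference quotients and to Riemann sums
    it shows that d_k f and A_k f are holomorphic. *)

Set Implicit Arguments.
Unset Strict Implicit.
Unset Printing Implicit Defensive.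
Import Order.TTheory GRing.Theory Num.Theory.
Import numFieldNormedType.Exports.

Local Open Scope classical_set_scope.
Local Open Scope complex_scope.
Local Open Scope ring_scope.

(** * Moduli of complex numbers *)

Notation normc := ComplexField.Normc.normc.

Section modulus.
Context {R : realType}.
Implicit Types z w : R[i].

Lemma normc_norm z : (normc z)%:C = `|z|.
Proof. by case: z. Qed.

Lemma normc_ge0 z : 0 <= normc z.
Proof. by case: z => a b; exact: sqrtr_ge0. Qed.

Lemma normcD z w : normc (z + w) <= normc z + normc w.
Proof. by rewrite -lecR rmorphD /= !normc_norm ler_normD. Qed.

Lemma normcN z : normc (- z) = normc z.
Proof. by apply: complexI; rewrite !normc_norm normrN. Qed.

Lemma normcB z w : normc (z - w) = normc (w - z).
Proof. by rewrite -normcN opprB. Qed.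

Lemma normc_real (x : R) : normc x%:C = `|x|.
Proof. by rewrite /= expr0n addr0 sqrtr_sqr. Qed.

Lemma normc0 : normc (0 : R[i]) = 0.
Proof. exact: ComplexField.Normc.normc0. Qed.

Lemma normc1 : normc (1 : R[i]) = 1.
Proof. exact: ComplexField.Normc.normc1. Qed.

Lemma normci : normc ('i : R[i]) = 1.
Proof. by rewrite /= expr0n expr1n add0r sqrtr1. Qed.

Lemma normc_sum I (r : seq I) (P : pred I) (F : I -> R[i]) :
  normc (\sum_(i <- r | P i) F i) <= \sum_(i <- r | P i) normc (F i).
Proof.
elim/big_rec2 : _ => [|i x y _ h]; first by rewrite normc0.
by rewrite (le_trans (normcD _ _))// lerD2l.
Qed.

Lemma Re_le_normc z : `|complex.Re z| <= normc z.
Proof.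
case: z => a b /=; rewrite -sqrtr_sqr ler_wsqrtr// lerDl; exact: sqr_ge0.
Qed.

Lemma Im_le_normc z : `|complex.Im z| <= normc z.
Proof.
case: z => a b /=; rewrite -sqrtr_sqr ler_wsqrtr// lerDr; exact: sqr_ge0.
Qed.

Lemma normc_le z : normc z <= `|complex.Re z| + `|complex.Im z|.
Proof.
rewrite {1}(complexE z) (le_trans (normcD _ _))// ComplexField.Normc.normcM.
by rewrite normci mul1r !normc_real.
Qed.

Lemma cReD z w : complex.Re (z + w) = complex.Re z + complex.Re w.
Proof. by case: z; case: w. Qed.
Lemma cImD z w : complex.Im (z + w) = complex.Im z + complex.Im w.
Proof. by case: z; case: w. Qed.
Lemma cReN z : complex.Re (- z) = - complex.Re z.
Proof. by case: z. Qed.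
Lemma cImN z : complex.Im (- z) = - complex.Im z.
Proof. by case: z. Qed.
Lemma cReM z w : complex.Re (z * w) =
  complex.Re z * complex.Re w - complex.Im z * complex.Im w.
Proof. by case: z; case: w. Qed.
Lemma cImM z w : complex.Im (z * w) =
  complex.Re z * complex.Im w + complex.Im z * complex.Re w.
Proof. by case: z; case: w. Qed.

Lemma complex_ext z w :
  complex.Re z = complex.Re w -> complex.Im z = complex.Im w -> z = w.
Proof. by case: z => a b; case: w => c d /= -> ->. Qed.

End modulus.

(** * Integrals of complex-valued functions of a real variable *)

Section integrals.
Context {R : realType}.
Notation mu := (@lebesgue_measure R).

(** Continuity for the modulus, in the real-valued form used by the estimates. *)
Definition ccont (g : R -> R[i]) (x : R) := forall e : R, 0 < e ->
  exists2 d, 0 < d & forall y, `|y - x| < d -> normc (g y - g x) < e.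

Lemma ccontP g x : ccont g x ->
  {for x, continuous (fun y => complex.Re (g y))} /\ {for x, continuous (fun y => complex.Im (g y))}.
Proof.
move=> gx; split; apply/cvgrPdist_lt => e e0; have [d d0 gd] := gx _ e0;
  near=> y; rewrite /=.
- rewrite -cReN -cReD; apply: le_lt_trans (Re_le_normc _) _.
  rewrite -normcB; apply: gd; rewrite distrC; near: y; by exists d.
- rewrite -cImN -cImD; apply: le_lt_trans (Im_le_normc _) _.
  rewrite -normcB; apply: gd; rewrite distrC; near: y; by exists d.
Unshelve. all: by end_near. Qed.

Lemma ccont_integrable g (a b : R) : (forall x, a <= x <= b -> ccont g x) ->
  mu.-integrable `[a, b] (EFin \o (fun y => complex.Re (g y))) /\
  mu.-integrable `[a, b] (EFin \o (fun y => complex.Im (g y))).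
Proof.
move=> gc; split; apply: continuous_compact_integrable;
  try exact: segment_compact; apply: continuous_in_subspaceT => x;
  rewrite inE/= in_itv/= => xab; by have [] := ccontP (gc _ xab).
Qed.

Definition cint (a b : R) (g : R -> R[i]) : R[i] :=
  (\int[mu]_(t in `[a, b]) complex.Re (g t)) +i*
  (\int[mu]_(t in `[a, b]) complex.Im (g t)).

Lemma eq_cint a b f g : (forall x, a <= x <= b -> f x = g x) ->
  cint a b f = cint a b g.
Proof.
by move=> fg; congr (_ +i* _); apply: eq_Rintegral => x;
  rewrite inE/= in_itv/= => /fg ->.
Qed.

Lemma cintD a b f g : (forall x, a <= x <= b -> ccont f x) ->
  (forall x, a <= x <= b -> ccont g x) ->
  cint a b (fun x => f x + g x) = cint a b f + cint a b g.
Proof.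
move=> /ccont_integrable[f1 f2] /ccont_integrable[g1 g2].
apply: complex_ext; rewrite ?cReD ?cImD /= -RintegralD//;
  by apply: eq_Rintegral => x _; rewrite ?cReD ?cImD.
Qed.

Lemma ccont_cst c x : ccont (fun=> c) x.
Proof. by move=> e e0; exists 1 => // y _; rewrite subrr normc0. Qed.

Lemma ccontD f g x : ccont f x -> ccont g x -> ccont (fun x => f x + g x) x.
Proof.
move=> fx gx e e0; have e2 : 0 < e / 2 by rewrite divr_gt0.
have [d d0 fd] := fx _ e2; have [d' d'0 gd] := gx _ e2.
exists (Num.min d d'); first by rewrite lt_min d0.
move=> y; rewrite lt_min => /andP[/fd h /gd h'].
rewrite opprD addrACA (le_lt_trans (normcD _ _))// [e]splitr.
exact: ltrD.
Qed.

Lemma ccontZ c f x : ccont f x -> ccont (fun x => c * f x) x.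
Proof.
move=> fx e e0; have c0 : 0 < normc c + 1 by rewrite ltr_wpDl// normc_ge0.
have [d d0 fd] := fx _ (divr_gt0 e0 c0); exists d => // y /fd h.
rewrite -mulrBr ComplexField.Normc.normcM.
move: h; rewrite ltr_pdivlMr// mulrC; apply: le_lt_trans.
by rewrite ler_wpM2r// ?normc_ge0// lerDl.
Qed.

Lemma cint_cst a b c : a <= b -> cint a b (fun=> c) = (b - a)%:C * c.
Proof.
move=> ab; case: c => u v; rewrite /cint /= !Rintegral_cst//=.
have -> : fine (mu `[a, b]) = b - a.
  rewrite lebesgue_measure_itv/= lte_fin; case: ltP => //= ba.
  by rewrite (@le_anti _ _ a b) ?subrr// ab.
by apply: complex_ext; rewrite /= ?mul0r ?subr0 ?addr0 mulrC.
Qed.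

Lemma cintZ a b c f : (forall x, a <= x <= b -> ccont f x) ->
  cint a b (fun x => c * f x) = c * cint a b f.
Proof.
move=> /ccont_integrable[f1 f2]; case: c => u v.
apply: complex_ext => /=.
  under eq_Rintegral do rewrite cReM.
  rewrite /= RintegralB ?RintegralZl//;
    by [exact: (integrableZl _ u f1)|exact: (integrableZl _ v f2)].
under eq_Rintegral do rewrite cImM.
rewrite /= RintegralD ?RintegralZl//;
  by [exact: (integrableZl _ u f2)|exact: (integrableZl _ v f1)].
Qed.

Lemma cintB a b f g : (forall x, a <= x <= b -> ccont f x) ->
  (forall x, a <= x <= b -> ccont g x) ->
  cint a b (fun x => f x - g x) = cint a b f - cint a b g.
Proof.
move=> fc gc; rewrite -[- cint a b g]mulN1r -cintZ// -cintD//.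
  by apply: eq_cint => x _; rewrite mulN1r.
by move=> x xab; exact/ccontZ/gc.
Qed.

Lemma cint_split a m b f : a <= m <= b ->
  (forall x, a <= x <= b -> ccont f x) ->
  cint a b f = cint a m f + cint m b f.
Proof.
move=> /andP[am mb] /ccont_integrable[f1 f2].
have key h : mu.-integrable `[a, b] (EFin \o h) ->
  \int[mu]_(t in `[a, b]) h t =
  \int[mu]_(t in `[a, m]) h t + \int[mu]_(t in `[m, b]) h t.
  move=> ih.
  have := @Rintegral_itvB R h (BLeft a) (BRight b) m.
  move=> /(_ ih); rewrite !bnd_simp => /(_ am mb).
  rewrite (@Rintegral_itv_obnd_cbnd _ m)// => [<-|].
    by rewrite addrC subrK.
  apply: integrableS ih => //; apply: subset_itvr; by rewrite bnd_simp.
by rewrite /cint !key.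
Qed.

Lemma cint_le a b f M : a <= b -> (forall x, a <= x <= b -> ccont f x) ->
  (forall x, a <= x <= b -> normc (f x) <= M) ->
  normc (cint a b f) <= 2 * ((b - a) * M).
Proof.
move=> ab fc fM; have [f1 f2] := ccont_integrable fc.
have key h : mu.-integrable `[a, b] (EFin \o h) ->
    (forall x, a <= x <= b -> `|h x| <= M) ->
  `|\int[mu]_(t in `[a, b]) h t| <= (b - a) * M.
  move=> ih hM; apply: le_trans (le_normr_Rintegral _ ih) _ => //.
  apply: (@le_trans _ _ (\int[mu]_(t in `[a, b]) (cst M t))).
    apply: le_Rintegral => //.
      exact: integrable_norm.
      by have [] := @ccont_integrable (fun=> M%:C) a b (fun _ _ => ccont_cst _ _).
  rewrite Rintegral_cst//= lebesgue_measure_itv/= lte_fin; case: ltP => //=.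
    by rewrite mulrC.
  by move=> ba; rewrite (@le_anti _ _ a b) ?ab// subrr mulr0 mul0r.
rewrite (le_trans (normc_le _))//= mulr_natl mulr2n.
rewrite lerD// key// => x /fM; apply: le_trans; [exact: Re_le_normc|exact: Im_le_normc].
Qed.

End integrals.

(** * Goursat's theorem and the mean value property in one variable *)

Section goursat.
Context {R : realType}.
Implicit Types (g : R[i] -> R[i]) (z D : R[i]).

(** Complex differentiability, with real epsilons and the real-valued modulus. *)
Definition cdiff g z D := forall e : R, 0 < e -> exists2 d, 0 < d &
  forall h, normc h < d -> normc (g (z + h) - g z - D * h) <= e * normc h.

Lemma cdiff_cont g z D : cdiff g z D -> forall e : R, 0 < e ->
  exists2 d, 0 < d & forall h, normc h < d -> normc (g (z + h) - g z) < e.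
Proof.
move=> /(_ _ ltr01)[d d0 gd] e e0.
have c0 : 0 < normc D + 1 by rewrite ltr_wpDl// normc_ge0.
exists (Num.min d (e / (normc D + 1))).
  by rewrite lt_min d0 divr_gt0.
move=> h; rewrite lt_min => /andP[/gd hd].
rewrite ltr_pdivlMr// => he.
rewrite -[_ - g z](subrK (D * h)) (le_lt_trans (normcD _ _))//.
rewrite ComplexField.Normc.normcM (le_lt_trans _ he)//.
by rewrite mul1r in hd; rewrite mulrDr mulr1 addrC mulrC lerD2l.
Qed.

Lemma cdiff_ccont g (z v : R[i]) (t : R) D : cdiff g (z + t%:C * v) D ->
  ccont (fun t => g (z + t%:C * v)) t.
Proof.
move=> /cdiff_cont gd e e0; have [d d0 {}gd] := gd _ e0.
have c0 : 0 < normc v + 1 by rewrite ltr_wpDl// normc_ge0.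
exists (d / (normc v + 1)); first exact: divr_gt0.
move=> y; rewrite ltr_pdivlMr// => yd.
have -> : z + y%:C * v = z + t%:C * v + (y - t)%:C * v.
  by rewrite -addrA -mulrDl -rmorphD /= subrKC.
apply: gd; rewrite ComplexField.Normc.normcM normc_real.
by rewrite (le_lt_trans _ yd)// ler_wpM2l// lerDl.
Qed.

Lemma cdiff_ccont_hor g (x c : R) D : cdiff g (x +i* c) D ->
  ccont (fun t => g (t +i* c)) x.
Proof.
have E (t : R) : t +i* c = (0 +i* c) + t%:C * 1.
  by apply: complex_ext => /=; ring.
move=> gx; rewrite (_ : (fun t => g (t +i* c)) =
  fun t => g ((0 +i* c) + t%:C * 1)); last by apply/funext => t; rewrite -E.
by apply: (cdiff_ccont (D := D)); rewrite -E.
Qed.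

Lemma cdiff_ccont_ver g (c y : R) D : cdiff g (c +i* y) D ->
  ccont (fun t => g (c +i* t)) y.
Proof.
have E (t : R) : c +i* t = c%:C + t%:C * 'i.
  by apply: complex_ext => /=; ring.
move=> gx; rewrite (_ : (fun t => g (c +i* t)) =
  fun t => g (c%:C + t%:C * 'i)); last by apply/funext => t; rewrite -E.
by apply: (cdiff_ccont (D := D)); rewrite -E.
Qed.

Definition rect_integral g (a b c d : R) : R[i] :=
  cint a b (fun x => g (x +i* c) - g (x +i* d)) +
  'i * cint c d (fun y => g (b +i* y) - g (a +i* y)).

Definition holo_rect g (a b c d : R) := forall x y,
  a <= x <= b -> c <= y <= d -> exists D, cdiff g (x +i* y) D.

Lemma ccontB (f h : R -> R[i]) x : ccont f x -> ccont h x ->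
  ccont (fun y => f y - h y) x.
Proof.
move=> fx hx; apply: ccontD => // e e0.
have [d d0 dP] := hx _ e0; exists d => // y /dP.
by rewrite -opprD normcN.
Qed.

Let hor_cont g a b c d y : holo_rect g a b c d -> c <= y <= d ->
  forall x, a <= x <= b -> ccont (fun t => g (t +i* y)) x.
Proof. by move=> gh cyd x axb; have [D /cdiff_ccont_hor] := gh _ _ axb cyd. Qed.

Let ver_cont g a b c d x : holo_rect g a b c d -> a <= x <= b ->
  forall y, c <= y <= d -> ccont (fun t => g (x +i* t)) y.
Proof. by move=> gh axb y cyd; have [D /cdiff_ccont_ver] := gh _ _ axb cyd. Qed.

Lemma rect_integral_splitx g a m b c d : holo_rect g a b c d ->
  a <= m <= b -> c <= d ->
  rect_integral g a b c d = rect_integral g a m c d + rect_integral g m b c d.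
Proof.
move=> gh amb cd; have /andP[am mb] := amb.
have ab := le_trans am mb.
have cc : c <= c <= d by rewrite lexx.
have dd : c <= d <= d by rewrite lexx andbT.
have aa : a <= a <= b by rewrite lexx.
have bb : a <= b <= b by rewrite lexx andbT.
rewrite /rect_integral (cint_split amb); last first.
  by move=> x axb; apply: ccontB; [exact: (hor_cont gh)|exact: (hor_cont gh)].
rewrite addrACA -mulrDr -cintD; last 2 first.
- by move=> y cyd; apply: ccontB; exact: (ver_cont gh).
- by move=> y cyd; apply: ccontB; exact: (ver_cont gh).
by congr (_ + _ * _); apply: eq_cint => y _; ring.
Qed.

Lemma rect_integral_splity g a b c m d : holo_rect g a b c d ->
  a <= b -> c <= m <= d ->
  rect_integral g a b c d = rect_integral g a b c m + rect_integral g a b m d.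
Proof.
move=> gh ab cmd; have /andP[cm md] := cmd.
have cd := le_trans cm md.
have cc : c <= c <= d by rewrite lexx.
have dd : c <= d <= d by rewrite lexx andbT.
have aa : a <= a <= b by rewrite lexx.
have bb : a <= b <= b by rewrite lexx andbT.
rewrite /rect_integral (cint_split cmd); last first.
  by move=> x axb; apply: ccontB; [exact: (ver_cont gh)|exact: (ver_cont gh)].
rewrite mulrDr addrACA -cintD; last 2 first.
- by move=> y cyd; apply: ccontB; exact: (hor_cont gh).
- by move=> y cyd; apply: ccontB; exact: (hor_cont gh).
by congr (_ + _); apply: eq_cint => y _; ring.
Qed.

Lemma holo_rectS g a b c d a' b' c' d' : holo_rect g a b c d ->
  a <= a' -> b' <= b -> c <= c' -> d' <= d -> holo_rect g a' b' c' d'.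
Proof.
move=> gh aa bb cc dd x y /andP[ax xb] /andP[cy yd]; apply: gh.
  by rewrite (le_trans aa)//= (le_trans xb).
by rewrite (le_trans cc)//= (le_trans yd).
Qed.

(** Affine functions have integral 0 around the rectangle, so only the remainder
    of the first-order expansion of g at z contributes. *)
Lemma rect_integral_small g a b c d z D e : holo_rect g a b c d ->
  a <= b -> c <= d ->
  (forall x y, a <= x <= b -> c <= y <= d ->
    normc (g (x +i* y) - g z - D * ((x +i* y) - z)) <= e) ->
  normc (rect_integral g a b c d) <= 4 * ((b - a) + (d - c)) * e.
Proof.
move=> gh ab cd ge.
pose r w := g w - g z - D * (w - z).
have cc : c <= c <= d by rewrite lexx.
have dd : c <= d <= d by rewrite lexx andbT.
have aa : a <= a <= b by rewrite lexx.
have bb : a <= b <= b by rewrite lexx andbT.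
have rh x y : c <= y <= d -> a <= x <= b ->
    normc (r (x +i* y) ) <= e by move=> ? ?; exact: ge.
have hc x : a <= x <= b -> ccont (fun x => g (x +i* c) - g (x +i* d)) x.
  by move=> axb; apply: ccontB; exact: (hor_cont gh).
have vc y : c <= y <= d -> ccont (fun y => g (b +i* y) - g (a +i* y)) y.
  by move=> cyd; apply: ccontB; exact: (ver_cont gh).
have E1 (x : R) : r (x +i* c) - r (x +i* d) =
    g (x +i* c) - g (x +i* d) - D * (0 -i* (d - c)).
  have -> : (0 -i* (d - c))%C = (x +i* c) - (x +i* d).
    by apply: complex_ext; rewrite ?cReD ?cImD ?cReN ?cImN /=; ring.
  by rewrite /r; ring.
have E2 (y : R) : r (b +i* y) - r (a +i* y) =
    g (b +i* y) - g (a +i* y) - D * (b - a)%:C.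
  have -> : (b - a)%:C = (b +i* y) - (a +i* y).
    by apply: complex_ext; rewrite ?cReD ?cImD ?cReN ?cImN /=; ring.
  by rewrite /r; ring.
have -> : rect_integral g a b c d =
  cint a b (fun x => r (x +i* c) - r (x +i* d)) +
  'i * cint c d (fun y => r (b +i* y) - r (a +i* y)).
  under [in RHS]eq_cint do rewrite E1.
  rewrite [X in X + 'i * _](cintB (g := fun=> D * (0 -i* (d - c)))
    hc (fun _ _ => ccont_cst _ _)).
  under [X in 'i * X]eq_cint do rewrite E2.
  rewrite [X in 'i * X](cintB (g := fun=> D * (b - a)%:C)
    vc (fun _ _ => ccont_cst _ _)).
  rewrite !cint_cst// /rect_integral.
  have -> : (0 -i* (d - c))%C = - ('i * (d - c)%:C).
    by apply: complex_ext; rewrite ?cReN ?cImN ?cReM ?cImM /=; ring.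
  by ring.
rewrite (le_trans (normcD _ _))// ComplexField.Normc.normcM normci mul1r.
have -> : 4 * (b - a + (d - c)) * e =
   2 * ((b - a) * (e + e)) + 2 * ((d - c) * (e + e)) by ring.
apply: lerD; apply: cint_le => //.
- move=> x axb e1 e10; have [dl dl0 dlP] := hc x axb _ e10.
  by exists dl => // y /dlP; rewrite !E1; congr (normc _ < _); ring.
- by move=> x axb; rewrite (le_trans (normcD _ _))// normcN lerD// rh.
- move=> x axb e1 e10; have [dl dl0 dlP] := vc x axb _ e10.
  by exists dl => // y /dlP; rewrite !E2; congr (normc _ < _); ring.
- by move=> x axb; rewrite (le_trans (normcD _ _))// normcN lerD// rh.
Qed.

Let le_sum4 (q x1 x2 x3 x4 : R) : q <= x1 + x2 + (x3 + x4) ->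
  [\/ q <= 4 * x1, q <= 4 * x2, q <= 4 * x3 | q <= 4 * x4].
Proof.
have [?|?] := leP q (4 * x1); first by constructor 1.
have [?|?] := leP q (4 * x2); first by constructor 2.
have [?|?] := leP q (4 * x3); first by constructor 3.
have [?|?] := leP q (4 * x4); first by constructor 4.
lra.
Qed.

(** The Goursat argument: quartering keeps at least a quarter of the integral,
    while differentiability at the common point of the nested rectangles makes
    the integral small compared with the square of their size. *)
Theorem goursat_rect g a b c d : holo_rect g a b c d -> a <= b -> c <= d ->
  rect_integral g a b c d = 0.
Proof.
move=> gh ab cd.
pose w j := (b - a) / 2 ^+ j; pose h j := (d - c) / 2 ^+ j.
have w_ge0 j : 0 <= w j by rewrite divr_ge0 ?subr_ge0// exprn_ge0.
have h_ge0 j : 0 <= h j by rewrite divr_ge0 ?subr_ge0// exprn_ge0.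
have halve u j : (u / 2 ^+ j : R) = u / 2 ^+ j.+1 + u / 2 ^+ j.+1.
  have e0 : (2 ^+ j : R) != 0 by rewrite expf_eq0 pnatr_eq0 andbF.
  by rewrite exprS; field.
have wS j : w j = w j.+1 + w j.+1 by exact: halve.
have hS j : h j = h j.+1 + h j.+1 by exact: halve.
pose Q j (u : R * R) := rect_integral g u.1 (u.1 + w j) u.2 (u.2 + h j).
pose inr j (u : R * R) := [/\ a <= u.1, u.1 + w j <= b, c <= u.2 & u.2 + h j <= d].
pose rel (u v : nat * (R * R)) := inr u.1 u.2 ->
  [/\ v.1 = u.1.+1, inr v.1 v.2,
     u.2.1 <= v.2.1 /\ v.2.1 + w v.1 <= u.2.1 + w u.1,
     u.2.2 <= v.2.2 /\ v.2.2 + h v.1 <= u.2.2 + h u.1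
   & normc (Q u.1 u.2) <= 4 * normc (Q v.1 v.2)].
(* one of the four quarters carries at least a quarter of the integral *)
have step u : {v | rel u v}.
  apply: cid; case: u => j u.
  have [[ua ub uc ud]|] := pselect (inr j u); last by exists (0%N, u).
  have wj := wS j; have hj := hS j; have w0 := w_ge0 j.+1; have h0 := h_ge0 j.+1.
  have ghu : holo_rect g u.1 (u.1 + w j) u.2 (u.2 + h j).
    exact: holo_rectS gh _ _ _ _.
  pose u1 := u; pose u2 := (u.1 + w j.+1, u.2).
  pose u3 := (u.1, u.2 + h j.+1); pose u4 := (u.1 + w j.+1, u.2 + h j.+1).
  have Qs : Q j u = Q j.+1 u1 + Q j.+1 u2 + (Q j.+1 u3 + Q j.+1 u4).
    rewrite /Q (@rect_integral_splity _ _ _ _ (u.2 + h j.+1))//; last 2 first.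
    - by rewrite lerDl.
    - by rewrite lerDl h0 lerD2l; lra.
    rewrite (@rect_integral_splitx _ _ (u.1 + w j.+1)); last 3 first.
    - by apply: holo_rectS ghu _ _ _ _; lra.
    - by rewrite lerDl w0 lerD2l; lra.
    - by rewrite lerDl.
    rewrite (@rect_integral_splitx _ _ (u.1 + w j.+1) _ (u.2 + h j.+1)); last 3 first.
    - by apply: holo_rectS ghu _ _ _ _; lra.
    - by rewrite lerDl w0 lerD2l; lra.
    - by rewrite lerD2l; lra.
    by rewrite /u1 /u2 /u3 /u4 /= -!addrA -wS -hS.
  have Qle : normc (Q j u) <= normc (Q j.+1 u1) + normc (Q j.+1 u2) +
      (normc (Q j.+1 u3) + normc (Q j.+1 u4)).
    by rewrite Qs (le_trans (normcD _ _))// lerD// normcD.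
  have [v [vQ v1 v2]] : exists v, [/\ normc (Q j u) <= 4 * normc (Q j.+1 v),
      v.1 = u.1 \/ v.1 = u.1 + w j.+1 & v.2 = u.2 \/ v.2 = u.2 + h j.+1].
    have [H|H|H|H] := le_sum4 Qle; [exists u1|exists u2|exists u3|exists u4];
      by split => //=; by [left|right].
  exists (j.+1, v) => _; split => //=.
  - by clear -v1 v2 ua ub uc ud wj hj w0 h0; split; case: v1 => v1e; case: v2 => v2e; lra.
  - by clear -v1 wj w0; split; case: v1 => v1e; lra.
  - by clear -v2 hj h0; split; case: v2 => v2e; lra.
have [s [s0 sS]] := dependent_choice step (0%N, (a, c)).
have inv j : (s j).1 = j /\ inr j (s j).2.
  elim: j => [|j [sj1 sjr]].
    by rewrite s0; split => //; rewrite /inr /w /h /= expr0 !divr1; split; lra.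
  have := sS j; rewrite /rel sj1 => /(_ sjr)[-> ? _ _ _]; by split.
have st j : [/\ (s j).2.1 <= (s j.+1).2.1 /\ (s j.+1).2.1 + w j.+1 <= (s j).2.1 + w j,
     (s j).2.2 <= (s j.+1).2.2 /\ (s j.+1).2.2 + h j.+1 <= (s j).2.2 + h j
   & normc (Q j (s j).2) <= 4 * normc (Q j.+1 (s j.+1).2)].
  have [sj1 sjr] := inv j; have [sj1' sjr'] := inv j.+1.
  by have := sS j; rewrite /rel sj1 sj1' => /(_ sjr)[_ _ ? ? ?].
have Qj j : normc (rect_integral g a b c d) <= 4 ^+ j * normc (Q j (s j).2).
  elim: j => [|j IH].
    rewrite s0 expr0 mul1r /Q /w /h /= expr0 !divr1.
    by rewrite (addrC a) (addrC c) !subrK.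
  apply: le_trans IH _; rewrite exprSr -mulrA; apply: ler_wpM2l; first exact: exprn_ge0.
  by have [] := st j.
have nest (f l : nat -> R) : (forall j, 0 <= l j) ->
    (forall j, f j <= f j.+1 /\ f j.+1 + l j.+1 <= f j + l j) ->
    exists x, forall j, f j <= x <= f j + l j.
  move=> l0 fl.
  have fle j k : f j <= f (j + k)%N /\ f (j + k)%N + l (j + k)%N <= f j + l j.
    elim: k => [|k [IH1 IH2]]; first by rewrite addn0.
    have [? ?] := fl (j + k)%N; rewrite addnS.
    by split; [exact: le_trans IH1 _|exact: le_trans IH2].
  have fub j : ubound (range f) (f j + l j).
    move=> _ [k _ <-]; have [jk|/ltnW kj] := leqP j k.
      have [_] := fle j (k - j)%N; rewrite subnKC// => /(le_trans _); apply.
      by rewrite lerDl.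
    have [h1 _] := fle k (j - k)%N; rewrite subnKC// in h1.
    by rewrite (le_trans h1)// lerDl.
  have hs : has_sup (range f).
    by split; [exists (f 0%N), 0%N|exists (f 0%N + l 0%N); exact: fub].
  exists (sup (range f)) => j; apply/andP; split.
    by apply: ub_le_sup; [case: hs|exists j].
  by apply: ge_sup; [case: hs|exact: fub].
have [x xP] := nest (fun j => (s j).2.1) w w_ge0 (fun j => let: And3 H _ _ := st j in H).
have [y yP] := nest (fun j => (s j).2.2) h h_ge0 (fun j => let: And3 _ H _ := st j in H).
have [D gD] : exists D, cdiff g (x +i* y) D.
  have := xP 0%N; have := yP 0%N; rewrite s0 /w /h /= expr0 !divr1 => hy hx.
  by apply: gh; lra.
apply: ComplexField.Normc.eq0_normc; apply/eqP.
rewrite eq_le normc_ge0 andbT; apply/ler_addgt0Pl => e e0; rewrite addr0.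
(* the summand 1 keeps L positive when the rectangle degenerates to a point *)
pose L := (b - a) + (d - c) + 1.
have L0 : 0 < L by rewrite /L; lra.
have e'0 : 0 < e / (4 * L ^+ 2) by rewrite divr_gt0// mulr_gt0// exprn_gt0.
have [dl dl0 dlP] := gD _ e'0.
have [j jP] : exists j, L / 2 ^+ j < dl.
  have dL : 0 < dl / L by rewrite divr_gt0.
  have [j _ jP] := near_infty_natSinv_expn_lt (PosNum dL).
  exists j; have /= := jP j (leqnn j).
  by rewrite ltr_pdivlMr// mulrC mul1r.
have [_ [u1 u2 u3 u4]] := inv j.
have wh : w j + h j <= L / 2 ^+ j.
  by rewrite /w /h -mulrDl ler_wpM2r ?invr_ge0 ?exprn_ge0// /L; lra.
apply: le_trans (Qj j) _.
have xPj := xP j; have yPj := yP j.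
have H : normc (Q j (s j).2) <= 4 * (w j + h j) * (e / (4 * L ^+ 2) * (w j + h j)).
  have -> : w j + h j =
      ((s j).2.1 + w j - (s j).2.1) + ((s j).2.2 + h j - (s j).2.2) by ring.
  apply: (@rect_integral_small _ _ _ _ _ (x +i* y) D); last first.
  - move=> x' y' xx' yy'.
    have E : (x' +i* y') = (x +i* y) + ((x' - x) +i* (y' - y)).
      by apply: complex_ext => /=; ring.
    have n1 : normc ((x' - x) +i* (y' - y)) <= w j + h j.
      apply: (le_trans (normc_le _)) => /=; apply: lerD; rewrite ler_norml; lra.
    have n2 : normc ((x' - x) +i* (y' - y)) < dl.
      by rewrite (le_lt_trans n1)// (le_lt_trans wh).
    have E' : (x' +i* y') - (x +i* y) = ((x' - x) +i* (y' - y)).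
      by rewrite [in LHS]E addrC addKr.
    rewrite E' [in leLHS]E; apply: le_trans (dlP _ n2) _.
    by rewrite (addrC (_ + w j)) addKr (addrC (_ + h j)) addKr ler_wpM2l// ltW.
  - by rewrite lerDl.
  - by rewrite lerDl.
  - exact: holo_rectS gh _ _ _ _.
have -> : e = 4 ^+ j * (4 * (L / 2 ^+ j) * (e / (4 * L ^+ 2) * (L / 2 ^+ j))).
  have -> : (4 : R) = 2 ^+ 2 by rewrite -natrX.
  rewrite -exprM mulnC exprM.
  have e0' : (2 ^+ j : R) != 0 by rewrite expf_eq0 pnatr_eq0 andbF.
  have L0' : L != 0 by rewrite gt_eqF.
  by field; rewrite e0' L0'.
rewrite ler_wpM2l ?exprn_ge0//; apply: le_trans H _.
have e'_ge0 := ltW e'0.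
have wh_ge0 : 0 <= w j + h j by exact: addr_ge0.
apply: ler_pM; [exact: mulr_ge0|exact: mulr_ge0|exact: ler_wpM2l|].
exact: ler_wpM2l.
Qed.

Lemma cdiff_cst c z : cdiff (fun=> c) z 0.
Proof.
move=> e e0; exists 1 => // h _.
by rewrite subrr mul0r subrr normc0 mulr_ge0 ?normc_ge0// ltW.
Qed.

Lemma cdiffD f g z D D' : cdiff f z D -> cdiff g z D' ->
  cdiff (fun z => f z + g z) z (D + D').
Proof.
move=> fD gD e e0; have e2 : 0 < e / 2 by rewrite divr_gt0.
have [d d0 dP] := fD _ e2; have [d' d'0 d'P] := gD _ e2.
exists (Num.min d d'); first by rewrite lt_min d0.
move=> h; rewrite lt_min => /andP[/dP h1 /d'P h2].
have -> : f (z + h) + g (z + h) - (f z + g z) - (D + D') * h =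
  (f (z + h) - f z - D * h) + (g (z + h) - g z - D' * h) by ring.
rewrite (le_trans (normcD _ _))// (le_trans (lerD h1 h2))//.
by rewrite -mulrDl -splitr.
Qed.

Lemma cdiffM f g z D D' : cdiff f z D -> cdiff g z D' ->
  cdiff (fun z => f z * g z) z (D * g z + f z * D').
Proof.
move=> fD gD e e0.
pose M := normc D + normc (f z) + normc (g z) + 1.
have M0 : 0 < M by rewrite ltr_wpDl// !addr_ge0// normc_ge0.
pose e' := Num.min 1 (e / (3 * M)).
have e'0 : 0 < e' by rewrite lt_min ltr01 divr_gt0// mulr_gt0.
have [d d0 dP] := fD _ e'0; have [d' d'0 d'P] := gD _ e'0.
have [d2 d20 d2P] := cdiff_cont gD e'0.
exists (Num.min d (Num.min d' d2)); first by rewrite !lt_min d0 d'0.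
move=> h; rewrite !lt_min => /and3P[/dP h1 /d'P h2 /d2P h3].
have -> : f (z + h) * g (z + h) - f z * g z - (D * g z + f z * D') * h =
  (f (z + h) - f z - D * h) * g (z + h) +
  (f z * (g (z + h) - g z - D' * h) + D * h * (g (z + h) - g z)) by ring.
have g1 : normc (g (z + h)) <= M.
  rewrite -(subrK (g z) (g (z + h))) (le_trans (normcD _ _))//.
  have e'1 : e' <= 1 by rewrite ge_min lexx.
  have := normc_ge0 D; have := normc_ge0 (f z).
  by move: (ltW h3); rewrite /M; lra.
have h_ge0 := normc_ge0 h.
have e'e : e' * (M * normc h) <= (e / 3) * normc h.
  rewrite mulrA ler_wpM2r//.
  have : e' <= e / (3 * M) by rewrite ge_min lexx orbT.
  rewrite ler_pdivlMr ?mulr_gt0//; lra.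
have fM : normc (f z) <= M.
  by rewrite /M; have := normc_ge0 D; have := normc_ge0 (g z); lra.
have DM : normc D <= M.
  by rewrite /M; have := normc_ge0 (f z); have := normc_ge0 (g z); lra.
have -> : e * normc h = e / 3 * normc h + (e / 3 * normc h + e / 3 * normc h).
  by field.
rewrite (le_trans (normcD _ _))// lerD//; last first.
  rewrite (le_trans (normcD _ _))// !ComplexField.Normc.normcM lerD//.
    apply: le_trans e'e; rewrite mulrCA ler_pM ?normc_ge0//.
  apply: le_trans e'e; rewrite [leRHS]mulrC ler_pM ?mulr_ge0 ?normc_ge0//.
    by rewrite ler_wpM2r.
  exact: ltW.
rewrite ComplexField.Normc.normcM (le_trans _ e'e)// mulrA mulrAC.
by rewrite ler_pM ?normc_ge0.
Qed.

Lemma cdiff_comp f g z D D' : cdiff f z D -> cdiff g (f z) D' ->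
  cdiff (g \o f) z (D' * D).
Proof.
move=> fD gD e e0.
pose M := normc D + normc D' + 1.
have M0 : 0 < M by rewrite ltr_wpDl// addr_ge0// normc_ge0.
pose e' := Num.min 1 (e / (2 * M)).
have e'0 : 0 < e' by rewrite lt_min ltr01 divr_gt0// mulr_gt0.
have e'e : e' * M <= e / 2.
  have : e' <= e / (2 * M) by rewrite ge_min lexx orbT.
  rewrite ler_pdivlMr ?mulr_gt0//; lra.
have [d d0 dP] := fD _ e'0; have [d' d'0 d'P] := gD _ e'0.
have [d2 d20 d2P] := cdiff_cont fD d'0.
exists (Num.min d d2); first by rewrite !lt_min d0.
move=> h; rewrite !lt_min => /andP[/dP h1 /d2P/d'P h3].
rewrite subrKC in h3.
have h_ge0 := normc_ge0 h.
have n1 : normc (f (z + h) - f z) <= M * normc h.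
  rewrite -(subrK (D * h) (_ - _)) (le_trans (normcD _ _))//.
  rewrite ComplexField.Normc.normcM (le_trans (lerD h1 (lexx _)))//.
  rewrite -mulrDl ler_wpM2r// /M.
  have e'1 : e' <= 1 by rewrite ge_min lexx.
  by have := normc_ge0 D'; lra.
have -> : (g \o f) (z + h) - (g \o f) z - D' * D * h =
  (g (f (z + h)) - g (f z) - D' * (f (z + h) - f z)) +
  D' * (f (z + h) - f z - D * h) by rewrite /=; ring.
have -> : e * normc h = e / 2 * normc h + e / 2 * normc h by field.
rewrite (le_trans (normcD _ _))// lerD//.
  rewrite (le_trans h3)// (le_trans (ler_wpM2l (ltW e'0) n1))//.
  by rewrite mulrA ler_wpM2r.
rewrite ComplexField.Normc.normcM (le_trans (ler_wpM2l (normc_ge0 _) h1))//.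
rewrite mulrA ler_wpM2r// mulrC (le_trans _ e'e)// ler_wpM2l ?ltW// /M.
by have := normc_ge0 D; lra.
Qed.

Lemma cdiff_inv z : z != 0 -> cdiff (fun z => z^-1) z (- z^-1 ^+ 2).
Proof.
move=> z0 e e0.
have nz0 : 0 < normc z.
  rewrite lt_def normc_ge0 andbT; apply: contra z0 => /eqP.
  by move=> /ComplexField.Normc.eq0_normc ->.
pose m := normc z / 2; have m0 : 0 < m by rewrite divr_gt0.
exists (Num.min m (e * m ^+ 3)).
  by rewrite lt_min m0 mulr_gt0// exprn_gt0.
move=> h; rewrite lt_min => /andP[hm he].
have zh : m <= normc (z + h).
  rewrite -(normcN h) in hm.
  have := normcD (z + h) (- h); rewrite addrK /m in hm *; lra.
have zh0 : z + h != 0.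
  by apply/eqP => E; move: zh; rewrite E normc0 leNgt m0.
have -> : (z + h)^-1 - z^-1 - - z^-1 ^+ 2 * h = h * h * (z ^- 2 * (z + h)^-1).
  by field; rewrite z0 zh0.
have zm : m <= normc z by rewrite /m; lra.
rewrite 3!ComplexField.Normc.normcM !ComplexField.Normc.normcV.
rewrite ComplexField.Normc.normcM mulrAC [leRHS]mulrC -mulrA.
rewrite ler_wpM2l ?normc_ge0// -invfM mulrC ler_pdivrMr; last first.
  by rewrite !mulr_gt0// (lt_le_trans m0).
apply: le_trans (ltW he) _; rewrite ler_wpM2l ?(ltW e0)//.
have m_ge0 := ltW m0.
rewrite !exprS expr0 mulr1 mulrA.
by apply: ler_pM => //; [exact: mulr_ge0|exact: ler_pM].
Qed.

Lemma is_derive_small (f : R -> R) (x df : R) : is_derive x 1 f df ->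
  forall e : R, 0 < e -> exists2 d, 0 < d &
  forall h, `|h| < d -> `|f (x + h) - f x - df * h| <= e * `|h|.
Proof.
move=> [dfx dfE] e e0.
have /cvgrPdist_le/(_ _ e0) : h^-1 *: (f (h *: 1 + x) - f x) @[h --> 0^'] --> df.
  by rewrite -dfE; exact: dfx.
move=> [d /= d0 dP]; exists d => // h hd.
have [->|h0] := eqVneq h 0; first by rewrite addr0 subrr mulr0 subrr normr0 mulr0.
have := dP h; rewrite /= sub0r normrN => /(_ hd h0).
rewrite -(ler_pM2r (x := `|h|)) ?normr_gt0// -normrM; apply: le_trans.
rewrite mulrBl -[_ *: (_ - _)]/(_ * _) mulrAC mulVf// mul1r distrC.
by rewrite [h *: 1]mulr1 (addrC h x).
Qed.

Definition cexp z : R[i] :=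
  (expR (complex.Re z))%:C * (cos (complex.Im z) +i* sin (complex.Im z)).

Lemma cexpD z w : cexp (z + w) = cexp z * cexp w.
Proof.
rewrite /cexp cReD cImD expRD cosD sinD rmorphM /=.
apply: complex_ext; rewrite !(cReM, cImM) /=; ring.
Qed.

Lemma normc_cexp z : normc (cexp z) = expR (complex.Re z).
Proof.
rewrite ComplexField.Normc.normcM normc_real /= cos2Dsin2 sqrtr1 mulr1.
by rewrite ger0_norm// expR_ge0.
Qed.

Lemma cdiff_cexp0 : cdiff cexp 0 1.
Proof.
move=> e e0.
have [e' [e'0 e'1 e'e]] : exists e' : R, [/\ 0 < e', 2 * e' <= 1 & 8 * e' <= e].
  exists (Num.min (2^-1) (e / 8)); split.
  - by rewrite lt_min invr_gt0 ltr0n divr_gt0.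
  - have : Num.min (2^-1) (e / 8) <= 2^-1 by rewrite ge_min lexx.
    by move: (Num.min _ _) => ? ?; lra.
  - have : Num.min (2^-1) (e / 8) <= e / 8 by rewrite ge_min lexx orbT.
    by move: (Num.min _ _) => ? ?; lra.
have [d1 d10 d1P] := is_derive_small (is_derive_expR (0 : R)) e'0.
have [d2 d20 d2P] := is_derive_small (is_derive_sin (0 : R)) e'0.
have [d3 d30 d3P] := is_derive_small (is_derive_cos (0 : R)) e'0.
exists (Num.min (Num.min d1 (Num.min d2 d3)) e').
  by rewrite !lt_min d10 d20 d30.
have e'1' : e' <= 1 by lra.
move=> [a b]; rewrite !lt_min -!andbA => /and4P[h1 h2 h3 h4].
set n := normc (a +i* b) in h1 h2 h3 h4 *.
have an : `|a| <= n by exact: (Re_le_normc (a +i* b)).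
have bn : `|b| <= n by exact: (Im_le_normc (a +i* b)).
have n0 : 0 <= n by exact: normc_ge0.
have {d1P}H1 := d1P _ (le_lt_trans an h1).
have {d2P}H2 := d2P _ (le_lt_trans bn h2).
have {d3P}H3 := d3P _ (le_lt_trans bn h3).
move: H1 H2 H3; rewrite !(add0r, expR0, sin0, cos0, oppr0, mul1r, mul0r, subr0).
move=> H1 H2 H3.
have c1 : `|cos b| <= 1 by rewrite ler_norml cos_geN1 cos_le1.
have s1 : `|sin b| <= 1 by rewrite ler_norml sin_geN1 sin_le1.
have ea : `|expR a - 1| <= 2 * n.
  rewrite -(subrK a (_ - 1)) (le_trans (ler_normD _ _))//.
  have : e' * `|a| <= 1 * n by apply: ler_pM => //; exact: ltW.
  lra.
have sb : `|sin b| <= 2 * n.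
  rewrite -(subrK b (sin b)) (le_trans (ler_normD _ _))//.
  have : e' * `|b| <= 1 * n by apply: ler_pM => //; exact: ltW.
  lra.
have e'n : e' * `|a| <= e' * n /\ e' * `|b| <= e' * n.
  by split; rewrite ler_wpM2l// ltW.
rewrite (le_trans (normc_le _))// /cexp !(cReD, cImD, cReN, cImN, cReM, cImM) /=.
rewrite !(expR0, cos0, sin0) !(mul0r, mulr0, subr0, addr0, mul1r, mulr1, oppr0, add0r).
have R1 : `|expR a * cos b - 1 - a| <= 3 * (e' * n).
  have -> : expR a * cos b - 1 - a = (expR a - 1 - a) + expR a * (cos b - 1) by ring.
  rewrite (le_trans (ler_normD _ _))// normrM.
  have ea2 : `|expR a| <= 2.
    rewrite -(subrK 1 (expR a)) (le_trans (ler_normD _ _))// normr1.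
    by lra.
  have : `|expR a| * `|cos b - 1| <= 2 * (e' * n).
    by apply: ler_pM => //; lra.
  lra.
have R2 : `|expR a * sin b - b| <= 5 * (e' * n).
  have -> : expR a * sin b - b = (expR a - 1) * sin b + (sin b - b) by ring.
  rewrite (le_trans (ler_normD _ _))// normrM.
  have : `|expR a - 1| * `|sin b| <= (2 * n) * (2 * n).
    by apply: ler_pM.
  have : n * n <= e' * n by rewrite ler_wpM2r// ltW.
  lra.
have : 8 * e' * n <= e * n by rewrite ler_wpM2r.
lra.
Qed.

Lemma cdiff_cexp z : cdiff cexp z (cexp z).
Proof.
move=> e e0.
have c0 : 0 < normc (cexp z) by rewrite normc_cexp expR_gt0.
have [d d0 dP] := cdiff_cexp0 (divr_gt0 e0 c0).
exists d => // h /dP; rewrite add0r mul1r.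
have -> : cexp 0 = 1.
  by rewrite /cexp /= expR0 cos0 sin0; apply: complex_ext; rewrite ?cReM ?cImM/=; ring.
move=> H; have -> : cexp (z + h) - cexp z - cexp z * h =
  cexp z * (cexp h - 1 - h) by rewrite cexpD; ring.
rewrite ComplexField.Normc.normcM (le_trans (ler_wpM2l (ltW c0) H))//.
by rewrite mulrA (mulrC _ (e / _)) divfK// gt_eqF.
Qed.

(** exp(2 pi i y): with this normalization the mean over the unit circle is the
    integral over [0, 1]. *)
Definition unitc (y : R) : R[i] := cos (2 * pi * y) +i* sin (2 * pi * y).

Lemma normc_unitc y : normc (unitc y) = 1.
Proof. by rewrite /unitc /= cos2Dsin2 sqrtr1. Qed.

Let cexp_unitc x y : cexp ((2 * pi)%:C * (x +i* y)) =
  (expR (2 * pi * x))%:C * unitc y.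
Proof. by rewrite /cexp /unitc !(cReM, cImM) /= !mul0r subr0 addr0. Qed.

Let unitc01 : unitc 0 = 1 /\ unitc 1 = 1.
Proof.
split; rewrite /unitc ?mulr0 ?cos0 ?sin0// mulr1.
by rewrite -[2 * pi]add0r mulr_natl cosD2pi // sinD2pi ?cos0 ?sin0.
Qed.

Definition holo_punctured g (r : R) :=
  forall z, 0 < normc z < r -> exists D, cdiff g z D.

Lemma ccont_circle g r0 r y : holo_punctured g r0 -> 0 < r < r0 ->
  ccont (fun y => g (r%:C * unitc y)) y.
Proof.
move=> gh rr0; have /andP[r_gt0 _] := rr0.
pose x := ln r / (2 * pi).
have p0 : (2 * pi : R) != 0 by rewrite mulf_neq0// gt_eqF// pi_gt0.
have E u : r%:C * unitc u = cexp ((2 * pi)%:C * (x +i* u)).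
  by rewrite cexp_unitc /x mulrCA divff// mulr1 lnK.
have -> : (fun y => g (r%:C * unitc y)) =
  fun y => (g \o cexp \o (fun z => (2 * pi)%:C * z)) (x +i* y).
  by apply/funext => u; rewrite E.
have [D gD] : exists D, cdiff g (cexp ((2 * pi)%:C * (x +i* y))) D.
  apply: gh; rewrite -E ComplexField.Normc.normcM normc_real normc_unitc mulr1.
  by rewrite gtr0_norm.
have lin : cdiff (fun z => (2 * pi)%:C * z) (x +i* y) (2 * pi)%:C.
  move=> e e0; exists 1 => // h _.
  rewrite (_ : _ - _ = 0) ?normc0 ?mulr_ge0 ?normc_ge0 ?(ltW e0)//; ring.
exact: (cdiff_ccont_ver (cdiff_comp (cdiff_comp lin (cdiff_cexp _)) gD)).
Qed.

(** In the coordinate w = log z / (2 pi) an annulus becomes a rectangle whose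
    horizontal sides carry the same values, so Goursat leaves only the two
    circles. *)
Lemma circle_integral_const g r0 r1 r2 : holo_punctured g r0 ->
  0 < r1 <= r2 -> r2 < r0 ->
  cint 0 1 (fun y => g (r1%:C * unitc y)) = cint 0 1 (fun y => g (r2%:C * unitc y)).
Proof.
move=> gh /andP[r10 r12] r20.
have r2_gt0 := lt_le_trans r10 r12.
have p0 : 0 < 2 * pi :> R by rewrite mulr_gt0// pi_gt0.
pose x r : R := ln r / (2 * pi).
have E r y : 0 < r -> cexp ((2 * pi)%:C * (x r +i* y)) = r%:C * unitc y.
  by move=> ?; rewrite cexp_unitc /x mulrCA divff ?gt_eqF// mulr1 lnK.
pose F := g \o cexp \o (fun z => (2 * pi)%:C * z).
have Fh : holo_rect F (x r1) (x r2) 0 1.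
  move=> u y /andP[ru ur] _.
  have [D gD] : exists D, cdiff g (cexp ((2 * pi)%:C * (u +i* y))) D.
    apply: gh; rewrite normc_cexp expR_gt0/=.
    rewrite /= mul0r subr0 (le_lt_trans _ r20)//.
    by rewrite -[leRHS]lnK// ler_expR mulrC -ler_pdivlMr.
  have lin : cdiff (fun z => (2 * pi)%:C * z) (u +i* y) (2 * pi)%:C.
    move=> e e0; exists 1 => // h _.
    rewrite (_ : _ - _ = 0) ?normc0 ?mulr_ge0 ?normc_ge0 ?(ltW e0)//; ring.
  by eexists; exact: (cdiff_comp (cdiff_comp lin (cdiff_cexp _)) gD).
have xx : x r1 <= x r2 by rewrite ler_wpM2r ?invr_ge0 ?(ltW p0)// ler_ln.
have := goursat_rect Fh xx ler01; rewrite /rect_integral.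
rewrite (_ : cint (x r1) _ _ = 0); last first.
  have [u0 u1] := unitc01.
  rewrite (@eq_cint _ _ _ _ (fun=> 0)) ?cint_cst ?mulr0// => u _.
  by rewrite /F /= !cexp_unitc u0 u1 subrr.
rewrite add0r (@eq_cint _ _ _ _
   (fun y => g (r2%:C * unitc y) - g (r1%:C * unitc y))); last first.
  by move=> y _; rewrite /F /= !E.
rewrite cintB; last 2 first.
- by move=> y _; apply: (ccont_circle _ gh); rewrite r2_gt0.
- by move=> y _; apply: (ccont_circle _ gh); rewrite r10 (le_lt_trans r12).
move=> /eqP; rewrite mulf_eq0 subr_eq0 => /orP[|/eqP//].
by rewrite eq_complex /= oner_eq0 andbF.
Qed.

(** By circle_integral_const the mean over the circle does not depend on its
    radius, and it tends to L as the radius tends to 0. *)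
Lemma circle_mean g (r0 r : R) L : holo_punctured g r0 -> 0 < r < r0 ->
  (forall e : R, 0 < e -> exists2 d, 0 < d &
    forall z, 0 < normc z < d -> normc (g z - L) < e) ->
  L = cint 0 1 (fun y => g (r%:C * unitc y)).
Proof.
move=> gh /andP[r_gt0 rr0] gL; apply/eqP; rewrite -subr_eq0; apply/eqP.
apply: ComplexField.Normc.eq0_normc; apply/eqP.
rewrite eq_le normc_ge0 andbT; apply/ler_addgt0Pl => e e0; rewrite addr0.
have [d d0 dP] := gL _ (divr_gt0 e0 (ltr0Sn R 1)).
pose r1 := Num.min r (d / 2).
have r10 : 0 < r1 by rewrite lt_min r_gt0 divr_gt0.
have r1r : r1 <= r by rewrite ge_min lexx.
have r1d : r1 < d.
  by rewrite (@le_lt_trans _ _ (d / 2))// ?ge_min ?lexx ?orbT//; lra.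
rewrite -(circle_integral_const (r1 := r1) gh)// ?r10//.
have c1 y : 0 <= y <= 1 -> ccont (fun y => g (r1%:C * unitc y)) y.
  by move=> _; apply: (ccont_circle _ gh); rewrite r10 (le_lt_trans r1r).
have -> : L = cint 0 1 (fun=> L) by rewrite cint_cst// subr0 mul1r.
rewrite normcB -cintB//; last by move=> y _; exact: ccont_cst.
rewrite (le_trans (cint_le (M := e / 2) _ _ _))//.
- by move=> y y01; apply: ccontB; [exact: c1|exact: ccont_cst].
- move=> y _; apply/ltW/dP.
  by rewrite ComplexField.Normc.normcM normc_real normc_unitc mulr1 gtr0_norm// r10.
- by rewrite subr0 mul1r; lra.
Qed.

(** The difference quotient at z is holomorphic off the centre and tends to D
    there, so circle_mean applies to it. *)
Lemma cauchy_derivative g z (r0 r : R) D : 0 < r < r0 ->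
  (forall h, normc h < r0 -> exists D, cdiff g (z + h) D) -> cdiff g z D ->
  (forall y, ccont (fun y => (g (z + r%:C * unitc y) - g z) * (r%:C * unitc y)^-1) y) /\
  D = cint 0 1 (fun y => (g (z + r%:C * unitc y) - g z) * (r%:C * unitc y)^-1).
Proof.
move=> rr0 gh gD; have /andP[r_gt0 _] := rr0.
pose q h := (g (z + h) - g z) * h^-1.
have qh : holo_punctured q r0.
  move=> h /andP[h0 hr]; have [D' gD'] := gh h hr.
  have h0' : h != 0 by apply/eqP => E; move: h0; rewrite E normc0 ltxx.
  have gD'' : cdiff (fun h => g (z + h)) h D'.
    by move=> e /gD'[d d0 dP]; exists d => // k /dP; rewrite addrA.
  have := cdiffM (cdiffD gD'' (cdiff_cst (- g z) h)) (cdiff_inv h0').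
  by move=> ?; eexists; eassumption.
split; first by move=> y; exact: (ccont_circle _ qh).
apply: (circle_mean qh rr0) => e e0; have [d d0 dP] := gD _ (divr_gt0 e0 (ltr0Sn R 1)).
exists d => // h /andP[h0 hd].
have h0' : h != 0 by apply/eqP => E; move: h0; rewrite E normc0 ltxx.
have -> : q h - D = (g (z + h) - g z - D * h) * h^-1 by rewrite /q; field.
rewrite ComplexField.Normc.normcM ComplexField.Normc.normcV ltr_pdivrMr//.
by rewrite (le_lt_trans (dP _ hd))// ltr_pM2r//; lra.
Qed.

(** The difference quotient is at most 2B / r on the circle; the other factor 2
    is the one lost in cint_le. *)
Lemma cauchy_estimate g z (r0 r B : R) D : 0 < r < r0 ->
  (forall h, normc h < r0 -> exists D, cdiff g (z + h) D) ->
  (forall h, normc h <= r -> normc (g (z + h)) <= B) ->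
  cdiff g z D -> normc D <= 4 * B / r.
Proof.
move=> rr0 gh gB gD; have /andP[r_gt0 _] := rr0.
have [qc ->] := cauchy_derivative rr0 gh gD.
rewrite (le_trans (cint_le (M := 2 * B / r) _ _ _))//.
- move=> y _; have n1 : normc (r%:C * unitc y) = r.
    by rewrite ComplexField.Normc.normcM normc_real normc_unitc mulr1 gtr0_norm.
  rewrite ComplexField.Normc.normcM ComplexField.Normc.normcV n1 ler_pM2r ?invr_gt0//.
  rewrite (le_trans (normcD _ _))// normcN mulr_natl mulr2n lerD ?gB ?n1//.
  by have := gB 0; rewrite addr0 normc0; apply; exact: ltW.
- by rewrite subr0 mul1r; lra.
Qed.

End goursat.

(** * The fundamental theorem of calculus and Riemann sums *)

Section real_variable.
Context {R : realType}.
Implicit Types g dg : R -> R[i].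

Lemma small_is_derive (f : R -> R) (x df : R) :
  (forall e : R, 0 < e -> exists2 d, 0 < d &
   forall h, `|h| < d -> `|f (x + h) - f x - df * h| <= e * `|h|) ->
  is_derive x 1 f df.
Proof.
move=> fx.
have H : h^-1 *: (f (h *: 1 + x) - f x) @[h --> 0^'] --> df.
  apply/cvgrPdist_le => e e0; have [d d0 dP] := fx _ e0.
  exists d => // h; rewrite /= sub0r normrN => hd h0.
  rewrite -(ler_pM2r (x := `|h|)) ?normr_gt0// -normrM; apply: le_trans (dP h hd).
  rewrite mulrBl -[_ *: (_ - _)]/(_ * _) mulrAC mulVf// mul1r distrC.
  by rewrite [h *: 1]mulr1 (addrC h x).
split; first by apply/cvg_ex; exists df.
exact: cvg_lim.
Qed.

Definition rdiff (g : R -> R[i]) (t : R) (D : R[i]) := forall e : R, 0 < e ->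
  exists2 d, 0 < d & forall h, `|h| < d -> normc (g (t + h) - g t - D * h%:C) <= e * `|h|.

Lemma rdiff_ReIm g t D : rdiff g t D ->
  is_derive t 1 (fun t => complex.Re (g t)) (complex.Re D) /\
  is_derive t 1 (fun t => complex.Im (g t)) (complex.Im D).
Proof.
move=> gD; split; apply: small_is_derive => e e0; have [d d0 dP] := gD _ e0;
  exists d => // h /dP; apply: le_trans.
- apply: le_trans (Re_le_normc _).
  by rewrite !cReD !cReN cReM /= mulr0 subr0.
- apply: le_trans (Im_le_normc _).
  by rewrite !cImD !cImN cImM /= mulr0 add0r.
Qed.

(** The constant 2 comes from treating real and imaginary parts separately. *)
Lemma rdiff_mvt g dg (M : R) : (forall t : R, 0 <= t <= 1 -> rdiff g t (dg t)) ->
  (forall t : R, 0 <= t <= 1 -> normc (dg t) <= M) -> normc (g 1 - g 0) <= 2 * M.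
Proof.
move=> gd gM.
have key (f df : R -> R) : (forall t : R, 0 <= t <= 1 -> is_derive t 1 f (df t)) ->
    (forall t : R, 0 <= t <= 1 -> `|df t| <= M) -> `|f 1 - f 0| <= M.
  move=> fd fM.
  have fdi (x : R) : x \in `]0, 1[%R -> is_derive x 1 f (df x).
    by rewrite in_itv/= => /andP[x0 x1]; apply: fd; rewrite !ltW.
  have fc : {within `[0, 1], continuous f}.
    apply: continuous_in_subspaceT => x; rewrite inE/= in_itv/= => /fd xd.
    by apply/differentiable_continuous/derivable1_diffP; case: xd.
  have [c + ->] := MVT ltr01 fdi fc.
  by rewrite in_itv/= subr0 mulr1 => /andP[c0 c1]; apply: fM; rewrite !ltW.
rewrite (le_trans (normc_le _))// mulr_natl mulr2n cReD cImD cReN cImN lerD//.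
- apply: (key (fun t => complex.Re (g t)) (fun t => complex.Re (dg t))) => t t01.
    by have [] := rdiff_ReIm (gd t t01).
  by rewrite (le_trans (Re_le_normc _))// gM.
- apply: (key (fun t => complex.Im (g t)) (fun t => complex.Im (dg t))) => t t01.
    by have [] := rdiff_ReIm (gd t t01).
  by rewrite (le_trans (Im_le_normc _))// gM.
Qed.

Lemma cint_FTC g dg : (forall t : R, 0 <= t <= 1 -> rdiff g t (dg t)) ->
  (forall t : R, 0 <= t <= 1 -> ccont dg t) -> cint 0 1 dg = g 1 - g 0.
Proof.
move=> gd dgc.
have key (f df : R -> R) : (forall t : R, 0 <= t <= 1 -> is_derive t 1 f (df t)) ->
    (forall t : R, 0 <= t <= 1 -> {for t, continuous df}) ->
    \int[lebesgue_measure]_(t in `[0, 1]) df t = f 1 - f 0.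
  move=> fd dfc.
  have fc x : 0 <= x <= 1 -> {for x, continuous f}.
    by move=> /fd xd; apply/differentiable_continuous/derivable1_diffP; case: xd.
  rewrite /Rintegral (@continuous_FTC2 _ df f)//.
  - by apply: continuous_in_subspaceT => x; rewrite inE/= in_itv/= => /dfc.
  - split.
    + by move=> x; rewrite in_itv/= => /andP[x0 x1]; case: (fd x _) => //; rewrite !ltW.
    + by apply: cvg_at_right_filter; apply: fc; rewrite lexx ler01.
    + by apply: cvg_at_left_filter; apply: fc; rewrite lexx ler01.
  - move=> x; rewrite in_itv/= => /andP[x0 x1]; rewrite derive1E.
    by case: (fd x _) => //; rewrite !ltW.
apply: complex_ext; rewrite ?(cReD, cImD, cReN, cImN) /=.
- by apply: (key (fun t => complex.Re (g t))) => t t01;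
    [have [] := rdiff_ReIm (gd t t01)|have [] := ccontP (dgc t t01)].
- by apply: (key (fun t => complex.Im (g t))) => t t01;
    [have [] := rdiff_ReIm (gd t t01)|have [] := ccontP (dgc t t01)].
Qed.

(** On each of the N intervals the integrand differs from its value at the left
    endpoint by at most C / N; the factor 2 is the one lost in cint_le. *)
Lemma riemann_sum_le g (C : R) (N : nat) : (0 < N)%N ->
  (forall t : R, 0 <= t <= 1 -> ccont g t) ->
  (forall s t : R, 0 <= s <= 1 -> 0 <= t <= 1 -> normc (g s - g t) <= C * `|s - t|) ->
  normc (cint 0 1 g - (N%:R^-1)%:C * \sum_(j < N) g (j%:R / N%:R)) <= 2 * C / N%:R.
Proof.
move=> N0 gc gC.
have N0' : 0 < N%:R :> R by rewrite ltr0n.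
have C0 : 0 <= C.
  have := gC 1 0; rewrite subr0 normr1 mulr1 !lexx ler01.
  by move=> /(_ isT isT); apply: le_trans; exact: normc_ge0.
have gc' j : (j < N)%N -> forall x : R, j%:R / N%:R <= x <= j.+1%:R / N%:R -> 0 <= x <= 1.
  move=> jN x /andP[x1 x2]; rewrite (le_trans _ x1)/= ?divr_ge0//.
  by rewrite (le_trans x2)// ler_pdivrMr// mul1r ler_nat.
have E k : (k <= N)%N -> cint 0 (k%:R / N%:R) g =
    \sum_(j < k) cint (j%:R / N%:R) (j.+1%:R / N%:R) g.
  elim: k => [|k IH] kN.
    rewrite big_ord0 mul0r; apply/eqP; apply/eqP/ComplexField.Normc.eq0_normc/eqP.
    rewrite eq_le normc_ge0 andbT (le_trans (cint_le (M := normc (g 0)) _ _ _))//.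
    - by move=> x /andP[x0 x1]; apply: gc; rewrite x0 (le_trans x1).
    - by move=> x /le_anti <-.
    - by rewrite subrr mul0r mulr0.
  rewrite big_ord_recr /= -IH ?(ltnW kN)// -cint_split//.
    by rewrite divr_ge0//= ler_pM2r ?invr_gt0// ler_nat.
  move=> x /andP[x0 x1]; apply: gc; rewrite x0 (le_trans x1)//.
  by rewrite ler_pdivrMr// mul1r ler_nat.
have := E N (leqnn N); rewrite divff ?gt_eqF// => ->.
rewrite mulr_sumr -sumrB (le_trans (normc_sum _ _ _))//.
have -> : 2 * C / N%:R = \sum_(j < N) 2 * (N%:R^-1 * (C / N%:R)).
  by rewrite sumr_const card_ord -[RHS]mulr_natr; field; rewrite gt_eqF.
apply: ler_sum => j _.
have w : j.+1%:R / N%:R - j%:R / N%:R = N%:R^-1 :> R.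
  by rewrite -mulrBl -natrB// subSnn mul1r.
have jj : j%:R / N%:R <= j.+1%:R / N%:R :> R.
  by rewrite ler_pM2r ?invr_gt0// ler_nat.
have gcj x : j%:R / N%:R <= x <= j.+1%:R / N%:R -> ccont g x.
  by move=> /(gc' _ (ltn_ord j))/gc.
have -> : (N%:R^-1)%:C * g (j%:R / N%:R) =
    cint (j%:R / N%:R) (j.+1%:R / N%:R) (fun=> g (j%:R / N%:R)).
  by rewrite cint_cst// w.
rewrite -cintB//; last by move=> ? _; exact: ccont_cst.
have -> : 2 * (N%:R^-1 * (C / N%:R)) =
    2 * ((j.+1%:R / N%:R - j%:R / N%:R) * (C / N%:R)) by rewrite w.
apply: cint_le => //.
- by move=> x xj; apply: ccontB; [exact: gcj|exact: ccont_cst].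
- move=> x xj; rewrite (le_trans (gC _ _ _ _))//.
  + exact: (gc' _ (ltn_ord j)).
  + by apply: (gc' _ (ltn_ord j)); rewrite lexx jj.
  + rewrite ler_wpM2l//; have /andP[x1 x2] := xj.
    by rewrite ger0_norm ?subr_ge0// -[leRHS]w lerD2r.
Qed.

End real_variable.

(** * Hermitian geometry *)

(** Locked, since unfolding the matrix product makes unification slow. *)
HB.lock Definition ip {R : realType} {n : nat} (z w : Cvec R n) : R[i] :=
  dotmx z w.

HB.lock Definition hnorm {R : realType} {n : nat} (z : Cvec R n) : R :=
  Num.sqrt (sqnorm z).

Section hermitian_geometry.
Context {R : realType} {n : nat}.
Implicit Types (a z w : Cvec R n) (c : R[i]).

Lemma ip_dotmx z w : ip z w = dotmx z w.
Proof. by rewrite ip.unlock. Qed.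

Lemma ipE z w : ip z w = \sum_k z 0 k * conjc (w 0 k).
Proof. by rewrite ip_dotmx dotmxE mxE; apply: eq_bigr => k _; rewrite !mxE. Qed.

Lemma ipDl z w a : ip (z + w) a = ip z a + ip w a.
Proof. by rewrite !ip_dotmx; exact: linearDl. Qed.

Lemma ipZl c z a : ip (c *: z) a = c * ip z a.
Proof. by rewrite !ipE mulr_sumr; apply: eq_bigr => k _; rewrite mxE mulrA. Qed.

Lemma ipC z w : ip z w = conjc (ip w z).
Proof.
rewrite !ipE (big_morph _ (rmorphD conjc) (rmorph0 conjc)).
by apply: eq_bigr => k _; rewrite rmorphM /= conjcK mulrC.
Qed.

Lemma ipDr z w a : ip a (z + w) = ip a z + ip a w.
Proof. by rewrite ipC ipDl rmorphD /= -!ipC. Qed.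

Lemma ipZr c z a : ip a (c *: z) = conjc c * ip a z.
Proof. by rewrite ipC ipZl rmorphM /= -!ipC. Qed.

Lemma ipNl z a : ip (- z) a = - ip z a.
Proof. by rewrite -scaleN1r ipZl mulN1r. Qed.

Lemma ipNr z a : ip a (- z) = - ip a z.
Proof. by rewrite ipC ipNl rmorphN /= -ipC. Qed.

Lemma normc_conj c : normc (conjc c) = normc c.
Proof. by case: c => x y /=; rewrite sqrrN. Qed.

Lemma mulc_conj c : c * conjc c = (normc c ^+ 2)%:C.
Proof.
case: c => x y; rewrite sqr_sqrtr ?addr_ge0 ?sqr_ge0//.
by apply: complex_ext; rewrite ?cReM ?cImM /=; ring.
Qed.

Lemma ip_sqnorm z : ip z z = (\sum_k normc (z 0 k) ^+ 2)%:C.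
Proof.
rewrite ipE (big_morph _ (rmorphD (real_complex R)) (rmorph0 (real_complex R))).
by apply: eq_bigr => k _; rewrite mulc_conj.
Qed.

Lemma sqnormE z : sqnorm z = \sum_k normc (z 0 k) ^+ 2.
Proof. by rewrite /sqnorm -ip_dotmx ip_sqnorm. Qed.

Lemma ipzz z : ip z z = (sqnorm z)%:C.
Proof. by rewrite ip_sqnorm sqnormE. Qed.

Lemma sqnorm_ge0 z : 0 <= sqnorm z.
Proof. by rewrite sqnormE sumr_ge0// => k _; exact: sqr_ge0. Qed.

Lemma sqnormD z w : sqnorm (z + w) = sqnorm z + 2 * complex.Re (ip z w) + sqnorm w.
Proof.
have -> : sqnorm (z + w) = complex.Re (ip (z + w) (z + w)) by rewrite ipzz.
rewrite ipDl (ipDr z w z) (ipDr z w w) 3!cReD (ipzz z) (ipzz w) (ipC w z).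
have -> : complex.Re (conjc (ip z w)) = complex.Re (ip z w) by case: (ip z w).
by move: (sqnorm z) (sqnorm w) => u v /=; ring.
Qed.

Lemma sqnormZ c z : sqnorm (c *: z) = normc c ^+ 2 * sqnorm z.
Proof.
rewrite !sqnormE mulr_sumr; apply: eq_bigr => k _.
by rewrite mxE ComplexField.Normc.normcM exprMn.
Qed.

Lemma hnormE z : hnorm z = Num.sqrt (sqnorm z).
Proof. by rewrite hnorm.unlock. Qed.

Lemma hnorm_ge0 z : 0 <= hnorm z. Proof. by rewrite hnormE sqrtr_ge0. Qed.

Lemma hnorm_sqr z : hnorm z ^+ 2 = sqnorm z.
Proof. by rewrite hnormE sqr_sqrtr// sqnorm_ge0. Qed.

Lemma unit_ballP z : unit_ball z <-> hnorm z < 1.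
Proof.
rewrite /unit_ball /= -hnorm_sqr; split => [|h].
  by move=> h; rewrite -(@ltr_pXn2r _ 2) ?nnegrE ?hnorm_ge0// expr1n.
by rewrite -[ltRHS](expr1n _ 2) ltr_pXn2r ?nnegrE ?hnorm_ge0.
Qed.

Lemma hnorm_scale c z : hnorm (c *: z) = normc c * hnorm z.
Proof.
by rewrite !hnormE sqnormZ sqrtrM ?sqr_ge0// sqrtr_sqr ger0_norm// normc_ge0.
Qed.

Lemma hnorm_opp z : hnorm (- z) = hnorm z.
Proof. by rewrite -scaleN1r hnorm_scale normcN normc1 mul1r. Qed.

Lemma hnorm_subC z w : hnorm (z - w) = hnorm (w - z).
Proof. by rewrite -hnorm_opp opprB. Qed.

Lemma hnorm0 : hnorm (0 : Cvec R n) = 0.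
Proof. by rewrite -(scale0r (0 : Cvec R n)) hnorm_scale normc0 mul0r. Qed.

Lemma hnorm_eq0 z : hnorm z = 0 -> z = 0.
Proof.
move=> z0; apply/rowP => k; rewrite mxE; apply: ComplexField.Normc.eq0_normc.
have : sqnorm z = 0 by rewrite -hnorm_sqr z0 expr0n.
rewrite sqnormE => /eqP; rewrite psumr_eq0 => [|i _]; last exact: sqr_ge0.
by move=> /allP/(_ k); rewrite mem_index_enum => /(_ isT)/=; rewrite sqrf_eq0 => /eqP.
Qed.

Lemma ip_le z w : normc (ip z w) <= hnorm z * hnorm w.
Proof.
rewrite -(@ler_pXn2r _ 2) ?nnegrE ?mulr_ge0 ?hnorm_ge0 ?normc_ge0//.
rewrite exprMn (hnorm_sqr z) (hnorm_sqr w) -lecR rmorphXn rmorphM /=.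
rewrite -[X in _ <= X * _]ipzz -[X in _ <= _ * X]ipzz normc_norm 3!ip_dotmx.
by case: (CauchySchwarz (@dotmx _ n) z w).
Qed.

Lemma hnorm_add z w : hnorm (z + w) <= hnorm z + hnorm w.
Proof.
rewrite -(@ler_pXn2r _ 2) ?nnegrE ?addr_ge0 ?hnorm_ge0//.
rewrite hnorm_sqr sqnormD sqrrD (hnorm_sqr z) (hnorm_sqr w) lerD2r lerD2l mulr_natl.
rewrite lerMn2r (le_trans (ler_norm _))//.
by rewrite (le_trans (Re_le_normc _))// ip_le.
Qed.

Lemma hnorm_ge_sub z w : hnorm z - hnorm w <= hnorm (z - w).
Proof. by rewrite lerBlDr -[z in hnorm z](subrK w z) hnorm_add. Qed.

Lemma normc_coord_le z k : normc (z 0 k) <= hnorm z.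
Proof.
rewrite -(@ler_pXn2r _ 2) ?nnegrE ?hnorm_ge0 ?normc_ge0//.
rewrite hnorm_sqr sqnormE (bigD1 k)//= lerDl sumr_ge0// => i _; exact: sqr_ge0.
Qed.

Lemma hnorm_sum I (r : seq I) (P : pred I) (F : I -> Cvec R n) :
  hnorm (\sum_(i <- r | P i) F i) <= \sum_(i <- r | P i) hnorm (F i).
Proof.
elim/big_rec2 : _ => [|i x y _ h]; first by rewrite hnorm0.
by rewrite (le_trans (hnorm_add _ _))// lerD2l.
Qed.

Lemma hnorm_delta k : hnorm (delta_mx 0 k : Cvec R n) = 1.
Proof.
rewrite hnormE sqnormE (bigD1 k)//= big1 => [|i ik].
  by rewrite mxE !eqxx normc1 expr1n addr0 sqrtr1.
by rewrite mxE (negbTE ik) andbF normc0 expr0n.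
Qed.

Lemma hnorm_le_sum z : hnorm z <= \sum_k normc (z 0 k).
Proof.
rewrite [z in hnorm z]row_sum_delta (le_trans (hnorm_sum _ _ _))//.
by apply: ler_sum => k _; rewrite hnorm_scale hnorm_delta mulr1.
Qed.

(** Pz and Qz are orthogonal, whence
    |a - Pz|^2 + (1 - |a|^2) |Qz|^2 = |1 - <z,a>|^2 - (1 - |a|^2)(1 - |z|^2). *)
Lemma sqnorm_Phi a z : unit_ball a -> unit_ball z ->
  1 - sqnorm (Phi a z) =
  (1 - sqnorm a) * (1 - sqnorm z) / normc (1 - ip z a) ^+ 2.
Proof.
move=> aB zB.
pose w := z *m proj_ortho a; pose v := z - w.
have wa : exists c, w = c *: a by apply/sub_rVP; exact: proj_ortho_sub.
have va : ip v a = 0.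
  have := proj_ortho_compl_sub a z => /orthomx1P va.
  by rewrite ip_dotmx [LHS]dotmxE va mxE.
have zE : z = w + v by rewrite /v addrC subrK.
have za : ip z a = ip w a by rewrite zE ipDl va addr0.
have wv : ip w v = 0 by have [c ->] := wa; rewrite ipZl ipC va conjc0 mulr0.
have av : ip a v = 0 by rewrite ipC va conjc0.
have nza : normc (1 - ip z a) != 0.
  apply/eqP => /ComplexField.Normc.eq0_normc/eqP; rewrite subr_eq0 => /eqP H.
  have := ip_le z a; rewrite -H normc1 leNgt => /negP; apply.
  move: aB zB => /unit_ballP aB /unit_ballP zB.
  by apply: le_lt_trans aB; rewrite ler_piMl ?hnorm_ge0// ltW.
have s0 : 0 <= 1 - sqnorm a by rewrite subr_ge0 (ltW aB).
have -> : Phi a z = (1 - ip z a)^-1 *: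
    ((a - w) - (Num.sqrt (1 - sqnorm a))%:C *: v).
  by rewrite /Phi -ip_dotmx mulmxBr mulmx1.
rewrite sqnormZ ComplexField.Normc.normcV exprVn.
set s := Num.sqrt _; have ss : s ^+ 2 = 1 - sqnorm a by rewrite sqr_sqrtr.
have -> : s%:C *: v = - (- s%:C *: v) by rewrite scaleNr opprK.
rewrite opprK (sqnormD (a - w)) (sqnormZ (- s%:C)) normcN normc_real.
rewrite real_normK ?num_real// ss.
rewrite ipZr ipDl ipNl wv av subrr mulr0 /= mulr0 addr0.
have -> : sqnorm (a - w) = sqnorm a - 2 * complex.Re (ip z a) + sqnorm w.
  rewrite sqnormD ipNr cReN -[- w]scaleN1r sqnormZ normcN normc1 za ipC.
  by move: (sqnorm a) (sqnorm w) (ip w a) => A W [x y] /=; ring.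
have Hz : sqnorm z = sqnorm w + sqnorm v by rewrite zE sqnormD wv /= mulr0 addr0.
have Hw : sqnorm a * sqnorm w = normc (ip z a) ^+ 2.
  have [c wc] := wa; rewrite za wc sqnormZ ipZl ipzz.
  rewrite ComplexField.Normc.normcM normc_real exprMn.
  by rewrite ger0_norm ?sqnorm_ge0//; ring.
have Hn : normc (1 - ip z a) ^+ 2 = 1 - 2 * complex.Re (ip z a) + normc (ip z a) ^+ 2.
  case: (ip z a) => x y; rewrite /= !sqr_sqrtr ?addr_ge0 ?sqr_ge0//; ring.
apply: (mulIf (expf_neq0 2 nza)).
rewrite [RHS]divfK ?expf_neq0// mulrBl mul1r mulrAC mulVf ?expf_neq0// mul1r.
rewrite Hn -Hw Hz.
move: (sqnorm a) (sqnorm w) (sqnorm v) (complex.Re _) => *; ring.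
Qed.

End hermitian_geometry.

(** * Complex differentiability in the Hermitian norm *)

Section differential_epsilon.
Context {K : numFieldType} {V W : normedModType K}.
Implicit Types (f : V -> W) (L : {linear V -> W}).

Lemma epsilon_differentiable f L z : continuous L ->
  (forall e : K, 0 < e -> exists2 d : K, 0 < d &
    forall h, `|h| < d -> `|f (z + h) - f z - L h| <= e * `|h|) ->
  differentiable f z /\ 'd f z = L :> (V -> W).
Proof.
move=> Lc fL.
have fo : f \o shift z = cst (f z) + L +o_ 0 id.
  apply/eqaddoP => e e0; have [d d0 dP] := fL _ e0.
  apply/nbhs_norm0P; exists d => // h /= hd.
  by have := dP h hd; rewrite (addrC z) -addrA -opprD.
have E := diff_unique Lc fo.
by split => //; apply/diff_locallyP; rewrite E.
Qed.

Lemma differentiable_epsilon f z : differentiable f z ->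
  forall e : K, 0 < e -> exists2 d : K, 0 < d &
    forall h, `|h| < d -> `|f (z + h) - f z - 'd f z h| <= e * `|h|.
Proof.
move=> fd; have [_ fo] := (diff_locallyP _ _).1 fd.
move=> e e0; move/eqaddoP : fo => /(_ e e0)/nbhs_norm0P[d /= d0 dP].
exists d => // h /dP; rewrite (addrC z) -addrA -opprD.
by rewrite -[(_ \o _ - _) h]/(f (h + z) - (f z + 'd f z h)).
Qed.

End differential_epsilon.

Section differential_on_row_vectors.
Context {K : numFieldType} {n : nat}.
Implicit Types (z h : 'rV[K]_n) (f : 'rV[K]_n -> K^o) (l : 'I_n -> K).

(** The linear form with coefficients l, made an instance so that it can be
    compared with a differential. *)
Definition row_form l h : K^o := \sum_k h 0 k * l k.

Lemma row_form_is_linear l : linear (row_form l).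
Proof.
move=> c x y; rewrite /row_form scaler_sumr -big_split; apply: eq_bigr => k _.
by rewrite !mxE mulrDl -[c *: (_ * _)]/(c * (x 0 k * l k)) mulrA.
Qed.

HB.instance Definition _ l := GRing.isLinear.Build K 'rV[K]_n K^o _
  (row_form l) (row_form_is_linear l).

Lemma row_form_continuous l : continuous (row_form l : 'rV[K]_n -> K^o).
Proof.
apply: continuous_big => [|k _ x]; first exact: add_continuous.
apply: (@cvgM _ _ _ _ (fun y : 'rV[K]_n => y 0 k) (fun=> l k)).
- exact: nbhs_filter.
- exact: (@coord_continuous K 1 n 0 k x).
- by apply: cvg_cst; exact: nbhs_filter.
Qed.

Lemma row_form_delta l k : row_form l (delta_mx 0 k) = l k.
Proof.
rewrite /row_form (bigD1 k)//= big1 => [|i ik]; rewrite mxE ?eqxx ?mul1r ?addr0//.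
by rewrite (negbTE ik) andbF mul0r.
Qed.

Definition row_diff f z l := forall e : K, 0 < e -> exists2 d : K, 0 < d &
  forall h, `|h| < d -> `|f (z + h) - f z - row_form l h| <= e * `|h|.

Lemma row_diff_differentiable f z l : row_diff f z l ->
  differentiable f z /\ forall k, 'D_(delta_mx 0 k) f z = l k.
Proof.
move=> /epsilon_differentiable-/(_ (@row_form_continuous l))[fd E].
by split => // k; rewrite deriveE// E; exact: row_form_delta.
Qed.

Lemma differentiable_row_diff f z : differentiable f z ->
  row_diff f z (fun k => 'D_(delta_mx 0 k) f z).
Proof.
move=> fd e e0; have [d d0 dP] := differentiable_epsilon fd e0.
exists d => // h /dP.
suff -> : 'd f z h = row_form (fun k => 'D_(delta_mx 0 k) f z) h by [].
rewrite [h in LHS]row_sum_delta linear_sum; apply: eq_bigr => k _.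
by rewrite linearZ -deriveE.
Qed.

End differential_on_row_vectors.

Section several_variables.
Context {R : realType} {n : nat}.
Implicit Types (z w h : Cvec R n) (f g : Cvec R n -> R[i]^o) (l : 'I_n -> R[i]).

Definition clinear l h : R[i] := \sum_k h 0 k * l k.

(** The differential is defined with the maximum norm on row vectors, while the
    estimates need the unitarily invariant norm; equivalence of the norms gives
    the same derivatives. *)
Definition hdiff f z l := forall e : R, 0 < e -> exists2 d, 0 < d &
  forall h, hnorm h < d -> normc (f (z + h) - f z - clinear l h) <= e * hnorm h.

Lemma normr_le_hnorm h : `|h| <= (hnorm h)%:C.
Proof.
have [h0|/mx_norm_neq0[[i k] E]] := eqVneq (mx_norm h) 0.
  by rewrite [`|h|]h0 lecR hnorm_ge0.
by rewrite [`|h|]E /= (ord1 i) -normc_norm lecR normc_coord_le.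
Qed.

Lemma normc_le_normr h k : (normc (h 0 k))%:C <= `|h|.
Proof.
rewrite normc_norm [`|h|]mx_normE.
exact: (le_bigmax _ (fun i : 'I_1 * 'I_n => `|h i.1 i.2|%:nng) (0, k)).
Qed.

Lemma hnorm_le_normr h : (hnorm h)%:C <= n%:R * `|h|.
Proof.
rewrite (@le_trans _ _ (\sum_k normc (h 0 k))%:C)//; first by rewrite lecR hnorm_le_sum.
rewrite rmorph_sum /= (@le_trans _ _ (\sum_(k < n) `|h|))//.
  by apply: ler_sum => k _; exact: normc_le_normr.
by rewrite sumr_const card_ord mulr_natl.
Qed.

Lemma pos_complex (e : R[i]) : 0 < e -> exists2 e' : R, 0 < e' & e = e'%:C.
Proof. by case: e => a b; rewrite ltcE /= => /andP[/eqP -> a0]; exists a. Qed.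

Lemma hdiff_differentiable f z l : hdiff f z l ->
  differentiable f z /\ forall k, partial_derivative k f z = l k.
Proof.
move=> fl; apply: row_diff_differentiable => _ /pos_complex[e e0 ->].
have [d d0 dP] := fl _ (divr_gt0 e0 (ltr0Sn R n)).
exists (d / n.+1%:R)%:C; first by rewrite ltcR divr_gt0.
move=> h; have [r [r0 hr rE]] : exists r, [/\ 0 <= r, hnorm h <= n%:R * r & `|h| = r%:C].
  have := normr_ge0 h; have := hnorm_le_normr h; case: `|h| => r i.
  rewrite !lecE /= => /andP[_ H] /andP[/eqP i0 r0]; exists r; split => //.
    by move: H; rewrite -(rmorph_nat (real_complex R)) cReM /= mul0r subr0.
  by rewrite i0.
rewrite rE ltcR ltr_pdivlMr// => hd.
have hr' : hnorm h <= r * n.+1%:R.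
  by rewrite mulrC (le_trans hr)// ler_wpM2r// ler_nat.
have := dP _ (le_lt_trans hr' hd).
rewrite -lecR normc_norm => /le_trans; apply.
rewrite -rmorphM lecR mulrAC ler_pdivrMr// -mulrA ler_wpM2l// ltW//.
Qed.

Lemma differentiable_hdiff f z : differentiable f z ->
  hdiff f z (fun k => partial_derivative k f z).
Proof.
move=> /differentiable_row_diff fd e e0.
have e0' : 0 < (e%:C : R[i]) by rewrite ltcR.
have [_ /pos_complex[d d0 ->] dP] := fd _ e0'.
exists d => // h hd; rewrite -lecR normc_norm.
rewrite (le_trans (dP h _))//.
  by rewrite (le_lt_trans (normr_le_hnorm h))// ltcR.
by rewrite rmorphM ler_wpM2l ?normr_le_hnorm// lecR ltW.
Qed.

End several_variables.

(** * Cauchy's estimates in several variables *)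

Section holomorphic.
Context {R : realType} {n : nat}.
Implicit Types (z w h v : Cvec R n) (f g F : Cvec R n -> R[i]^o) (l : 'I_n -> R[i]).

Notation normcM := ComplexField.Normc.normcM.

Lemma clinearZ l c h : clinear l (c *: h) = c * clinear l h.
Proof. by rewrite /clinear mulr_sumr; apply: eq_bigr => k _; rewrite mxE mulrA. Qed.

Lemma clinear_delta l k : clinear l (delta_mx 0 k : Cvec R n) = l k.
Proof. exact: row_form_delta. Qed.

Lemma clinear_le l h (M : R) : (forall k, normc (l k) <= M) ->
  normc (clinear l h) <= n%:R * M * hnorm h.
Proof.
move=> lM; rewrite (le_trans (normc_sum _ _ _))//.
rewrite (@le_trans _ _ (\sum_(k < n) M * hnorm h))//.
  by apply: ler_sum => k _; rewrite normcM mulrC ler_pM ?normc_ge0 ?normc_coord_le.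
by rewrite sumr_const card_ord -mulrA mulr_natl.
Qed.

Definition pd f z : 'I_n -> R[i] := fun k => partial_derivative k f z.

Lemma pdP f z : differentiable f z -> hdiff f z (pd f z).
Proof. exact: differentiable_hdiff. Qed.

Lemma hdiff_pd f z l : hdiff f z l -> differentiable f z /\ pd f z = l.
Proof. by move=> /hdiff_differentiable[? fl]; split => //; apply/funext. Qed.

Lemma hdiff_near f g z l (r : R) : 0 < r ->
  (forall w, hnorm (w - z) < r -> f w = g w) -> hdiff f z l -> hdiff g z l.
Proof.
move=> r0 fg fl e e0; have [d d0 dP] := fl _ e0.
exists (Num.min d r); first by rewrite lt_min d0.
move=> h; rewrite lt_min => /andP[/dP h1 h2].
by rewrite -!fg// ?subrr ?hnorm0// addrC addKr.
Qed.

Lemma hdiffZD f g z l m c : hdiff f z l -> hdiff g z m ->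
  hdiff (fun z => c * f z + g z) z (fun k => c * l k + m k).
Proof.
move=> fl gm e e0; have c0 : 0 < 2 * (normc c + 1).
  by rewrite mulr_gt0// ltr_wpDl// normc_ge0.
have [d d0 dP] := fl _ (divr_gt0 e0 c0).
have [d' d'0 d'P] := gm _ (divr_gt0 e0 (ltr0Sn R 1)).
exists (Num.min d d'); first by rewrite lt_min d0.
move=> h; rewrite lt_min => /andP[/dP h1 /d'P h2].
have -> : clinear (fun k => c * l k + m k) h = c * clinear l h + clinear m h.
  rewrite /clinear mulr_sumr -big_split; apply: eq_bigr => k _ /=; ring.
have -> : c * f (z + h) + g (z + h) - (c * f z + g z) - (c * clinear l h + clinear m h) =
  c * (f (z + h) - f z - clinear l h) + (g (z + h) - g z - clinear m h) by ring.
rewrite (le_trans (normcD _ _))// normcM.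
have -> : e * hnorm h = e / 2 * hnorm h + e / 2 * hnorm h by field.
rewrite lerD//; apply: le_trans (ler_wpM2l (normc_ge0 _) h1) _.
have c1 : 0 < normc c + 1 by rewrite ltr_wpDl// normc_ge0.
rewrite mulrA ler_wpM2r ?hnorm_ge0//.
have -> : normc c * (e / (2 * (normc c + 1))) = e / 2 * (normc c / (normc c + 1)).
  by field; rewrite gt_eqF.
by rewrite ler_piMr ?divr_ge0 ?(ltW e0)// ler_pdivrMr// mul1r lerDl.
Qed.

Lemma hdiffZ f z l c : hdiff f z l -> hdiff (fun z => c * f z) z (fun k => c * l k).
Proof.
move=> fl; have := hdiffZD (c - 1) fl fl.
rewrite (_ : (fun k => _) = fun k => c * l k); last first.
  by apply/funext => k; rewrite mulrBl mul1r subrK.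
apply: (hdiff_near ltr01) => w _.
by rewrite mulrBl mul1r subrK.
Qed.

Lemma hdiff_shift f z h l : hdiff f (z + h) l -> hdiff (fun w => f (w + h)) z l.
Proof.
move=> fl e /fl[d d0 dP]; exists d => // k /dP.
by rewrite (addrAC z).
Qed.

Lemma hdiff_scale f z (c : R[i]) l : hdiff f (c *: z) l ->
  hdiff (fun w => f (c *: w)) z (fun k => c * l k).
Proof.
move=> fl e e0; have c0 : 0 < normc c + 1 by rewrite ltr_wpDl// normc_ge0.
have [d d0 dP] := fl _ (divr_gt0 e0 c0).
exists (d / (normc c + 1)); first exact: divr_gt0.
move=> h; rewrite ltr_pdivlMr// => hd.
have ch : hnorm (c *: h) <= hnorm h * (normc c + 1).
  by rewrite hnorm_scale mulrC ler_wpM2l ?hnorm_ge0// lerDl.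
have := dP (c *: h) (le_lt_trans ch hd).
rewrite -scalerDr clinearZ.
have -> : clinear (fun k => c * l k) h = c * clinear l h.
  by rewrite /clinear mulr_sumr; apply: eq_bigr => k _; rewrite mulrCA.
move=> /le_trans; apply.
by rewrite mulrAC ler_pdivrMr// -mulrA ler_wpM2l// ltW.
Qed.

Lemma hdiff_line f z v (c : R[i]) l : hdiff f (z + c *: v) l ->
  cdiff (fun c => f (z + c *: v)) c (clinear l v).
Proof.
move=> fl e e0; have c0 : 0 < hnorm v + 1 by rewrite ltr_wpDl// hnorm_ge0.
have [d d0 dP] := fl _ (divr_gt0 e0 c0).
exists (d / (hnorm v + 1)); first exact: divr_gt0.
move=> k; rewrite ltr_pdivlMr// => hd.
have ch : hnorm (k *: v) <= normc k * (hnorm v + 1).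
  by rewrite hnorm_scale ler_wpM2l ?normc_ge0// lerDl.
have := dP (k *: v) (le_lt_trans ch hd).
have -> : z + c *: v + k *: v = z + (c + k) *: v by rewrite scalerDl addrA.
rewrite clinearZ mulrC => /le_trans; apply.
by rewrite mulrAC ler_pdivrMr// -mulrA ler_wpM2l// ltW.
Qed.

Lemma hdiff_rdiff f z v (t : R) l : hdiff f (z + t%:C *: v) l ->
  rdiff (fun t => f (z + t%:C *: v)) t (clinear l v).
Proof.
move=> /hdiff_line fl e /fl[d d0 dP]; exists d => // h hd.
by have := dP h%:C; rewrite normc_real rmorphD /=; apply.
Qed.

Lemma hdiff_cont f z l : hdiff f z l -> forall e : R, 0 < e ->
  exists2 d, 0 < d & forall w, hnorm (w - z) < d -> normc (f w - f z) < e.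
Proof.
move=> fl e e0; have [d d0 dP] := fl _ ltr01.
pose M := \sum_k normc (l k).
have lM k : normc (l k) <= M.
  by rewrite /M (bigD1 k)//= lerDl sumr_ge0// => i _; exact: normc_ge0.
have M0 : 0 <= M by rewrite sumr_ge0// => i _; exact: normc_ge0.
have c0 : 0 < n%:R * M + 1 by rewrite ltr_wpDl// mulr_ge0.
exists (Num.min d (e / (n%:R * M + 1))); first by rewrite lt_min d0 divr_gt0.
move=> w; rewrite lt_min ltr_pdivlMr// => /andP[/dP + he].
rewrite subrKC mul1r => h1.
rewrite -(subrK (clinear l (w - z)) (_ - _)) (le_lt_trans (normcD _ _))//.
rewrite (le_lt_trans _ he)// mulrDr mulr1 addrC lerD// mulrC.
exact: clinear_le.
Qed.

(** Cauchy's estimate in one variable on the complex line through w in the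
    direction v. *)
Lemma hdiff_cauchy f w v (r r0 B : R) : 0 < r < r0 ->
  (forall z, hnorm (z - w) < r0 -> differentiable f z) ->
  (forall z, hnorm (z - w) <= r -> normc (f z) <= B) ->
  normc (clinear (pd f w) v) <= 4 * B / r * hnorm v.
Proof.
move=> rr0 fd fB; have /andP[r_gt0 rltr0] := rr0.
have r0_gt0 := lt_trans r_gt0 rltr0.
have fw : hdiff f w (pd f w) by apply/pdP/fd; rewrite subrr hnorm0.
have [v0|v0] := eqVneq (hnorm v) 0.
  by rewrite (hnorm_eq0 v0) -(scale0r (0 : Cvec R n)) clinearZ mul0r normc0 scale0r hnorm0 mulr0.
have nv0 : 0 < hnorm v by rewrite lt_def v0 hnorm_ge0.
pose u := ((hnorm v)^-1)%:C *: v.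
have nu : hnorm u = 1.
  by rewrite /u hnorm_scale normc_real ger0_norm ?invr_ge0 ?hnorm_ge0// mulVf.
have -> : v = (hnorm v)%:C *: u.
  by rewrite /u scalerA -rmorphM /= mulfV// rmorph1 scale1r.
rewrite clinearZ normcM normc_real hnorm_scale normc_real nu mulr1 mulrC.
rewrite ler_wpM2r//.
have E c : hnorm (w + c *: u - w) = normc c by rewrite addrC addKr hnorm_scale nu mulr1.
apply: (@cauchy_estimate _ (fun c => f (w + c *: u)) 0 r0 r B) => //.
- move=> h hr; rewrite add0r; eexists; apply: hdiff_line; apply: pdP; apply: fd.
  by rewrite E.
- by move=> h hr; rewrite add0r; apply: fB; rewrite E.
- by apply: hdiff_line; rewrite scale0r addr0.
Qed.

Lemma hdiff_mvt f w h (M : R) :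
  (forall t : R, 0 <= t <= 1 -> differentiable f (w + t%:C *: h)) ->
  (forall t : R, 0 <= t <= 1 -> normc (clinear (pd f (w + t%:C *: h)) h) <= M) ->
  normc (f (w + h) - f w) <= 2 * M.
Proof.
move=> fd fM.
have := @rdiff_mvt _ (fun t => f (w + t%:C *: h))
  (fun t => clinear (pd f (w + t%:C *: h)) h) M.
rewrite scale1r scale0r addr0; apply => // t /fd ?.
by apply: hdiff_rdiff; exact: pdP.
Qed.

Definition increment f h z : R[i]^o := f (z + h) - f z.

Lemma diff_increment f z h : differentiable f z -> differentiable f (z + h) ->
  differentiable (increment f h) z /\
  pd (increment f h) z = (fun k => pd f (z + h) k - pd f z k).
Proof.
move=> /pdP fz /pdP fzh; apply: hdiff_pd.
have := hdiffZD (-1) fz (hdiff_shift fzh).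
rewrite (_ : (fun z => _) = increment f h); last first.
  by apply/funext => w; rewrite mulN1r addrC.
rewrite (_ : (fun k => _) = (fun k => pd f (z + h) k - pd f z k))//.
by apply/funext => w; rewrite mulN1r addrC.
Qed.

Lemma clinearB l m h : clinear (fun k => l k - m k) h = clinear l h - clinear m h.
Proof. by rewrite -sumrB; apply: eq_bigr => k _; rewrite mulrBr. Qed.

(** Cauchy's estimate for the increment f (z + h) - f z, which is small by
    Cauchy's estimate for f: the derivative is locally Lipschitz. *)
Lemma pd_lipschitz f w h v (r r0 B : R) : 0 < r < r0 ->
  (forall z, hnorm (z - w) < r0 -> differentiable f z) ->
  (forall z, hnorm (z - w) <= r -> normc (f z) <= B) -> hnorm h <= r / 4 ->
  normc (clinear (pd f (w + h)) v - clinear (pd f w) v) <=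
    256 * B / r ^+ 2 * hnorm h * hnorm v.
Proof.
move=> /andP[r_gt0 rr0] fd fB hr.
have inc z : hnorm (z - w) < r / 2 -> differentiable f z /\ differentiable f (z + h).
  move=> zw; split; apply: fd; first by lra.
  by rewrite addrAC (le_lt_trans (hnorm_add _ _))//; lra.
have wr : hnorm (w - w) < r / 2 by rewrite subrr hnorm0; lra.
have [fw fwh] := inc w wr; have [_ pdD] := diff_increment fw fwh.
rewrite -clinearB -pdD.
(* Cauchy's estimate on the radius r / 4 for the increment, which is at most
   2 * (4 * B / (r / 2)) * |h| by the mean value inequality and Cauchy's
   estimate on the radius r / 2 *)
have -> : 256 * B / r ^+ 2 * hnorm h * hnorm v =
  4 * (16 * B / r * hnorm h) / (r / 4) * hnorm v by field; rewrite gt_eqF.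
apply: (@hdiff_cauchy _ _ _ _ (r / 2)); first by lra.
  by move=> z /inc[fz fzh]; exact: (diff_increment fz fzh).1.
move=> z zw; have -> : 16 * B / r * hnorm h = 2 * (4 * B / (r / 2) * hnorm h).
  by field; rewrite gt_eqF.
have seg (t : R) : 0 <= t <= 1 -> hnorm (z + t%:C *: h - w) <= r / 2.
  move=> /andP[t0 t1]; rewrite addrAC (le_trans (hnorm_add _ _))// hnorm_scale normc_real.
  have : `|t| * hnorm h <= 1 * hnorm h by rewrite ler_wpM2r ?hnorm_ge0// ger0_norm.
  lra.
apply: hdiff_mvt => t t01; have := seg t t01 => zt.
  by apply: fd; lra.
apply: (@hdiff_cauchy _ _ _ _ (r0 - r / 2)); first by lra.
- by move=> u uz; apply: fd; rewrite -(subrK (z + t%:C *: h) u) -addrA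
    (le_lt_trans (hnorm_add _ _))//; lra.
- by move=> u uz; apply: fB; rewrite -(subrK (z + t%:C *: h) u) -addrA
    (le_trans (hnorm_add _ _))//; lra.
Qed.

Let alg (a b l m t s : R[i]) :
  a - (t + s) * m - (b - t * m) - (l - m) * s = a - b - l * s.
Proof. by ring. Qed.

(** The derivative of t |-> f (w + t h) - t df(w) h is small by pd_lipschitz. *)
Lemma taylor2 f w h (r r0 B : R) : 0 < r < r0 ->
  (forall z, hnorm (z - w) < r0 -> differentiable f z) ->
  (forall z, hnorm (z - w) <= r -> normc (f z) <= B) -> hnorm h <= r / 4 ->
  normc (f (w + h) - f w - clinear (pd f w) h) <= 512 * B / r ^+ 2 * hnorm h ^+ 2.
Proof.
move=> rr0 fd fB hr; have /andP[r_gt0 rltr0] := rr0.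
pose g t := f (w + t%:C *: h) - t%:C * clinear (pd f w) h.
have th (t : R) : 0 <= t <= 1 -> hnorm (t%:C *: h) <= hnorm h.
  move=> /andP[t0 t1]; rewrite hnorm_scale normc_real ger0_norm//.
  by rewrite ler_piMl ?hnorm_ge0.
have := @rdiff_mvt _ g (fun t => clinear (pd f (w + t%:C *: h)) h - clinear (pd f w) h)
  (256 * B / r ^+ 2 * hnorm h ^+ 2).
rewrite /g scale1r scale0r addr0 mul1r mul0r subr0.
have -> : f (w + h) - clinear (pd f w) h - f w = f (w + h) - f w - clinear (pd f w) h.
  by rewrite addrAC.
have -> : 2 * (256 * B / r ^+ 2 * hnorm h ^+ 2) = 512 * B / r ^+ 2 * hnorm h ^+ 2.
  by field; rewrite gt_eqF.
apply => t t01; have tht := th t t01.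
- have : hdiff f (w + t%:C *: h) (pd f (w + t%:C *: h)).
    by apply/pdP/fd; rewrite addrC addKr; lra.
  move=> /hdiff_rdiff fr e /fr[d d0 dP]; exists d => // k /dP.
  by rewrite rmorphD /= (alg (f (w + (t%:C + k%:C) *: h))).
- rewrite (le_trans (pd_lipschitz _ rr0 fd fB _))//; first by lra.
  have B0 : 0 <= B.
    by apply: le_trans (normc_ge0 (f w)) (fB w _); rewrite subrr hnorm0 ltW.
  have K0 : 0 <= 256 * B / r ^+ 2.
    apply: divr_ge0; first exact: (mulr_ge0 (ler0n _ _) B0).
    exact/exprn_ge0/ltW.
  rewrite expr2 [leRHS]mulrA; apply: ler_wpM2r; first exact: hnorm_ge0.
  exact: ler_wpM2l.
Qed.

End holomorphic.

(** * Holomorphy of partial derivatives and of averages along rays *)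

Section weierstrass.
Context {R : realType} {n : nat}.
Implicit Types (z w h v : Cvec R n) (f g F G : Cvec R n -> R[i]^o) (l : 'I_n -> R[i]).

Notation normcM := ComplexField.Normc.normcM.

(** The partial derivatives of the approximating functions are circle integrals
    of difference quotients, so they converge; taylor2 bounds the remainders of
    the first-order expansions uniformly. *)
Lemma weierstrass F w (r r0 B : R) : 0 < r < r0 ->
  (forall z, hnorm (z - w) <= r -> normc (F z) <= B) ->
  (forall e : R, 0 < e -> exists G : Cvec R n -> R[i]^o,
    (forall z, hnorm (z - w) < r0 -> differentiable G z) /\
    (forall z, hnorm (z - w) <= r -> normc (G z - F z) <= e)) ->
  differentiable F w.
Proof.
move=> rr0 FB FG; have /andP[r_gt0 rltr0] := rr0.
pose ek k : Cvec R n := delta_mx 0 k.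
pose q (f : Cvec R n -> R[i]^o) k y : R[i] :=
  (f (w + (r%:C * unitc y) *: ek k) - f w) * (r%:C * unitc y)^-1.
have n1 y : normc (r%:C * unitc y) = r.
  by rewrite normcM normc_real normc_unitc mulr1 gtr0_norm.
have ek1 (c : R[i]) k : hnorm (w + c *: ek k - w) = normc c.
  by rewrite addrC addKr hnorm_scale hnorm_delta mulr1.
have Gq G k : (forall z, hnorm (z - w) < r0 -> differentiable G z) ->
    (forall y, ccont (q G k) y) /\ pd G w k = cint 0 1 (q G k).
  move=> Gd; have Gh c : normc c < r0 ->
      cdiff (fun c => G (w + c *: ek k)) c (clinear (pd G (w + c *: ek k)) (ek k)).
    by move=> cr; apply/hdiff_line/pdP/Gd; rewrite ek1.
  have := @cauchy_derivative _ (fun c => G (w + c *: ek k)) 0 r0 r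
     (clinear (pd G (w + 0 *: ek k)) (ek k)) rr0 _ _.
  rewrite scale0r addr0 clinear_delta.
  have -> : (fun y : R => (G (w + (0 + r%:C * unitc y) *: ek k) - G w) /
     (r%:C * unitc y)) = q G k by apply/funext => y; rewrite add0r.
  apply.
  - by move=> h hr; rewrite add0r; eexists; exact: Gh.
  - by have := Gh 0; rewrite normc0 scale0r addr0 clinear_delta; apply; exact: lt_trans rltr0.
have qd G e k y : (forall z, hnorm (z - w) <= r -> normc (G z - F z) <= e) ->
    normc (q G k y - q F k y) <= 2 * e / r.
  move=> GF; rewrite /q -mulrBl normcM ComplexField.Normc.normcV n1.
  rewrite ler_pM2r ?invr_gt0//.
  rewrite (_ : G _ - _ - (_ - _) = (G (w + (r%:C * unitc y) *: ek k) -
     F (w + (r%:C * unitc y) *: ek k)) - (G w - F w)); last first.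
    by move: (G _) (F _) (G _) (F _) => a b c d; ring.
  rewrite (le_trans (normcD _ _))// normcN mulr_natl mulr2n lerD// GF//.
    by rewrite ek1 n1.
  by rewrite subrr hnorm0 ltW.
have qFc k y : ccont (q F k) y.
  move=> e e0.
  have e'0 : 0 < e * r / 8 by rewrite divr_gt0// mulr_gt0.
  have [G [Gd GF]] := FG _ e'0.
  have [qGc _] := Gq G k Gd.
  have [d d0 dP] := qGc y _ (divr_gt0 e0 (ltr0Sn R 1)).
  exists d => // x /dP h1.
  have h2 := qd _ _ k x GF; have h3 := qd _ _ k y GF.
  have E : 2 * (e * r / 8) / r = e / 4 by field; rewrite gt_eqF.
  rewrite E in h2 h3.
  have -> : q F k x - q F k y =
    (q G k x - q G k y) + ((q G k y - q F k y) - (q G k x - q F k x)) by ring.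
  rewrite (le_lt_trans (normcD _ _))// (le_lt_trans (lerD (lexx _) (normcD _ _)))//.
  by rewrite normcN; lra.
pose l k := cint 0 1 (q F k).
have lG G e k : (forall z, hnorm (z - w) < r0 -> differentiable G z) ->
    (forall z, hnorm (z - w) <= r -> normc (G z - F z) <= e) ->
    normc (pd G w k - l k) <= 4 * e / r.
  move=> Gd GF; have [qGc ->] := Gq G k Gd.
  rewrite /l -cintB//.
  have -> : 4 * e / r = 2 * ((1 - 0) * (2 * e / r)) by rewrite subr0; ring.
  apply: cint_le => //.
    by move=> x _; apply: ccontB.
  by move=> x _; exact: qd.
have B0 : 0 <= B.
  by apply: le_trans (normc_ge0 (F w)) (FB w _); rewrite subrr hnorm0 ltW.
pose K := 512 * (B + 1) / r ^+ 2.
have K0 : 0 <= K.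
  apply: divr_ge0; last exact/exprn_ge0/ltW.
  by apply: mulr_ge0; [exact: ler0n|exact: addr_ge0].
have main h : hnorm h <= r / 4 ->
    normc (F (w + h) - F w - clinear l h) <= K * hnorm h ^+ 2.
  move=> hr; apply/ler_addgt0Pl => e e0.
  (* the total error of replacing F by G is e' times this constant *)
  pose c := 2 + 4 * n%:R * hnorm h / r.
  have c0 : 0 < c.
    by rewrite ltr_wpDr// divr_ge0 ?(ltW r_gt0)// mulr_ge0 ?hnorm_ge0.
  have [e' [e'0 e'1 e'c]] : exists e' : R, [/\ 0 < e', e' <= 1 & e' * c <= e].
    exists (Num.min 1 (e / c)); split; first by rewrite lt_min ltr01 divr_gt0.
      by rewrite ge_min lexx.
    by rewrite -ler_pdivlMr// ge_min lexx orbT.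
  have [G [Gd GF]] := FG _ e'0.
  have GB z : hnorm (z - w) <= r -> normc (G z) <= B + 1.
    move=> zr; rewrite -(subrK (F z) (G z)) (le_trans (normcD _ _))// addrC lerD ?FB//.
    by rewrite (le_trans (GF z zr)).
  have := taylor2 rr0 Gd GB hr; rewrite -/K => T.
  have wh : hnorm (w + h - w) <= r by rewrite addrC addKr; lra.
  have ww : hnorm (w - w) <= r by rewrite subrr hnorm0 ltW.
  have := clinear_le h (fun k => lG G e' k Gd GF); rewrite clinearB => L.
  have G1 := GF _ wh; have G2 := GF _ ww.
  rewrite (_ : F _ - _ - _ = (G (w + h) - G w - clinear (pd G w) h) +
     ((clinear (pd G w) h - clinear l h) +
     ((G w - F w) - (G (w + h) - F (w + h))))); last first.
    by move: (G _) (F _) (G _) (F _) (clinear _ _) (clinear _ _) => a b a' b' x y; ring.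
  apply: le_trans (normcD _ _) _; rewrite addrC lerD//.
  apply: le_trans (normcD _ _) _.
  have := normcD (G w - F w) (- (G (w + h) - F (w + h))); rewrite normcN => G3.
  have E : n%:R * (4 * e' / r) * hnorm h + 2 * e' = e' * c by rewrite /c; ring.
  move: L G1 G2 G3 E e'c.
  move: (normc _) (normc _) (normc _) (normc _) => x1 x2 x3 x4 *; lra.
apply: (hdiff_pd (l := l) _).1 => e e0.
exists (Num.min (r / 4) (e / (K + 1))); first by rewrite lt_min !divr_gt0//; lra.
move=> h; rewrite lt_min => /andP[/ltW /main hr he].
rewrite (le_trans hr)// expr2 mulrA ler_wpM2r ?hnorm_ge0//.
move: he; rewrite ltr_pdivlMr; last by lra.
rewrite mulrDr mulr1 => he; rewrite mulrC ltW// (le_lt_trans _ he)// lerDl.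
exact: hnorm_ge0.
Qed.

(** By taylor2 the difference quotients, which are holomorphic, converge to the
    partial derivative locally uniformly. *)
Lemma pd_differentiable f w k (r r0 B : R) : 0 < r < r0 ->
  (forall z, hnorm (z - w) < r0 -> differentiable f z) ->
  (forall z, hnorm (z - w) <= r -> normc (f z) <= B) ->
  differentiable (fun z => pd f z k : R[i]^o) w.
Proof.
move=> /andP[r_gt0 rr0] fd fB.
have near z u (s t : R) : hnorm (z - w) <= s -> hnorm (u - z) <= t ->
    hnorm (u - w) <= t + s.
  by move=> zs ut; rewrite -(subrK z u) -addrA (le_trans (hnorm_add _ _))// lerD.
have r20 : 0 < r / 2 < r0 - r / 4 by lra.
have fdz z : hnorm (z - w) <= r / 4 -> forall u, hnorm (u - z) < r0 - r / 4 ->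
    differentiable f u.
  move=> zr u uz; apply: fd; rewrite -(subrK z u) -addrA (le_lt_trans (hnorm_add _ _))//.
  lra.
have fBz z : hnorm (z - w) <= r / 4 -> forall u, hnorm (u - z) <= r / 2 -> normc (f u) <= B.
  by move=> zr u uz; apply: fB; have := near _ _ _ _ zr uz; lra.
apply: (@weierstrass _ _ (r / 4) (r / 2) (4 * B / (r / 2))); first by lra.
  move=> z zr; have := hdiff_cauchy (delta_mx 0 k) r20 (fdz z zr) (fBz z zr).
  by rewrite clinear_delta hnorm_delta mulr1.
move=> e e0.
have B0 : 0 <= B.
  by apply: le_trans (normc_ge0 (f w)) (fB w _); rewrite subrr hnorm0 ltW.
pose K := 512 * B / (r / 2) ^+ 2.
have K0 : 0 <= K.
  have r2_ge0 : 0 <= r / 2 by lra.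
  apply: divr_ge0; last exact: exprn_ge0.
  by apply: mulr_ge0; [exact: ler0n|exact: B0].
pose t := Num.min (r / 8) (e / (K + 1)).
have t0 : 0 < t by rewrite lt_min !divr_gt0//; lra.
have tr : t <= r / 8 by rewrite ge_min lexx.
have te : t * K <= e.
  have : t <= e / (K + 1) by rewrite ge_min lexx orbT.
  by rewrite ler_pdivlMr; lra.
pose ek : Cvec R n := t%:C *: delta_mx 0 k.
have nek : hnorm ek = t by rewrite /ek hnorm_scale hnorm_delta mulr1 normc_real gtr0_norm.
exists (fun z => (t^-1)%:C * increment f ek z); split.
  move=> z zr; have fz : differentiable f z by apply: fd; lra.
  have fze : differentiable f (z + ek).
    apply: fd; rewrite addrAC (le_lt_trans (hnorm_add _ _))// nek; lra.
  have [/pdP D _] := diff_increment fz fze.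
  exact: (hdiff_pd (hdiffZ (t^-1)%:C D)).1.
move=> z zr; have hek : hnorm ek <= r / 2 / 4 by rewrite nek; lra.
have := taylor2 r20 (fdz z zr) (fBz z zr) hek.
rewrite /ek clinearZ clinear_delta -/ek nek -/K => T.
have -> : (t^-1)%:C * increment f ek z - pd f z k =
    (t^-1)%:C * (f (z + ek) - f z - t%:C * pd f z k).
  by rewrite [RHS]mulrBr mulrA -rmorphM /= mulVf ?gt_eqF// rmorph1 mul1r.
rewrite normcM normc_real gtr0_norm ?invr_gt0// mulrC ler_pdivrMr//.
by rewrite (le_trans T)// expr2 mulrA ler_wpM2r ?(ltW t0)// mulrC.
Qed.

Lemma hdiff_sum I (s : seq I) (F : I -> Cvec R n -> R[i]^o) z
    (l : I -> 'I_n -> R[i]) :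
  (forall i, hdiff (F i) z (l i)) ->
  hdiff (fun z => \sum_(i <- s) F i z : R[i]^o) z (fun k => \sum_(i <- s) l i k).
Proof.
move=> Fl; elim: s => [|i s IH].
  move=> e e0; exists 1 => // h _; rewrite !big_nil subrr sub0r normcN /clinear.
  rewrite big1 ?normc0 ?mulr_ge0 ?hnorm_ge0 ?(ltW e0)// => k _.
  by rewrite big_nil mulr0.
have := hdiffZD 1 (Fl i) IH.
rewrite (_ : (fun k => _) = (fun k => \sum_(j <- i :: s) l j k)); last first.
  by apply/funext => k; rewrite big_cons mul1r.
by apply: (hdiff_near ltr01) => w _; rewrite big_cons mul1r.
Qed.

(** The bounds to which the Cauchy estimates are applied; for functions of finite
    norm they come from growth_estimate. *)
Definition locally_bounded F := forall rho : R, rho < 1 ->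
  exists B, forall z, hnorm z <= rho -> normc (F z) <= B.

Definition holo F := (forall z, hnorm z < 1 -> differentiable F z) /\ locally_bounded F.

Lemma holo_pd f k : holo f -> holo (fun z => pd f z k : R[i]^o).
Proof.
move=> [fd fb].
have shift (rho : R) z w (s : R) : hnorm w <= rho -> hnorm (z - w) <= s -> hnorm z <= rho + s.
  by move=> wr zw; rewrite -(subrK w z) (le_trans (hnorm_add _ _))// addrC lerD.
split=> [w w1|rho rho1].
  have [B fB] := fb ((1 + hnorm w) / 2) (ltac:(lra)).
  apply: (@pd_differentiable _ _ _ ((1 - hnorm w) / 2) (1 - hnorm w) B); first by lra.
    move=> z zw; apply: fd; rewrite -(subrK w z) (le_lt_trans (hnorm_add _ _))//; lra.
  by move=> z zw; apply: fB; have := shift _ _ _ _ (lexx (hnorm w)) zw; lra.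
have [B fB] := fb ((1 + rho) / 2) (ltac:(lra)).
exists (4 * B / ((1 - rho) / 2)) => z zr.
have rr : 0 < (1 - rho) / 2 < 1 - rho by lra.
have := @hdiff_cauchy _ _ f z (delta_mx 0 k) _ _ B rr.
rewrite clinear_delta hnorm_delta mulr1; apply.
- by move=> u uz; apply: fd; rewrite -(subrK z u) (le_lt_trans (hnorm_add _ _))//; lra.
- by move=> u uz; apply: fB; have := shift _ _ _ _ zr uz; lra.
Qed.

(** Cauchy's estimate bounds the derivative on a ball of radius rho < 1. *)
Lemma holo_lipschitz F : holo F -> forall rho : R, rho < 1 -> exists2 C, 0 <= C &
  forall z w, hnorm z <= rho -> hnorm w <= rho ->
    normc (F z - F w) <= C * hnorm (z - w).
Proof.
move=> [Fd Fb] rho rho1.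
have [B FB] := Fb ((1 + rho) / 2) (ltac:(lra)).
pose C := 4 * `|B| / ((1 - rho) / 2).
have rr : 0 < (1 - rho) / 2 < 1 - rho by lra.
have C0 : 0 <= C.
  apply: divr_ge0; last by lra.
  by apply: mulr_ge0; [exact: ler0n|exact: normr_ge0].
exists (2 * C); first by apply: mulr_ge0; [exact: ler0n|].
move=> z w zr wr; rewrite -mulrA -[in normc _](subrK w z) (addrC (z - w) w).
have seg (t : R) : 0 <= t <= 1 -> hnorm (w + t%:C *: (z - w)) <= rho.
  move=> /andP[t0 t1].
  have -> : w + t%:C *: (z - w) = (1 - t)%:C *: w + t%:C *: z.
    by rewrite rmorphB /= rmorph1 scalerBl scale1r scalerBr addrA addrAC.
  rewrite (le_trans (hnorm_add _ _))// !hnorm_scale !normc_real.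
  rewrite ger0_norm ?subr_ge0// ger0_norm//.
  have : (1 - t) * hnorm w <= (1 - t) * rho by rewrite ler_wpM2l// subr_ge0.
  have : t * hnorm z <= t * rho by rewrite ler_wpM2l.
  lra.
apply: hdiff_mvt => t t01; have tr := seg t t01; first by apply: Fd; lra.
apply: (hdiff_cauchy _ rr).
- by move=> u uz; apply: Fd; rewrite -(subrK (w + t%:C *: (z - w)) u)
    (le_lt_trans (hnorm_add _ _))//; lra.
- move=> u uz; apply: le_trans (ler_norm B); apply: FB.
  by rewrite -(subrK (w + t%:C *: (z - w)) u) (le_trans (hnorm_add _ _))//; lra.
Qed.

Lemma rdiff_ccont (g : R -> R[i]) t D : rdiff g t D -> ccont g t.
Proof.
move=> gD e e0; have [d d0 dP] := gD _ ltr01.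
have c0 : 0 < normc D + 1 by rewrite ltr_wpDl// normc_ge0.
exists (Num.min d (e / (normc D + 1))); first by rewrite lt_min d0 divr_gt0.
move=> y; rewrite lt_min ltr_pdivlMr// => /andP[/dP + he].
rewrite subrKC mul1r => h1.
rewrite -(subrK (D * (y - t)%:C) (_ - _)) (le_lt_trans (normcD _ _))//.
by rewrite (le_lt_trans _ he)// mulrDr mulr1 addrC lerD// normcM normc_real mulrC.
Qed.

Lemma holo_rdiff F z (t : R) : holo F -> hnorm (t%:C *: z) < 1 ->
  rdiff (fun t : R => F (t%:C *: z)) t (clinear (pd F (t%:C *: z)) z).
Proof.
move=> [Fd _] tz; have := pdP (Fd _ tz); rewrite -[t%:C *: z]add0r => /hdiff_rdiff.
by rewrite (_ : (fun t => F (0 + t%:C *: z)) = (fun t => F (t%:C *: z)))//;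
  apply/funext => s; rewrite add0r.
Qed.

Lemma hnorm_scale01 z (t : R) : 0 <= t <= 1 -> hnorm (t%:C *: z) = t * hnorm z.
Proof. by move=> /andP[t0 _]; rewrite hnorm_scale normc_real ger0_norm. Qed.

Lemma hnorm_scale01_le z (t : R) : 0 <= t <= 1 -> hnorm (t%:C *: z) <= hnorm z.
Proof.
move=> t01; rewrite hnorm_scale01//; have /andP[t0 t1] := t01.
by rewrite ler_piMl// hnorm_ge0.
Qed.

Lemma holo_ccont F z (t : R) : holo F -> hnorm z < 1 -> 0 <= t <= 1 ->
  ccont (fun t : R => F (t%:C *: z)) t.
Proof.
move=> Fh z1 t01; apply: (rdiff_ccont (holo_rdiff Fh _)).
exact: le_lt_trans (hnorm_scale01_le _ t01) z1.
Qed.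

Definition ray_average F z : R[i]^o := cint 0 1 (fun t => F (t%:C *: z)).

Lemma ray_average_le F z B : holo F -> hnorm z < 1 ->
  (forall w, hnorm w <= hnorm z -> normc (F w) <= B) ->
  normc (ray_average F z) <= 2 * B.
Proof.
move=> Fh z1 FB; apply: le_trans (cint_le (M := B) _ _ _) _ => //.
- by move=> t t01; exact: holo_ccont.
- by move=> t t01; apply/FB/hnorm_scale01_le.
- by rewrite subr0 mul1r.
Qed.

(** The average is the locally uniform limit of its Riemann sums, which are
    holomorphic; holo_lipschitz makes the convergence uniform. *)
Lemma holo_ray_average F : holo F -> holo (ray_average F).
Proof.
move=> Fh; have [Fd Fb] := Fh.
split=> [w w1|rho rho1]; last first.
  have [B FB] := Fb _ rho1; exists (2 * B) => z zr.
  apply: ray_average_le => //; first exact: le_lt_trans zr rho1.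
  by move=> u uz; apply: FB; exact: le_trans uz zr.
pose rho := (1 + hnorm w) / 2; pose r := (1 - hnorm w) / 2.
have rho1 : rho < 1 by rewrite /rho; lra.
have near z : hnorm (z - w) <= r -> hnorm z <= rho.
  move=> zw; rewrite -(subrK w z) (le_trans (hnorm_add _ _))// /rho.
  by move: zw; rewrite /r; lra.
have [B FB] := Fb _ rho1; have [C C0 FC] := holo_lipschitz Fh rho1.
apply: (@weierstrass _ _ r (1 - hnorm w) (2 * B)); first by rewrite /r; lra.
  move=> z /near zr; apply: ray_average_le => //; first exact: le_lt_trans zr rho1.
  by move=> u uz; apply: FB; exact: le_trans uz zr.
move=> e e0.
have [N N0 NP] : exists2 N : nat, (0 < N)%N & 2 * C / N%:R <= e.
  have k0 : 0 <= 2 * C / e.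
    by apply: divr_ge0; [apply: mulr_ge0|apply: ltW].
  have [N NP] : exists N : nat, 2 * C / e < N%:R.
    by exists (Num.truncn (2 * C / e)).+1; exact: truncnS_gt.
  have N0 : (0 < N)%N by rewrite -(ltr_nat R) (le_lt_trans k0).
  exists N => //; rewrite ler_pdivrMr ?ltr0n//.
  by move: NP; rewrite ltr_pdivrMr// => /ltW; rewrite (mulrC _ e).
pose G z : R[i]^o := (N%:R^-1)%:C * \sum_(j < N) F ((j%:R / N%:R)%:C *: z).
have jN01 (j : 'I_N) : 0 <= (j%:R / N%:R : R) <= 1.
  by rewrite divr_ge0//= ler_pdivrMr ?ltr0n// mul1r ler_nat ltnW.
exists G; split.
  move=> z zw; have z1 : hnorm z < 1.
    by rewrite -(subrK w z) (le_lt_trans (hnorm_add _ _))//; lra.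
  have Fj (j : 'I_N) : hdiff (fun z => F ((j%:R / N%:R)%:C *: z)) z
      (fun k => (j%:R / N%:R)%:C * pd F ((j%:R / N%:R)%:C *: z) k).
    apply: hdiff_scale; apply/pdP/Fd.
    exact: le_lt_trans (hnorm_scale01_le _ (jN01 j)) z1.
  exact: (hdiff_pd (hdiffZ (N%:R^-1)%:C (hdiff_sum (index_enum _) Fj))).1.
move=> z /near zr.
have z1 : hnorm z < 1 := le_lt_trans zr rho1.
rewrite normcB; apply: le_trans NP.
apply: riemann_sum_le => //.
- by move=> t t01; exact: holo_ccont.
- move=> s t s01 t01.
  apply: le_trans (FC _ _ _ _) _.
  + exact: le_trans (hnorm_scale01_le _ s01) zr.
  + exact: le_trans (hnorm_scale01_le _ t01) zr.
  + rewrite -scalerBl -rmorphB hnorm_scale normc_real ler_wpM2l//.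
    by rewrite ler_piMr// ltW.
Qed.

(** The derivative of t |-> f (t z) is the sum of the z_k (d_k f)(t z). *)
Lemma holo_ray_formula f z : holo f -> hnorm z < 1 ->
  f z - f 0 = \sum_(k < n) z 0 k * ray_average (fun z => pd f z k : R[i]^o) z.
Proof.
move=> fh z1.
have pc k t : 0 <= t <= 1 -> ccont (fun t : R => pd f (t%:C *: z) k) t.
  by move=> t01; apply: (holo_ccont (holo_pd k fh)).
have sumc s t : 0 <= t <= 1 ->
  ccont (fun t : R => \sum_(k <- s) z 0 k * pd f (t%:C *: z) k) t /\
  cint 0 1 (fun t : R => \sum_(k <- s) z 0 k * pd f (t%:C *: z) k) =
  \sum_(k <- s) z 0 k * ray_average (fun z => pd f z k : R[i]^o) z.
  elim: s t => [|k s IH] t t01.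
    rewrite big_nil; split; last first.
      by under eq_cint do rewrite big_nil; rewrite cint_cst// mulr0.
    by under eq_fun do rewrite big_nil; exact: ccont_cst.
  have hd : (fun t : R => \sum_(k <- k :: s) z 0 k * pd f (t%:C *: z) k) =
      (fun t : R => z 0 k * pd f (t%:C *: z) k + \sum_(k <- s) z 0 k * pd f (t%:C *: z) k).
    by apply/funext => u; rewrite big_cons.
  rewrite hd; split.
    by apply: ccontD (IH t t01).1; apply: ccontZ; exact: pc.
  rewrite cintD; first by rewrite cintZ; [rewrite (IH t t01).2 big_cons|exact: pc].
    by move=> u u01; apply: ccontZ; exact: pc.
  by move=> u u01; have [] := IH u u01.
rewrite -(sumc _ 0 _).2 ?lexx ?ler01//.
have := @cint_FTC _ (fun t => f (t%:C *: z)) (fun t => clinear (pd f (t%:C *: z)) z).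
rewrite scale1r scale0r => <- //.
- move=> t t01; apply: holo_rdiff => //.
  exact: le_lt_trans (hnorm_scale01_le _ t01) z1.
- by move=> t t01; have [] := sumc (index_enum _) t t01.
Qed.

Lemma pd_ZD f g (c : R[i]) z : differentiable f z -> differentiable g z ->
  pd (fun z => c * f z + g z : R[i]^o) z = fun k => c * pd f z k + pd g z k.
Proof. by move=> fz gz; exact: (hdiff_pd (hdiffZD c (pdP fz) (pdP gz))).2. Qed.

Lemma pd_ext f g z : hnorm z < 1 -> differentiable f z ->
  (forall w, hnorm w < 1 -> f w = g w) -> pd f z = pd g z.
Proof.
move=> z1 fz fg; apply/esym; apply: (hdiff_pd _).2.
apply: hdiff_near (pdP fz); first by rewrite -subr_gt0 in z1; exact: z1.
move=> w wz; apply: fg; rewrite -(subrK z w) (le_lt_trans (hnorm_add _ _))//.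
by lra.
Qed.

Lemma ray_average_ZD f g (c : R[i]) z : holo f -> holo g -> hnorm z < 1 ->
  ray_average (fun z => c * f z + g z : R[i]^o) z = c * ray_average f z + ray_average g z.
Proof.
move=> fh gh z1; rewrite /ray_average cintD ?cintZ//.
- by move=> t t01; exact: holo_ccont.
- by move=> t t01; apply/ccontZ/holo_ccont.
- by move=> t t01; exact: holo_ccont.
Qed.

Lemma ray_average_ext f g z : hnorm z < 1 -> (forall w, hnorm w < 1 -> f w = g w) ->
  ray_average f z = ray_average g z.
Proof.
move=> z1 fg; apply: eq_cint => t t01; apply: fg.
exact: le_lt_trans (hnorm_scale01_le _ t01) z1.
Qed.

End weierstrass.

(** * Invariance of Lebesgue measure on tuples *)

Section lebesgue_translation.
Context {R : realType}.
Notation mu := (@lebesgue_measure R).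
Local Open Scope ereal_scope.

(** A change of variables for sigma-finite measures: translation pushes the
    Lebesgue measure forward to itself. *)
Lemma lebesgue_integral_translation (f : measurableTypeR R -> \bar R) (a : R) :
  measurable_fun setT f -> (forall x, 0 <= f x) ->
  \int[mu]_x f (x + a)%R = \int[mu]_x f x.
Proof.
move=> mf f0.
pose phi : measurableTypeR R -> measurableTypeR R := fun x => (x + a)%R.
have mphi : measurable_fun setT phi by exact: measurable_funD.
have := @ge0_integral_pushforward _ _ _ _ R phi mphi mu setT f measurableT mf.
rewrite preimage_setT => /(_ (fun x _ => f0 x)) <-.
apply: eq_measure_integral => A mA _ /=.
pose p : {measure set (measurableTypeR R) -> \bar R} :=
  measure_function_pushforward__canonical__measure_function_Measure mu mphi.
apply/esym; apply: (@lebesgue_measure_unique _ p) => // _ [[b c] _ <-].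
rewrite /p /= /pushforward.
have -> : phi @^-1` [set` `]b, c]] = [set` `](b - a)%R, (c - a)%R]].
  by apply/seteqP; split => x /=; rewrite !in_itv/= ltrBlDr lerBrDr.
rewrite !lebesgue_measure_itv/= !lte_fin ltrD2r.
by case: ifPn => // _; rewrite -!EFinD opprB addrA subrK.
Qed.

End lebesgue_translation.

Section tuple_translation.
Context {R : realType}.
Notation T := (measurableTypeR R).
Notation mu := (@lebesgue_measure R).
Notation tm m := (tuple_measure mu m).
Local Open Scope ereal_scope.

Definition tadd m (t s : m.-tuple T) : m.-tuple T :=
  [tuple (tnth t i + tnth s i : R)%R | i < m].

Definition topp m (t : m.-tuple T) : m.-tuple T := [tuple (- tnth t i : R)%R | i < m].

Lemma tnth_tadd m (t s : m.-tuple T) i :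
  tnth (tadd t s) i = (tnth t i + tnth s i : R)%R.
Proof. by rewrite tnth_mktuple. Qed.

Lemma tnth_topp m (t : m.-tuple T) i : tnth (topp t) i = (- tnth t i : R)%R.
Proof. by rewrite tnth_mktuple. Qed.

Lemma measurable_tadd d (X : measurableType d) m (f g : X -> m.-tuple T) :
  measurable_fun setT f -> measurable_fun setT g ->
  measurable_fun setT (fun x => tadd (f x) (g x)).
Proof.
move=> mf mg; apply/measurable_fun_tnthP => i.
rewrite (_ : _ \o _ = fun x => (tnth (f x) i + tnth (g x) i : R)%R); last first.
  by apply/funext => x /=; rewrite tnth_tadd.
by apply: measurable_funD; [move/measurable_fun_tnthP : mf; exact|
  move/measurable_fun_tnthP : mg; exact].
Qed.

Lemma measurable_topp d (X : measurableType d) m (f : X -> m.-tuple T) :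
  measurable_fun setT f -> measurable_fun setT (fun x => topp (f x)).
Proof.
move=> mf; apply/measurable_fun_tnthP => i.
rewrite (_ : _ \o _ = fun x => (- tnth (f x) i : R)%R); last first.
  by apply/funext => x /=; rewrite tnth_topp.
by apply: measurableT_comp => //; move/measurable_fun_tnthP : mf; exact.
Qed.

Lemma tuple_integralS m (f : m.+1.-tuple T -> \bar R) :
  measurable_fun setT f -> (forall t, 0 <= f t) ->
  \int[tm m.+1]_t f t = \int[mu]_x \int[tm m]_t f (tuple_cons (x, t)).
Proof.
move=> mf f0.
have mc : measurable_fun setT (@tuple_cons _ T m) by exact: measurable_tuple_cons.
have := @ge0_integral_pushforward _ _ _ _ R _ mc (mu \x tm m) setT f measurableT mf.
rewrite preimage_setT => /(_ (fun x _ => f0 x)) E.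
transitivity (\int[pushforward (mu \x tm m) (@tuple_cons _ T m)]_t f t).
  by apply: eq_measure_integral.
rewrite E fubini_tonelli1//=.
by apply: measurableT_comp.
Qed.

Lemma tuple_integral_translation m (f : m.-tuple T -> \bar R) (s : m.-tuple T) :
  measurable_fun setT f -> (forall t, 0 <= f t) ->
  \int[tm m]_t f (tadd t s) = \int[tm m]_t f t.
Proof.
elim: m f s => [|m IH] f s mf f0.
  by apply: eq_integral => t _; rewrite (tuple0 t) (tuple0 (tadd _ _)).
rewrite tuple_integralS//; last first.
  by apply: measurableT_comp => //; apply: measurable_tadd.
rewrite (tuple_integralS mf f0).
pose y := thead s; pose s' : m.-tuple T := [tuple of behead s].
have E x t : tadd (tuple_cons (x, t)) s = tuple_cons ((x + y)%R, tadd t s').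
  apply: eq_from_tnth => i; rewrite tnth_tadd.
  case: (unliftP ord0 i) => [j|] ->.
    rewrite /tuple_cons/= !tnthS tnth_tadd; congr (_ + _)%R.
    by rewrite [in LHS](tuple_eta s) tnthS.
  by rewrite [in LHS](tuple_eta s) /tuple_cons/= !tnth0.
pose g x := \int[tm m]_t f (tuple_cons (x, t)).
have mfc : measurable_fun setT (fun xt => f (@tuple_cons _ T m xt)).
  by apply: measurableT_comp => //; exact: measurable_tuple_cons.
have mg : measurable_fun setT g.
  exact: (measurable_fun_fubini_tonelli_F (m2 := tm m) _ mfc (fun x => f0 _)).
rewrite -(lebesgue_integral_translation y mg); last first.
  by move=> x; apply: integral_ge0.
apply: eq_integral => x _; under eq_integral do rewrite E.
apply: (IH (fun t => f (tuple_cons ((x + y)%R, t)))) => //.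
by apply: (measurableT_comp mfc); exact: measurable_pair1.
Qed.

(** Uniqueness of Haar measure in the form needed here: the image of the
    Lebesgue measure under an additive bijection phi is a multiple of it, and
    the factor is read off from one test function g. *)
Lemma tuple_integral_haar m (phi psi : m.-tuple T -> m.-tuple T)
    (f g : m.-tuple T -> \bar R) :
  measurable_fun setT phi ->
  (forall x y, phi (tadd x (psi y)) = tadd (phi x) y) ->
  measurable_fun setT f -> (forall t, 0 <= f t) ->
  measurable_fun setT g -> (forall t, 0 <= g t) ->
  (\int[tm m]_x f (phi x)) * (\int[tm m]_x g x) =
  (\int[tm m]_x f x) * (\int[tm m]_x g (topp (phi x))).
Proof.
move=> mphi phiD mf f0 mg g0.
have mfphi : measurable_fun setT (fun x => f (phi x)) by exact: measurableT_comp.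
have mgy y : measurable_fun setT (fun x => g (tadd y (topp (phi x)))).
  by apply: measurableT_comp => //; apply: measurable_tadd => //; exact: measurable_topp.
have mgophi : measurable_fun setT (fun x => g (topp (phi x))).
  by apply: measurableT_comp => //; exact: measurable_topp.
transitivity (\int[tm m]_y \int[tm m]_x (g y * f (tadd (phi x) y))).
  rewrite muleC -ge0_integralZr//; last exact: integral_ge0.
  apply: eq_integral => y _.
  rewrite ge0_integralZl//; last first.
    by apply: measurableT_comp => //; exact: measurable_tadd.
  congr (_ * _); rewrite -(tuple_integral_translation (psi y) mfphi)//.
  by apply: eq_integral => x _; rewrite phiD.
rewrite (@fubini_tonelli _ _ _ _ _ (tm m) (tm m)
  (fun yx => g yx.1 * f (tadd (phi yx.2) yx.1)))//; last 2 first.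
- apply: emeasurable_funM; first exact: measurableT_comp.
  apply: measurableT_comp => //; apply: measurable_tadd => //.
  exact: measurableT_comp.
- by move=> yx; exact: mule_ge0.
transitivity (\int[tm m]_x \int[tm m]_y (g (tadd y (topp (phi x))) * f y)).
  apply: eq_integral => x _.
  have mh : measurable_fun setT (fun y => g y * f (tadd (phi x) y)).
    apply: emeasurable_funM => //; apply: measurableT_comp => //.
    exact: measurable_tadd.
  rewrite -(tuple_integral_translation (topp (phi x)) mh); last first.
    by move=> y; exact: mule_ge0.
  apply: eq_integral => y _; congr (_ * f _).
  by apply: eq_from_tnth => i; rewrite !tnth_tadd tnth_topp addrC subrK.
rewrite (@fubini_tonelli _ _ _ _ _ (tm m) (tm m)
  (fun xy => g (tadd xy.2 (topp (phi xy.1))) * f xy.2))//; last 2 first.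
- apply: emeasurable_funM; last exact: measurableT_comp.
  apply: measurableT_comp => //; apply: measurable_tadd => //.
  by apply: measurable_topp; exact: measurableT_comp.
- by move=> yx; exact: mule_ge0.
rewrite -ge0_integralZr//; last exact: integral_ge0.
apply: eq_integral => y _; rewrite /= ge0_integralZr//.
rewrite muleC; congr (_ * _).
rewrite -(tuple_integral_translation (psi y) (mgy y))//.
apply: eq_integral => x _; congr g.
by apply: eq_from_tnth => i; rewrite phiD tnth_tadd !tnth_topp tnth_tadd opprD addrCA subrr addr0.
Qed.

End tuple_translation.

(** * Integration over the complex space *)

(** The integral of a nonnegative function, measurable or not, is the supremum
    over the simple functions below it. *)
Lemma integral_monotone d (X : measurableType d) (R : realType)
    (mu : {measure set X -> \bar R}) (f g : X -> \bar R) :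
  (forall x, 0 <= f x)%E -> (forall x, f x <= g x)%E ->
  (\int[mu]_x f x <= \int[mu]_x g x)%E.
Proof.
move=> f0 fg; rewrite !ge0_integralTE//; last by move=> x; exact: le_trans (f0 x) (fg x).
by apply: le_ereal_sup => _ [h hf <-]; exists h => // x; exact: le_trans (hf x) (fg x).
Qed.

Section volume_on_Cn.
Context {R : realType} {n : nat}.
Notation T := (measurableTypeR R).
Notation Tn := ((n + n).-tuple (measurableTypeR R)).
Notation toC := (@complex_of_tuple R n).
Notation lam := (@lebesgueC R n).
Implicit Types (z w : Cvec R n).

Definition tuple_of_complex z : Tn :=
  [tuple (match fintype.split i with
          | inl k => complex.Re (z 0 k) | inr k => complex.Im (z 0 k) end : R)
   | i < n + n].
Notation ofC := tuple_of_complex.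

Lemma tuple_of_complexK z : toC (ofC z) = z.
Proof.
apply/rowP => k; rewrite mxE !tnth_mktuple.
by rewrite (unsplitK (inl k)) (unsplitK (inr k)); case: (z 0 k).
Qed.

Lemma complex_of_tupleK (t : Tn) : ofC (toC t) = t.
Proof.
apply: eq_from_tnth => i; rewrite tnth_mktuple.
by rewrite -[in RHS](splitK i); case: (fintype.split i) => k; rewrite mxE.
Qed.

Lemma complex_of_tadd (t s : Tn) : toC (tadd t s) = toC t + toC s.
Proof. by apply/rowP => k; rewrite !mxE !tnth_tadd. Qed.

Lemma complex_of_topp (t : Tn) : toC (topp t) = - toC t.
Proof. by apply/rowP => k; rewrite !mxE !tnth_topp. Qed.

Lemma measurable_sqrt_comp d (X : measurableType d) (f : X -> R) :
  measurable_fun setT f -> measurable_fun setT (fun x => Num.sqrt (f x)).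
Proof.
move=> mf.
have ms : measurable_fun setT (Num.sqrt : T -> T).
  by apply: continuous_measurable_fun; exact: sqrt_continuous.
exact: (measurableT_comp ms mf).
Qed.

(** Row vectors over R[i] carry no sigma-algebra, so measurability is expressed
    in the real coordinates in which the volume is defined. *)
Definition vec_measurable d (X : measurableType d) (H : X -> Cvec R n) :=
  measurable_fun setT (fun x => ofC (H x)).

Definition cplx_measurable d (X : measurableType d) (c : X -> R[i]) :=
  measurable_fun setT (fun x => complex.Re (c x)) /\
  measurable_fun setT (fun x => complex.Im (c x)).

Lemma vec_measurableP d (X : measurableType d) (H : X -> Cvec R n) :
  vec_measurable H <-> forall k, cplx_measurable (fun x => H x 0 k).
Proof.
split=> [/measurable_fun_tnthP mH k|mH].
  split; [have := mH (lshift n k)|have := mH (rshift n k)];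
    apply: eq_measurable_fun => x _ /=; rewrite tnth_mktuple.
    by rewrite (unsplitK (inl k)).
  by rewrite (unsplitK (inr k)).
apply/measurable_fun_tnthP => i.
rewrite (_ : _ \o _ = fun x => (match fintype.split i with
  | inl k => complex.Re (H x 0 k) | inr k => complex.Im (H x 0 k) end : R)); last first.
  by apply/funext => x /=; rewrite tnth_mktuple.
by case: (fintype.split i) => k; case: (mH k).
Qed.

Lemma cplx_measurableM d (X : measurableType d) (b c : X -> R[i]) :
  cplx_measurable b -> cplx_measurable c -> cplx_measurable (fun x => b x * c x).
Proof.
move=> [b1 b2] [c1 c2]; split.
  under eq_fun do rewrite cReM.
  by apply: measurable_funB; apply: measurable_funM.
under eq_fun do rewrite cImM.
by apply: measurable_funD; apply: measurable_funM.
Qed.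

Lemma cplx_measurableD d (X : measurableType d) (b c : X -> R[i]) :
  cplx_measurable b -> cplx_measurable c -> cplx_measurable (fun x => b x + c x).
Proof.
move=> [b1 b2] [c1 c2]; split.
  by under eq_fun do rewrite cReD; apply: measurable_funD.
by under eq_fun do rewrite cImD; apply: measurable_funD.
Qed.

Lemma cplx_measurable_cst d (X : measurableType d) c : cplx_measurable (fun _ : X => c).
Proof. by split; exact: measurable_cst. Qed.

Lemma cplx_measurable_real d (X : measurableType d) (f : X -> R) :
  measurable_fun setT f -> cplx_measurable (fun x => (f x)%:C).
Proof. by move=> mf; split => //=; exact: measurable_cst. Qed.

Lemma cplx_measurable_normc d (X : measurableType d) (c : X -> R[i]) :
  cplx_measurable c -> measurable_fun setT (fun x => normc (c x)).
Proof.
move=> [c1 c2].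
rewrite (_ : (fun x => _) = fun x => Num.sqrt (complex.Re (c x) ^+ 2 + complex.Im (c x) ^+ 2)).
  apply: measurable_sqrt_comp.
  by apply: measurable_funD; exact: measurable_funX.
by apply/funext => x; case: (c x).
Qed.

Lemma vec_measurableD d (X : measurableType d) (H G : X -> Cvec R n) :
  vec_measurable H -> vec_measurable G -> vec_measurable (fun x => H x + G x).
Proof.
move=> /vec_measurableP mH /vec_measurableP mG; apply/vec_measurableP => k.
by under eq_fun do rewrite mxE; exact: cplx_measurableD.
Qed.

Lemma vec_measurable_scale d (X : measurableType d) (c : X -> R[i]) (H : X -> Cvec R n) :
  cplx_measurable c -> vec_measurable H -> vec_measurable (fun x => c x *: H x).
Proof.
move=> mc /vec_measurableP mH; apply/vec_measurableP => k.
by under eq_fun do rewrite mxE; exact: cplx_measurableM.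
Qed.

Lemma vec_measurable_cst d (X : measurableType d) z : vec_measurable (fun _ : X => z).
Proof. exact: measurable_cst. Qed.

Lemma vec_measurableN d (X : measurableType d) (H : X -> Cvec R n) :
  vec_measurable H -> vec_measurable (fun x => - H x).
Proof.
move=> mH; under eq_fun do rewrite -scaleN1r.
by apply: vec_measurable_scale => //; exact: cplx_measurable_cst.
Qed.

Lemma vec_measurable_id : vec_measurable toC.
Proof.
rewrite /vec_measurable (_ : (fun x => _) = id); first exact: measurable_id.
by apply/funext => t; rewrite complex_of_tupleK.
Qed.

Lemma vec_measurable_comp d d' (X : measurableType d) (Y : measurableType d') (H : X -> Cvec R n)
  (G : Y -> X) : vec_measurable H -> measurable_fun setT G -> vec_measurable (fun y => H (G y)).
Proof. by move=> mH mG; exact: (measurableT_comp mH mG). Qed.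

Definition Cmeasurable d (Y : measurableType d) (u : Cvec R n -> Y) :=
  measurable_fun setT (fun t => u (toC t)).

Lemma Cmeasurable_comp d d' (X : measurableType d) (Y : measurableType d') (u : Cvec R n -> Y)
    (H : X -> Cvec R n) :
  Cmeasurable u -> vec_measurable H -> measurable_fun setT (fun x => u (H x)).
Proof.
move=> mu mH; rewrite (_ : (fun x => _) = (fun t => u (toC t)) \o (fun x => ofC (H x))).
  exact: measurableT_comp.
by apply/funext => x /=; rewrite tuple_of_complexK.
Qed.

Lemma vec_measurable_hnorm d (X : measurableType d) (H : X -> Cvec R n) :
  vec_measurable H -> measurable_fun setT (fun x => hnorm (H x)).
Proof.
move=> /vec_measurableP mH; under eq_fun do rewrite hnormE sqnormE.
apply: measurable_sqrt_comp.
by apply: measurable_sum => k; apply: measurable_funX; exact: cplx_measurable_normc.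
Qed.

Lemma vec_measurable_ip d (X : measurableType d) (H : X -> Cvec R n) a :
  vec_measurable H -> cplx_measurable (fun x => ip (H x) a).
Proof.
move=> /vec_measurableP mH; under eq_fun do rewrite ipE.
have key s : cplx_measurable (fun x => \sum_(k <- s) H x 0 k * conjc (a 0 k)).
  elim: s => [|k s IH].
    by under eq_fun do rewrite big_nil; exact: cplx_measurable_cst.
  under eq_fun do rewrite big_cons.
  by apply: cplx_measurableD => //; apply: cplx_measurableM => //; exact: cplx_measurable_cst.
exact: key.
Qed.

Definition ind (b : bool) : R := b%:R.

Lemma measurable_ind d (X : measurableType d) (b : X -> bool) :
  measurable_fun setT b -> measurable_fun setT (fun x => ind (b x)).
Proof.
move=> mb; rewrite (_ : (fun x => _) = fun x => if b x then 1 else 0 : R).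
  by apply: measurable_fun_if => //; apply: measurable_funTS; exact: measurable_cst.
by apply/funext => x; rewrite /ind; case: (b x).
Qed.

Definition Int (f : Cvec R n -> \bar R) : \bar R := (\int[lam]_t f (toC t))%E.

Local Open Scope ereal_scope.

Lemma Int_translation (f : Cvec R n -> \bar R) w : Cmeasurable f -> (forall z, 0 <= f z) ->
  Int (fun z => f (z + w)%R) = Int f.
Proof.
move=> mf f0; rewrite /Int.
rewrite -(tuple_integral_translation (ofC w) mf)//.
by apply: eq_integral => t _; rewrite complex_of_tadd tuple_of_complexK.
Qed.

(** tuple_integral_haar for multiplication by a nonzero complex number. *)
Lemma Int_haar (f g : Cvec R n -> \bar R) (c : R[i]) : c != 0%R ->
  Cmeasurable f -> (forall z, 0 <= f z) -> Cmeasurable g -> (forall z, 0 <= g z) ->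
  Int (fun z => f (c *: z)%R) * Int g = Int f * Int (fun z => g (- (c *: z))%R).
Proof.
move=> c0 mf f0 mg g0.
have mphi : measurable_fun setT (fun t => ofC (c *: toC t)).
  by apply: vec_measurable_scale; [exact: cplx_measurable_cst|exact: vec_measurable_id].
have := @tuple_integral_haar R (n + n) _ (fun t => ofC (c^-1 *: toC t))
  (fun t => f (toC t)) (fun t => g (toC t)) mphi _ mf _ mg _.
rewrite /Int; under eq_integral do rewrite tuple_of_complexK.
under [X in _ -> _ -> _ -> _ = _ * X]eq_integral
  do rewrite complex_of_topp tuple_of_complexK.
apply => // x y.
rewrite -[RHS]complex_of_tupleK 2!complex_of_tadd; congr ofC.
transitivity (c *: (toC x + c^-1 *: toC y))%R.
  by congr (c *: (toC x + _))%R; exact: tuple_of_complexK.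
rewrite scalerDr scalerA divff// scale1r; congr (_ + toC y)%R.
by apply/esym; exact: tuple_of_complexK.
Qed.

Lemma Int_ge0 f : (forall z, 0 <= f z) -> 0 <= Int f.
Proof. by move=> f0; apply: integral_ge0. Qed.

Lemma Int_le f g : (forall z, 0 <= f z) -> (forall z, f z <= g z) -> Int f <= Int g.
Proof.
by move=> f0 fg; apply: integral_monotone.
Qed.

Lemma IntZ (k : R) f : Cmeasurable f -> (forall z, 0 <= f z) -> (0 <= k)%R ->
  Int (fun z => k%:E * f z) = k%:E * Int f.
Proof. by move=> mf f0 k0; rewrite /Int ge0_integralZl. Qed.

Lemma IntD f g : Cmeasurable f -> (forall z, 0 <= f z) -> Cmeasurable g -> (forall z, 0 <= g z) ->
  Int (fun z => f z + g z) = Int f + Int g.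
Proof. by move=> mf f0 mg g0; rewrite /Int ge0_integralD. Qed.

Lemma Int_swap (f : Cvec R n -> Cvec R n -> \bar R) :
  measurable_fun setT (fun x : Tn * Tn => f (toC x.1) (toC x.2)) ->
  (forall z w, 0 <= f z w) ->
  Int (fun z => Int (f z)) = Int (fun w => Int (f^~ w)).
Proof.
move=> mf f0.
exact: (@fubini_tonelli _ _ _ _ _ lam lam (fun x => f (toC x.1) (toC x.2)) mf).
Qed.

Lemma Int_swapR (f : Cvec R n -> R -> \bar R) :
  measurable_fun setT (fun x : Tn * T => f (toC x.1) x.2) ->
  (forall z x, 0 <= f z x) ->
  Int (fun z => \int[@lebesgue_measure R]_x f z x) =
  \int[@lebesgue_measure R]_x Int (f^~ x).
Proof.
move=> mf f0.
exact: (@fubini_tonelli _ _ _ _ _ lam (@lebesgue_measure R)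
  (fun x => f (toC x.1) x.2) mf).
Qed.

Lemma Cmeasurable_IntR (f : Cvec R n -> R -> \bar R) :
  measurable_fun setT (fun x : Tn * T => f (toC x.1) x.2) ->
  (forall z x, 0 <= f z x) ->
  Cmeasurable (fun z => \int[@lebesgue_measure R]_x f z x).
Proof.
move=> mf f0.
exact: (@measurable_fun_fubini_tonelli_F _ _ _ _ _ (@lebesgue_measure R)
  (fun x => f (toC x.1) x.2) mf).
Qed.

Definition Vol (b : Cvec R n -> bool) := Int (fun z => (ind (b z))%:E).

Lemma ind_ge0 b : (0 <= ind b)%R.
Proof. by rewrite /ind; case: b. Qed.

Lemma ind_and (a b : bool) : (ind (a && b) = ind a * ind b)%R.
Proof. by rewrite /ind; case: a; case: b; rewrite ?mulr1 ?mulr0. Qed.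

Lemma Vol_le (b c : Cvec R n -> bool) : (forall z, b z -> c z) -> Vol b <= Vol c.
Proof.
move=> bc; apply: Int_le => z; rewrite lee_fin ?ind_ge0//.
by rewrite /ind; case: (b z) (bc z) => [->|_]//; case: (c z).
Qed.

Lemma Cmeasurable_ind (b : Cvec R n -> bool) : Cmeasurable b -> Cmeasurable (fun z => (ind (b z))%:E).
Proof. by move=> mb; apply/measurable_EFinP; exact: measurable_ind. Qed.

Lemma VolE (b : Cvec R n -> bool) (A : set Tn) : measurable A ->
  (forall t, b (toC t) <-> A t) -> Vol b = lam A.
Proof.
move=> mA bA; rewrite -[RHS]mul1e -integral_cst// integral_mkcond.
apply: eq_integral => t _; rewrite /patch /ind.
case: ifPn => [|]; rewrite ?(inE,notin_setE) -bA; first by move=> ->.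
by move/negP/negbTE => ->.
Qed.

Lemma Vol_unit_ball : Vol (fun z => (hnorm z < 1)%R) = @volume_unit_ball R n.
Proof.
apply: VolE; first exact: measurable_unit_ball.
by move=> t /=; rewrite unit_ballP.
Qed.

Lemma Cmeasurable_hnorm : Cmeasurable (@hnorm R n).
Proof. exact: vec_measurable_hnorm vec_measurable_id. Qed.

Lemma Cmeasurable_ball (r : R) : Cmeasurable (fun z => (hnorm z < r)%R).
Proof. by apply: measurable_fun_ltr; [exact: Cmeasurable_hnorm|exact: measurable_cst]. Qed.

Lemma volume_unit_ball_neq0 : @volume_unit_ball R n != 0.
Proof. by rewrite gt_eqF// volume_unit_ball_gt0. Qed.

Lemma volume_unit_ball_fin : @volume_unit_ball R n \is a fin_num.
Proof. by rewrite ge0_fin_numE ?volume_unit_ball_lty// ltW// volume_unit_ball_gt0. Qed.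

Lemma mule_cancel (v x y : \bar R) : v != 0 -> v \is a fin_num -> v * x = v * y -> x = y.
Proof. by move=> v0 vfin E; rewrite -[LHS]mul1e -[RHS]mul1e -(mulVe v0 vfin) -!muleA E. Qed.

(** A rotation preserves the unit ball, which has finite positive volume, so the
    factor of Int_haar is 1. *)
Lemma Int_rotation (f : Cvec R n -> \bar R) (c : R[i]) : normc c = 1%R ->
  Cmeasurable f -> (forall z, 0 <= f z) -> Int (fun z => f (c *: z)%R) = Int f.
Proof.
move=> c1 mf f0.
have c0 : c != 0%R by apply/eqP => c0; move: c1; rewrite c0 normc0 => /esym/eqP; rewrite oner_eq0.
have mB := Cmeasurable_ind (Cmeasurable_ball 1).
have B0 z : 0 <= (ind (hnorm z < 1)%R)%:E :> \bar R by rewrite lee_fin ind_ge0.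
have := Int_haar c0 mf f0 mB B0.
have -> : Int (fun z => (ind (hnorm (- (c *: z))%R < 1)%R)%:E) = Vol (fun z => (hnorm z < 1)%R).
  by apply: eq_integral => t _; rewrite hnorm_opp hnorm_scale c1 mul1r.
rewrite -/(Vol _) Vol_unit_ball ![_ * volume_unit_ball]muleC.
exact: (mule_cancel volume_unit_ball_neq0 volume_unit_ball_fin).
Qed.

Let box (r : R) : Cvec R n -> bool := fun z => [forall i, (`|tnth (ofC z) i : R| < r)%R].

Let I (r : R) : set T := [set` `](- r)%R, r[%R].

Let measurable_box r : measurable [set t : Tn | forall i, I r (tnth t i)].
Proof. by apply: (@measurable_tuple_box _ _ _ (fun=> I r)) => i; exact: measurable_itv. Qed.

Let boxE r t : box r (toC t) <-> forall i, I r (tnth t i).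
Proof.
rewrite /box; split=> [/forallP h i|h]; last apply/forallP => i; have := h i;
  by rewrite /I /= complex_of_tupleK in_itv/= ltr_norml.
Qed.

Let Cmeasurable_box r : Cmeasurable (fun z => (ind (box r z))%:E).
Proof.
apply/measurable_EFinP/measurable_ind.
apply: (@measurable_fun_bool _ _ _ _ true).
rewrite setTI (_ : _ @^-1` _ = [set t : Tn | forall i, I r (tnth t i)]).
  exact: measurable_box.
by apply/seteqP; split=> t /=; move: (boxE r t) => /= [h1 h2]; [exact: h1|exact: h2].
Qed.

Let Vol_box r : (0 < r)%R -> Vol (box r) = ((r + r) ^+ (n + n))%:E.
Proof.
move=> r0; rewrite (VolE (measurable_box r) (boxE r)).
rewrite [lam _](@tuple_measure_box _ _ _ (@lebesgue_measure R) _ (fun=> I r))//.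
  have E : @lebesgue_measure R (I r) = (r + r)%:E.
    by rewrite /I lebesgue_measure_itv/= lte_fin gtrN// -EFinD opprK.
  transitivity (\prod_(i < n + n) (r + r)%:E : \bar R); first by apply: eq_bigr => i _; exact: E.
  by rewrite prodEFin prodr_const card_ord.
by move=> _; exact: measurable_itv.
Qed.

(** A dilation multiplies the side of a cube by the dilation factor; this
    determines the factor of Int_haar. *)
Lemma Int_dilation (f : Cvec R n -> \bar R) (t : R) : (0 < t)%R ->
  Cmeasurable f -> (forall z, 0 <= f z) ->
  Int (fun z => f (t%:C *: z)%R) = (t ^- (n + n))%:E * Int f.
Proof.
move=> t0 mf f0.
have c0 : t%:C != 0%R by rewrite (inj_eq (@complexI R) t 0%R) gt_eqF.
have B0 z : 0 <= (ind (box 1 z))%:E :> \bar R by rewrite lee_fin ind_ge0.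
have := Int_haar c0 mf f0 (Cmeasurable_box 1) B0.
have -> : Int (fun z => (ind (box 1 (- (t%:C *: z))))%:E) = Vol (box t^-1).
  apply: eq_integral => s _; congr (ind _)%:E; apply: eq_forallb => i.
  rewrite !tnth_mktuple; case: (fintype.split i) => k; rewrite !mxE.
    by rewrite cReN cReM /= mul0r subr0 normrN normrM gtr0_norm// mulrC -ltr_pdivlMr// div1r.
  by rewrite cImN cImM /= mul0r addr0 normrN normrM gtr0_norm// mulrC -ltr_pdivlMr// div1r.
rewrite -/(Vol _) !Vol_box ?invr_gt0// ![_ * _%:E]muleC => E.
have k0 : ((1 + 1) ^+ (n + n) != 0 :> R)%R by rewrite expf_neq0// pnatr_eq0.
apply: (@mule_cancel (((1 + 1) ^+ (n + n))%:E)); [exact: k0|by []|].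
rewrite E muleA -EFinM; congr (_%:E * _).
by rewrite -exprVn -exprMn mulrDl !mul1r.
Qed.

Lemma Vol_ball (r : R) : (0 < r)%R ->
  Vol (fun z => (hnorm z < r)%R) = (r ^+ (n + n))%:E * @volume_unit_ball R n.
Proof.
move=> r0; rewrite -Vol_unit_ball.
have r'0 : (0 < r^-1)%R by rewrite invr_gt0.
have := @Int_dilation (fun z => (ind (hnorm z < 1)%R)%:E) r^-1 r'0.
rewrite exprVn invrK => <-; last 2 first.
- exact: Cmeasurable_ind (Cmeasurable_ball 1).
- by move=> z; rewrite lee_fin ind_ge0.
apply: eq_integral => t _.
by rewrite hnorm_scale normc_real ger0_norm ?ltW// mulrC ltr_pdivrMr// mul1r.
Qed.

End volume_on_Cn.

(** * Volumes of tubes *)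

Section slabs.
Context {R : realType} {n : nat}.
Notation T := (measurableTypeR R).
Notation Tn := ((n + n).-tuple (measurableTypeR R)).
Notation toC := (@complex_of_tuple R n).
Implicit Types (z w : Cvec R n).

Lemma measurable_normr d (X : measurableType d) (f : X -> R) :
  measurable_fun setT f -> measurable_fun setT (fun x => `|f x|).
Proof. by move=> mf; apply: measurableT_comp. Qed.

Lemma integral_ind_itv (c r : R) : 0 < r ->
  (\int[@lebesgue_measure R]_x (ind (`|c + x| < r))%:E = (r + r)%:E)%E.
Proof.
move=> r0.
transitivity (@lebesgue_measure R [set` `](- c - r), (- c + r)[%R]).
  rewrite -[RHS]mul1e -integral_cst; last exact: measurable_itv.
  rewrite [RHS]integral_mkcond; apply: eq_integral => x _; rewrite /patch /ind.
  have -> : (x \in [set` `](- c - r), (- c + r)[%R]) = (`|c + x| < r).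
    rewrite mem_setE in_itv/= ltr_norml; congr (_ && _).
      by apply/idP/idP => h; lra.
    by apply/idP/idP => h; lra.
  by case: (_ < _).
rewrite lebesgue_measure_itv/= lte_fin ifT; last by lra.
by rewrite -EFinD; congr (_%:E); lra.
Qed.

(** Integrate the product of the indicators of |l z| < d and |l z + x| < r over z
    and x, in both orders: translating z by - x u exchanges the roles of d and r. *)
Lemma Vol_slab (u : Cvec R n) (l : Cvec R n -> R) (b : Cvec R n -> bool) (d r : R) :
  0 < d -> 0 < r -> Cmeasurable l -> Cmeasurable b ->
  (forall z (x : R), l (z + x%:C *: u) = l z + x) ->
  (forall z (x : R), b (z + x%:C *: u) = b z) ->
  (r%:E * Vol (fun z => b z && (`|l z| < d)%R) =
   d%:E * Vol (fun z => b z && (`|l z| < r)%R))%E.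
Proof.
move=> d0 r0 ml mb lD bD.
have m0 : measurable_fun setT (fun x : Tn * T => l (toC x.1)) by exact: (measurableT_comp ml measurable_fst).
have m1 : measurable_fun setT (fun x : Tn * T => b (toC x.1)) by exact: (measurableT_comp mb measurable_fst).
have mx : measurable_fun setT (fun x : Tn * T => x.2 : R) by exact: measurable_snd.
have mlt (s : R) : Cmeasurable (fun z => `|l z| < s).
  by apply: measurable_fun_ltr; [exact: measurable_normr|exact: measurable_cst].
pose g z (x : R) := (ind (b z && (`|l z| < d)%R) * ind (`|l z + x| < r))%:E : \bar R.
pose h z (x : R) := (ind (b z && (`|l z| < r)%R) * ind (`|- l z + x| < d))%:E : \bar R.
have g0 z x : (0 <= g z x)%E by rewrite lee_fin mulr_ge0 ?ind_ge0.
have h0 z x : (0 <= h z x)%E by rewrite lee_fin mulr_ge0 ?ind_ge0.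
have mg : measurable_fun setT (fun x : Tn * T => g (toC x.1) x.2).
  apply/measurable_EFinP; apply: measurable_funM; apply: measurable_ind.
    by apply: measurable_and => //; apply: measurable_fun_ltr => //; exact: measurable_normr.
  by apply: measurable_fun_ltr => //; apply: measurable_normr; exact: measurable_funD.
have mh : measurable_fun setT (fun x : Tn * T => h (toC x.1) x.2).
  apply/measurable_EFinP; apply: measurable_funM; apply: measurable_ind.
    by apply: measurable_and => //; apply: measurable_fun_ltr => //; exact: measurable_normr.
  apply: measurable_fun_ltr => //; apply: measurable_normr; apply: measurable_funD => //.
  exact: measurableT_comp.
have mVol (s : R) : Cmeasurable (fun z => (ind (b z && (`|l z| < s)%R))%:E : \bar R).
  by apply: Cmeasurable_ind; apply: measurable_and => //; exact: mlt.
have ind0 (c : bool) : (0 <= (ind c)%:E :> \bar R)%E by rewrite lee_fin ind_ge0.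
have E1 : (Int (fun z => \int[@lebesgue_measure R]_x g z x) = (r + r)%:E * Vol (fun z => b z && (`|l z| < d)%R))%E.
  rewrite /Vol -IntZ//; last by rewrite addr_ge0// ltW.
  apply: eq_integral => t _; rewrite -(integral_ind_itv (l (toC t)) r0) muleC -ge0_integralZl//.
  apply/measurable_EFinP/measurable_ind; apply: measurable_fun_ltr => //.
  by apply: measurable_normr; exact: measurable_funD.
have E2 : (Int (fun z => \int[@lebesgue_measure R]_x h z x) = (d + d)%:E * Vol (fun z => b z && (`|l z| < r)%R))%E.
  rewrite /Vol -IntZ//; last by rewrite addr_ge0// ltW.
  apply: eq_integral => t _; rewrite -(integral_ind_itv (- l (toC t)) d0) muleC -ge0_integralZl//.
  apply/measurable_EFinP/measurable_ind; apply: measurable_fun_ltr => //.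
  by apply: measurable_normr; exact: measurable_funD.
have E : (Int (fun z => \int[@lebesgue_measure R]_x g z x) = Int (fun z => \int[@lebesgue_measure R]_x h z x))%E.
  rewrite (Int_swapR mg g0) (Int_swapR mh h0); apply: eq_integral => x _.
  have mgx : Cmeasurable (fun z => g z x) by exact: (measurableT_comp mg (measurable_pair2 x)).
  rewrite -(Int_translation ((- x)%:C *: u) mgx)//.
  apply: eq_integral => t _; rewrite /g /h bD lD subrK.
  rewrite (_ : - l (toC t) + x = - (l (toC t) - x)) ?normrN; last by rewrite opprB addrC.
  by rewrite !ind_and mulrAC.
have k0 : (2 != 0 :> R) by [].
apply: (@mule_cancel _ 2%:E); [exact: k0|by []|].
rewrite !muleA -!EFinM !mulrDl !mul1r.
rewrite -E1.
rewrite -E2.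
exact: E.
Qed.

Lemma normc_sqr (c : R[i]) : normc c ^+ 2 = complex.Re c ^+ 2 + complex.Im c ^+ 2.
Proof. by case: c => a b /=; rewrite sqr_sqrtr// addr_ge0// sqr_ge0. Qed.

(** The square of the distance from z to the complex line spanned by the unit
    vector zeta. *)
Definition perp (zeta z : Cvec R n) : R := sqnorm z - normc (ip z zeta) ^+ 2.

Lemma perp_ge0 zeta z : hnorm zeta = 1 -> 0 <= perp zeta z.
Proof.
move=> u1; rewrite subr_ge0 -hnorm_sqr ler_pXn2r ?nnegrE ?hnorm_ge0 ?normc_ge0//.
by have := ip_le z zeta; rewrite u1 mulr1.
Qed.

Lemma perp_shift zeta z c : hnorm zeta = 1 -> perp zeta (z + c *: zeta) = perp zeta z.
Proof.
move=> u1.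
have zz : sqnorm zeta = 1 by rewrite -hnorm_sqr u1 expr1n.
rewrite /perp sqnormD (ipZr c zeta z) (ipDl z (c *: zeta) zeta) (ipZl c zeta zeta) (sqnormZ c zeta).
rewrite ipzz zz (_ : 1%:C = 1)// mulr1 mulr1 !normc_sqr cReM cReD cImD.
by case: c => a b /=; ring.
Qed.

Lemma perpZ zeta z c : perp zeta (c *: z) = normc c ^+ 2 * perp zeta z.
Proof.
rewrite /perp (sqnormZ c z) (ipZl c z zeta) ComplexField.Normc.normcM exprMn.
by rewrite mulrBr.
Qed.

Lemma vec_measurable_sqnorm d (X : measurableType d) (H : X -> Cvec R n) :
  vec_measurable H -> measurable_fun setT (fun x => sqnorm (H x)).
Proof.
move=> mH; under eq_fun do rewrite -hnorm_sqr.
by apply: measurable_funX; exact: vec_measurable_hnorm.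
Qed.

Lemma Cmeasurable_perp zeta : Cmeasurable (perp zeta).
Proof.
apply: measurable_funB; first exact: (vec_measurable_sqnorm vec_measurable_id).
apply: measurable_funX; apply: cplx_measurable_normc; apply: vec_measurable_ip; exact: vec_measurable_id.
Qed.

Let box zeta (r d : R) z :=
  (perp zeta z < r ^+ 2) && (`|complex.Im (ip z zeta)| < d) && (`|complex.Re (ip z zeta)| < d).

(** Vol_slab in the two real directions zeta and i zeta. *)
Let box_volume zeta (r d : R) : hnorm zeta = 1 -> 0 < r -> 0 < d ->
  ((r ^+ 2)%:E * Vol (box zeta r d) = (d ^+ 2)%:E * Vol (box zeta r r))%E.
Proof.
move=> u1 r0 d0.
have [mRe mIm] : cplx_measurable (fun t => ip (toC t) zeta) by apply: vec_measurable_ip; exact: vec_measurable_id.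
have mP : Cmeasurable (fun z => perp zeta z < r ^+ 2).
  by apply: measurable_fun_ltr; [exact: Cmeasurable_perp|exact: measurable_cst].
have zz : ip zeta zeta = 1 by rewrite ipzz -hnorm_sqr u1 expr1n.
rewrite !expr2 !EFinM -!muleA.
have E1 := @Vol_slab zeta (fun z => complex.Re (ip z zeta))
  (fun z => (perp zeta z < r ^+ 2) && (`|complex.Im (ip z zeta)| < d)) d r d0 r0 mRe.
rewrite E1; first last.
- move=> z x; rewrite (perp_shift z x%:C u1).
  by rewrite (ipDl z (x%:C *: zeta) zeta) (ipZl x%:C zeta zeta) zz mulr1 cImD addr0.
- by move=> z x; rewrite (ipDl z (x%:C *: zeta) zeta) (ipZl x%:C zeta zeta) zz mulr1 cReD.
- apply: measurable_and => //; apply: measurable_fun_ltr => //.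
  exact: measurable_normr.
rewrite muleCA; congr (_ * _)%E.
have E2 := @Vol_slab ('i *: zeta) (fun z => complex.Im (ip z zeta))
  (fun z => (perp zeta z < r ^+ 2) && (`|complex.Re (ip z zeta)| < r)) d r d0 r0 mIm.
have sw s : Vol (fun z => (perp zeta z < r ^+ 2) && (`|complex.Im (ip z zeta)| < s)%R
      && (`|complex.Re (ip z zeta)| < r)%R) =
    Vol (fun z => (perp zeta z < r ^+ 2)%R && (`|complex.Re (ip z zeta)| < r)%R
      && (`|complex.Im (ip z zeta)| < s)%R).
  by congr Vol; apply/funext => z; rewrite andbAC.
rewrite /box !sw E2//.
- apply: measurable_and => //; apply: measurable_fun_ltr => //.
  exact: measurable_normr.
- move=> z x; rewrite scalerA (ipDl z _ zeta) (ipZl _ zeta zeta) zz mulr1 cImD cImM /=.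
  by rewrite mulr1 mul0r addr0.
- move=> z x; rewrite scalerA (perp_shift z _ u1).
  rewrite (ipDl z _ zeta) (ipZl _ zeta zeta) zz mulr1 cReD cReM /=.
  by rewrite mulr0 mul0r subr0 addr0.
Qed.

Definition tube zeta (r d : R) z := (perp zeta z < r ^+ 2) && (normc (ip z zeta) < d).

Lemma Cmeasurable_tube zeta r d : Cmeasurable (tube zeta r d).
Proof.
apply: measurable_and; apply: measurable_fun_ltr => //; first exact: Cmeasurable_perp.
by apply: cplx_measurable_normc; apply: vec_measurable_ip; exact: vec_measurable_id.
Qed.

Lemma tube_volume_ge (zeta : Cvec R n) (r d : R) : hnorm zeta = 1 -> 0 < r -> 0 < d ->
  (((d / 2) ^+ 2 * r ^+ (n + n))%:E * @volume_unit_ball R n <= (r ^+ 2)%:E * Vol (tube zeta r d))%E.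
Proof.
move=> u1 r0 d0; have d2 : 0 < d / 2 by rewrite divr_gt0.
apply: (@le_trans _ _ ((r ^+ 2)%:E * Vol (box zeta r (d / 2)))%E).
  rewrite box_volume// EFinM -muleA -(Vol_ball r0).
  apply: lee_wpmul2l; first by rewrite lee_fin sqr_ge0.
  apply: Vol_le => z zr; have := ip_le z zeta; rewrite u1 mulr1 => h.
  have h1 := le_trans (Re_le_normc (ip z zeta)) h.
  have h2 := le_trans (Im_le_normc (ip z zeta)) h.
  rewrite /box (le_lt_trans h1 zr) (le_lt_trans h2 zr) !andbT.
  apply: (@le_lt_trans _ _ (sqnorm z)); first by rewrite /perp gerBl sqr_ge0.
  by rewrite -hnorm_sqr ltr_pXn2r ?nnegrE ?hnorm_ge0// ltW.
apply: lee_wpmul2l; first by rewrite lee_fin sqr_ge0.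
apply: Vol_le => z /andP[/andP[zr zi] zd]; rewrite /tube zr/=.
apply: (le_lt_trans (normc_le _)); lra.
Qed.

Lemma tube_volume_le (zeta : Cvec R n) (r d : R) : hnorm zeta = 1 -> 0 < r -> 0 < d ->
  ((r ^+ 2)%:E * Vol (tube zeta r d) <= (d ^+ 2 * (2 * r) ^+ (n + n))%:E * @volume_unit_ball R n)%E.
Proof.
move=> u1 r0 d0.
apply: (@le_trans _ _ ((r ^+ 2)%:E * Vol (box zeta r d))%E).
  apply: lee_wpmul2l; first by rewrite lee_fin sqr_ge0.
  apply: Vol_le => z /andP[zr zd]; rewrite /box zr/=.
  by rewrite (le_lt_trans (Re_le_normc _) zd) (le_lt_trans (Im_le_normc _) zd).
have r2 : 0 < 2 * r by rewrite mulr_gt0.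
rewrite box_volume// (EFinM (d ^+ 2)) -muleA -(@Vol_ball R n (2 * r) r2).
apply: lee_wpmul2l; first by rewrite lee_fin sqr_ge0.
apply: Vol_le => z /andP[/andP[zr zi] zd].
rewrite -(@ltr_pXn2r _ 2) ?nnegrE ?hnorm_ge0//; last exact: ltW.
rewrite hnorm_sqr.
have -> : sqnorm z = perp zeta z + (complex.Re (ip z zeta) ^+ 2 + complex.Im (ip z zeta) ^+ 2).
  by rewrite -normc_sqr /perp subrK.
have sq (x : R) : `|x| < r -> x ^+ 2 < r ^+ 2.
  by move=> xr; rewrite -real_normK ?num_real// ltr_pXn2r ?nnegrE// ltW.
have := sq _ zi; have := sq _ zd; have := sqr_ge0 r; rewrite exprMn; move: zr.
set a := perp _ _; set b := _ ^+ 2; set c := _ ^+ 2; set e := _ ^+ 2; lra.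
Qed.

End slabs.

(** * Integrals of powers of a linear function *)

Section power_integrals.
Context {R : realType}.
Notation mu := (@lebesgue_measure R).

Lemma integral_ind (a b : R) (f : R -> R) :
  (\int[mu]_(t in `[a, b]) (f t)%:E = \int[mu]_t (ind (a <= t <= b) * f t)%:E)%E.
Proof.
rewrite integral_mkcond; apply: eq_integral => t _; rewrite /patch mem_setE in_itv/=.
by case: ifPn => _; rewrite /ind ?mul1r ?mul0r.
Qed.

Lemma is_derive_powR_lin (A r e t : R) : 0 < A - r * t ->
  is_derive t 1 (fun t => (A - r * t) `^ e) (- r * (e * (A - r * t) `^ (e - 1))).
Proof.
move=> h.
have h1 : is_derive t 1 (fun t => A - r * t) (- r).
  have H : is_derive t 1 (fun t => A - r * t) (0 - r *: (1 : R)).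
    by apply: is_deriveB.
  by move: H; rewrite sub0r /GRing.scale /= mulr1.
have h2 := is_derive1_powR e h.
have := @is_derive1_comp R (fun x => x `^ e) (fun t => A - r * t) t _ _ h2 h1.
by rewrite mulrC.
Qed.

Lemma integral_powR_lin (A r e a b : R) : a < b -> 0 < r -> 0 < A - r * b ->
  e + 1 != 0 ->
  (\int[mu]_(t in `[a, b]) ((A - r * t) `^ e)%:E =
   (((A - r * a) `^ (e + 1) - (A - r * b) `^ (e + 1)) / (r * (e + 1)))%:E)%E.
Proof.
move=> ab r0 bA e1.
have pos t : t <= b -> 0 < A - r * t.
  by move=> tb; apply: lt_le_trans bA _; rewrite lerD2l lerN2 ler_wpM2l// ltW.
pose F t := (- (r * (e + 1))^-1) * (A - r * t) `^ (e + 1).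
have dF t : t <= b -> is_derive t 1 F ((A - r * t) `^ e).
  move=> tb; have := @is_deriveZ _ _ _ (fun t => (A - r * t) `^ (e + 1)) (- (r * (e + 1))^-1) t _ _
    (is_derive_powR_lin (e + 1) (pos t tb)).
  rewrite addrK => H; rewrite (_ : (A - r * t) `^ e =
    - (r * (e + 1))^-1 *: (- r * ((e + 1) * (A - r * t) `^ e)))//.
  change ((A - r * t) `^ e = - (r * (e + 1))^-1 * (- r * ((e + 1) * (A - r * t) `^ e))).
  by field; rewrite e1 gt_eqF.
have cF t : t <= b -> {for t, continuous F}.
  by move=> /dF tb; apply/differentiable_continuous/derivable1_diffP; case: tb.
rewrite (@continuous_FTC2 _ _ F)//.
- rewrite -EFinB /F; congr (_%:E); field.
  by rewrite e1 gt_eqF.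
- apply: continuous_in_subspaceT => x; rewrite inE/= in_itv/= => /andP[_ xb].
  have h := is_derive_powR_lin e (pos x xb).
  by apply/differentiable_continuous/derivable1_diffP; case: h.
- split.
  + by move=> x; rewrite in_itv/= => /andP[_ /ltW/dF]; case.
  + by apply: cvg_at_right_filter; apply: cF; exact: ltW.
  + by apply: cvg_at_left_filter; exact: cF.
- by move=> x; rewrite in_itv/= => /andP[_ /ltW/dF]; rewrite derive1E; case.
Qed.

Lemma powR_le_inv (x y e : R) : 0 < x -> x <= y -> e <= 0 -> y `^ e <= x `^ e.
Proof.
move=> x0 xy e0; have y0 : 0 < y by exact: lt_le_trans xy.
rewrite -(opprK e) (powRN x) (powRN y) lef_pV2 ?posrE ?powR_gt0//.
by apply: ge0_ler_powR; rewrite ?nnegrE ?oppr_ge0// ltW.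
Qed.

Lemma measurable_powR_comp d (X : measurableType d) (f : X -> R) (e : R) :
  measurable_fun setT f -> measurable_fun setT (fun x => f x `^ e).
Proof. by move=> mf; exact: (measurableT_comp (measurable_powR e) mf). Qed.

(** max (1 - t) X >= (1 + X - t) / 2, and a power of the right-hand side has an
    explicit primitive. *)
Lemma ray_kernel_le (g X : R) : 0 < g -> 0 < X ->
  (\int[mu]_t (ind (0 <= t <= 1)%R * (Num.max (1 - t) X) `^ (- 1 - g))%:E <=
   (2 `^ (1 + g) / g * X `^ (- g))%:E)%E.
Proof.
move=> g0 X0.
have e1 : - 1 - g + 1 = - g by ring.
have E : (\int[mu]_t (ind (0 <= t <= 1)%R * ((1 + X) - 1 * t) `^ (- 1 - g))%:E =
   ((((1 + X) - 1 * 0) `^ (- g) - ((1 + X) - 1 * 1) `^ (- g)) / (1 * (- g)))%:E)%E.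
  rewrite -integral_ind integral_powR_lin ?e1//; first by lra.
  by rewrite oppr_eq0 gt_eqF.
apply: (@le_trans _ _ (\int[mu]_t ((2 `^ (1 + g))%:E * (ind (0 <= t <= 1)%R * ((1 + X) - 1 * t) `^ (- 1 - g))%:E))%E).
  apply: integral_monotone => t.
    by rewrite lee_fin mulr_ge0 ?ind_ge0 ?powR_ge0.
  rewrite -EFinM lee_fin /ind; case: (boolP (0 <= t <= 1)) => [|_]; last by rewrite !mul0r mulr0.
  move=> /andP[t0 t1]; rewrite !mul1r.
  have m0 : 0 < Num.max (1 - t) X by rewrite lt_max X0 orbT.
  have h : (1 + X - t) / 2 <= Num.max (1 - t) X.
    by rewrite le_max; apply/orP; case: (leP (1 - t) X) => h; [right|left]; lra.
  have p0 : 0 < (1 + X - t) / 2 by lra.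
  apply: le_trans (powR_le_inv p0 h _) _; first by lra.
  rewrite powRM; [|lra|lra].
  rewrite mulrC -powR_inv1// -powRrM (_ : - 1 * (- 1 - g) = 1 + g)//; last by ring.
rewrite ge0_integralZl//; last 2 first.
- apply/measurable_EFinP; apply: measurable_funM.
    apply: measurable_ind; apply: measurable_and; apply: measurable_fun_ler => //.
  apply: measurable_powR_comp.
  by apply: measurable_funB => //; apply: measurable_funM.
- by move=> t _; rewrite lee_fin mulr_ge0 ?ind_ge0 ?powR_ge0.
rewrite E -EFinM lee_fin -mulrA ler_wpM2l ?powR_ge0//.
rewrite !mul1r subr0 (_ : 1 + X - 1 = X); last by ring.
have := powR_ge0 (1 + X) (- g); set u := _ `^ _; set v := _ `^ _ => u0.
rewrite invrN mulrN -mulNr opprB mulrC.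
by apply: ler_wpM2l; [rewrite invr_ge0 ltW|rewrite gerBl].
Qed.

(** The integrand may blow up where 1 - r u vanishes: integrate over compact
    subintervals and pass to the limit by monotone convergence. *)
Lemma layer_integral_le (b r k : R) : -1 < b -> 0 < r -> 0 < k ->
  (\int[mu]_u (ind (0 < 1 - r * u <= k)%R * (1 - r * u) `^ b)%:E <=
   (k `^ (b + 1) / (r * (b + 1)))%:E)%E.
Proof.
move=> b1 r0 k0; have b0 : 0 < b + 1 by lra.
pose e (i : nat) : R := k / i.+2%:R.
have e0 i : 0 < e i by rewrite divr_gt0.
have ek i : e i < k by rewrite ltr_pdivrMr// ltr_pMr// ltr1n.
pose F i : set (measurableTypeR R) := [set` `[(1 - k) / r, (1 - e i) / r]].
have mf (i : nat) : measurable_fun (F i) (fun u : R => ((1 - r * u) `^ b)%:E).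
  apply/measurable_EFinP; apply: measurable_funTS.
  apply: measurable_powR_comp.
  by apply: measurable_funB => //; apply: measurable_funM.
have nd : nondecreasing_seq F.
  move=> i j ij; apply/subsetPset => u; rewrite /F /= !in_itv/= => /andP[-> h]/=.
  apply: le_trans h _; rewrite ler_pM2r ?invr_gt0// lerD2l lerN2.
  by rewrite ler_pM2l// lef_pV2 ?posrE// ler_nat.
have := @ge0_nondecreasing_set_cvg_integral _ (measurableTypeR R) R F
  (fun u : measurableTypeR R => ((1 - r * u) `^ b)%:E) (@lebesgue_measure R) nd (fun i => measurable_itv _) mf
  (fun i x _ => powR_ge0 _ _).
move=> cv.
apply: (@le_trans _ _ (\int[mu]_(u in \bigcup_i F i) ((1 - r * u) `^ b)%:E)%E).
  rewrite [leRHS]integral_mkcond; apply: integral_monotone => u.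
    by rewrite lee_fin mulr_ge0 ?ind_ge0 ?powR_ge0.
  rewrite /patch /ind; case: (boolP (0 < 1 - r * u <= k)) => [/andP[h1 h2]|_]; last first.
    by rewrite mul0r; case: ifPn => _ //; rewrite lee_fin powR_ge0.
  rewrite ifT ?mul1r// inE.
  have [N hN] : exists N : nat, k / (1 - r * u) < N%:R.
    by exists (Num.truncn (k / (1 - r * u))).+1; exact: truncnS_gt.
  exists N => //; rewrite /F /= in_itv/= ler_pdivrMr// ler_pdivlMr//.
  apply/andP; split; first lra.
  suff : e N <= 1 - r * u by lra.
  rewrite /e ler_pdivrMr// mulrC -ler_pdivrMr//.
  by rewrite (le_trans (ltW hN))// ler_nat; exact: ltnW.
apply: (@cvge_to_le _ _ _ _ _ _ _ cv).
apply: nearW => i; rewrite /F integral_powR_lin//.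
- rewrite lee_fin ler_pM2r ?invr_gt0 ?mulr_gt0//.
  have -> : 1 - r * ((1 - k) / r) = k by field; rewrite gt_eqF.
  by rewrite lerBlDr lerDl powR_ge0.
- by rewrite ltr_pM2r ?invr_gt0// ltrD2l ltrN2.
- have -> : 1 - r * ((1 - e i) / r) = e i by field; rewrite gt_eqF.
  exact: e0.
- by rewrite gt_eqF.
Qed.

End power_integrals.

(** * Integrals over boundary layers *)

Section boundary_layers.
Context {R : realType} {n : nat}.
Notation mu := (@lebesgue_measure R).
Notation T := (measurableTypeR R).
Notation Tn := ((n + n).-tuple (measurableTypeR R)).
Notation toC := (@complex_of_tuple R n).
Implicit Types (z w a v : Cvec R n).

Lemma hnorm_realscale (t : R) z : 0 <= t -> hnorm (t%:C *: z) = t * hnorm z.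
Proof. by move=> t0; rewrite hnorm_scale normc_real ger0_norm. Qed.

Lemma integral_ind_cst (a b k : R) : a <= b ->
  (\int[mu]_t (ind (a <= t <= b) * k)%:E = ((b - a) * k)%:E)%E.
Proof.
move=> ab; rewrite -integral_ind integral_cst//.
have E : @lebesgue_measure R [set` `[a, b]] = (b - a)%:E.
  rewrite lebesgue_measure_itv/= lte_fin; case: ltP => h; first by rewrite -EFinB.
  by rewrite (_ : b = a) ?subrr//; apply/eqP; rewrite eq_le ab h.
by transitivity (k%:E * (b - a)%:E)%E; [congr (_ * _)%E|rewrite -EFinM mulrC].
Qed.

Lemma measurable_Int_l d (X : measurableType d)
    (m : {sigma_finite_measure set X -> \bar R}) (f : Cvec R n -> X -> \bar R) :
  measurable_fun setT (fun x : Tn * X => f (toC x.1) x.2) ->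
  (forall z x, 0 <= f z x)%E -> measurable_fun setT (fun x => Int (f^~ x)).
Proof.
move=> mf f0.
exact: (@measurable_fun_fubini_tonelli_G _ _ _ _ _ (@lebesgueC R n) (fun x => f (toC x.1) x.2) mf).
Qed.

(** For u in [1, 1 + rho] the integral of a function g is at most a constant times
    that of z |-> g (u z). Averaging over u replaces the singular weight by its mean
    along a piece of the ray through z, which is of order rho^b, so that only the
    volume of S' remains. This takes the place of polar coordinates. *)
Lemma boundary_layer (b K : R) : -1 < b -> 0 < K -> exists2 C : R, 0 <= C &
  forall (rho : R) (S S' : Cvec R n -> bool), 0 < rho <= 1 -> Cmeasurable S -> Cmeasurable S' ->
  (forall z, S z -> hnorm z < 1 /\ 1 - hnorm z <= K * rho) ->
  (forall z (t : R), S z -> 1 - rho <= t <= 1 -> S' (t%:C *: z)) ->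
  (Int (fun z => (ind (S z) * (1 - hnorm z) `^ b)%:E) <= (C * rho `^ b)%:E * Vol S')%E.
Proof.
move=> b1 K0; have bp : 0 < b + 1 by lra.
(* for b >= 0 the weight is at most (K rho)^b on S; the averaging is needed for
   negative b only *)
have [b0|b0] := leP 0 b.
  exists (K `^ b); first exact: powR_ge0.
  move=> rho S S' /andP[r0 r1] mS mS' hS hS'.
  have mI := Cmeasurable_ind mS'.
  rewrite /Vol -IntZ; last 3 first.
  - exact: mI.
  - by move=> z; rewrite lee_fin ind_ge0.
  - by rewrite mulr_ge0 ?powR_ge0.
  apply: Int_le => z; first by rewrite lee_fin mulr_ge0 ?ind_ge0 ?powR_ge0.
  rewrite -EFinM lee_fin.
  case Sz: (S z); last by rewrite /ind mul0r !mulr_ge0 ?powR_ge0.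
  have [z1 zr] := hS z Sz.
  have := hS' z 1 Sz; rewrite scale1r lexx andbT lerBlDr lerDl (ltW r0) => /(_ isT) ->.
  rewrite /ind mul1r mulr1 -powRM; [|exact: ltW|exact: ltW].
  by apply: ge0_ler_powR => //; rewrite nnegrE ?mulr_ge0 ?subr_ge0// ltW.
pose C1 : R := 4 * K `^ (b + 1) / (b + 1) + 2.
have C10 : 0 <= C1 by rewrite addr_ge0// divr_ge0 ?mulr_ge0 ?powR_ge0// ltW.
exists (2 ^+ (n + n) * C1); first by rewrite mulr_ge0// exprn_ge0.
move=> rho S S' /andP[r0 r1] mS mS' hS hS'.
pose g z : \bar R := (ind (S z) * (1 - hnorm z) `^ b)%:E.
have g0 z : (0 <= g z)%E by rewrite lee_fin mulr_ge0 ?ind_ge0 ?powR_ge0.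
have mg : Cmeasurable g.
  apply/measurable_EFinP; apply: measurable_funM; first exact: measurable_ind.
  apply: measurable_powR_comp; apply: measurable_funB; first exact: measurable_cst.
  exact: Cmeasurable_hnorm.
pose h z (u : R) : \bar R := ((ind (1 <= u <= 1 + rho))%:E * g (u%:C *: z))%E.
have h0 z u : (0 <= h z u)%E by rewrite mule_ge0// lee_fin ind_ge0.
have mh : measurable_fun setT (fun x : Tn * T => h (toC x.1) x.2).
  apply: emeasurable_funM.
    apply/measurable_EFinP; apply: measurable_ind.
    by apply: measurable_and; apply: measurable_fun_ler => //; exact: measurable_snd.
  apply: (Cmeasurable_comp mg); apply: vec_measurable_scale; first by apply: cplx_measurable_real; exact: measurable_snd.
  exact: (vec_measurable_comp vec_measurable_id measurable_fst).
have step1 : (rho%:E * Int g <= (2 ^+ (n + n))%:E * Int (fun z => \int[mu]_u h z u))%E.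
  have E : (rho%:E * Int g = \int[mu]_u ((ind (1 <= u <= 1 + rho)%R)%:E * Int g))%E.
    rewrite ge0_integralZr//; last 3 first.
    - apply/measurable_EFinP; apply: measurable_ind.
      by apply: measurable_and; apply: measurable_fun_ler.
    - by move=> x _; rewrite lee_fin ind_ge0.
    - exact: Int_ge0.
    congr (_ * _)%E.
    have := @integral_ind_cst 1 (1 + rho) 1; rewrite lerDl (ltW r0) => /(_ isT) E.
    transitivity (((1 + rho - 1) * 1)%:E : \bar R); first by congr (_%:E); ring.
    by rewrite -E; apply: eq_integral => u _; rewrite mulr1.
  rewrite E.
  rewrite (Int_swapR mh h0).
  rewrite -[leRHS]ge0_integralZl; last 4 first.
  - exact: measurableT.
  - exact: (measurable_Int_l mu mh h0).
  - by move=> x _; exact: Int_ge0.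
  - by rewrite lee_fin exprn_ge0.
  apply: integral_monotone => u; first by rewrite mule_ge0 ?Int_ge0// lee_fin ind_ge0.
  case: (boolP (1 <= u <= 1 + rho)) => [/andP[u1 u2]|hu]; last first.
    by rewrite /ind mul0e mule_ge0// ?lee_fin ?exprn_ge0 ?Int_ge0.
  have u0 : 0 < u by lra.
  have -> : Int (h^~ u) = Int (fun z => g (u%:C *: z)).
    by apply: eq_integral => t _; rewrite /h u1 u2 /ind mul1e.
  rewrite /ind mul1e (Int_dilation u0 mg g0) muleA -EFinM.
  rewrite -[leLHS]mul1e; apply: lee_wpmul2r; first exact: Int_ge0.
  rewrite lee_fin -exprVn -exprMn exprn_ege1//.
  by rewrite -ler_pdivrMr ?invr_gt0// invrK mul1r; lra.
have step2 : (Int (fun z => \int[mu]_u h z u) <= (C1 * rho `^ (b + 1))%:E * Vol S')%E.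
  have mI := Cmeasurable_ind mS'.
  have k0 : 0 <= C1 * rho `^ (b + 1) by rewrite mulr_ge0 ?powR_ge0.
  rewrite /Vol -IntZ//; last by move=> z; rewrite lee_fin ind_ge0.
  apply: Int_le => z; first by apply: integral_ge0.
  case S'z : (S' z); last first.
    rewrite /ind mule0 (_ : (\int[mu]_u h z u)%E = 0%E)//.
    apply: integral0_eq => u _; rewrite /h.
    case: (boolP (1 <= u <= 1 + rho)) => [/andP[u1 u2]|hu]; last by rewrite /ind mul0e.
    rewrite /g; case Su : (S (u%:C *: z)); last by rewrite /ind mul0r mule0.
    have u0 : 0 < u by lra.
    have c : 1 - rho <= u^-1 <= 1.
      rewrite invf_le1 ?u1// andbT -[leRHS]div1r ler_pdivlMr//.
      nra.
    have := hS' (u%:C *: z) u^-1 Su c.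
    by rewrite scalerA -rmorphM /= mulVf ?gt_eqF// scale1r S'z.
  rewrite (_ : ind true = 1 :> R)// mule1.
  pose r := hnorm z.
  have r00 : 0 <= r := hnorm_ge0 z.
  have hle u : (h z u <= (ind (1 <= u <= 1 + rho)%R * (ind (0 < 1 - r * u <= K * rho)%R * (1 - r * u) `^ b))%:E)%E.
    rewrite /h /g -EFinM lee_fin.
    case: (boolP (1 <= u <= 1 + rho)) => [/andP[u1 u2]|hu]; last by rewrite /ind !mul0r.
    have u0 : 0 <= u by lra.
    rewrite /ind !mul1r; case Su : (S (u%:C *: z)); last by rewrite mul0r mulr_ge0 ?powR_ge0.
    have := hS _ Su; rewrite (hnorm_realscale z u0) -/r (mulrC u r) => -[c1 c2].
    by rewrite subr_gt0 c1 c2.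
  (* layer_integral_le has a factor 1 / r; for small r the weight is bounded
     along the piece of the ray *)
  have [rbig|rsmall] := leP 4^-1 r.
    have rp : 0 < r by lra.
    apply: (@le_trans _ _ (((K * rho) `^ (b + 1)) / (r * (b + 1)))%:E).
      apply: le_trans (layer_integral_le b1 rp (mulr_gt0 K0 r0)).
      apply: integral_monotone => // u; apply: le_trans (hle u) _.
      rewrite lee_fin /ind; case: (_ <= _ <= _); rewrite ?mul1r// mul0r.
      by rewrite mulr_ge0 ?powR_ge0.
    rewrite lee_fin (powRM (b + 1) (ltW K0) (ltW r0)) invfM.
    have rv : r^-1 <= 4 by rewrite -[leRHS]invrK lef_pV2 ?posrE.
    have := powR_ge0 rho (b + 1); have := powR_ge0 K (b + 1); rewrite /C1.
    move: (K `^ _) (rho `^ _) => A B A0 B0.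
    have bi : 0 < (b + 1)^-1 by rewrite invr_gt0.
    apply: (@le_trans _ _ ((A * (b + 1)^-1 * B) * 4)); last first.
      rewrite mulrDl (_ : 4 * A / (b + 1) * B = (A * (b + 1)^-1 * B) * 4); last by ring.
      by rewrite lerDl mulr_ge0.
    rewrite (_ : A * B * (r^-1 / (b + 1)) = (A * (b + 1)^-1 * B) * r^-1); last by ring.
    by apply: ler_wpM2l => //; rewrite !mulr_ge0// ltW.
  apply: (@le_trans _ _ (\int[mu]_u (ind (1 <= u <= 1 + rho)%R * 2)%:E)%E).
    apply: integral_monotone => // u; apply: le_trans (hle u) _; rewrite lee_fin.
    case: (boolP (1 <= u <= 1 + rho)) => [/andP[u1 u2]|hu]; last by rewrite /ind !mul0r.
    rewrite (_ : ind true = 1 :> R)// !mul1r.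
    have ru : 2^-1 <= 1 - r * u by nra.
    apply: (@le_trans _ _ ((1 - r * u) `^ b)).
      by rewrite /ind; case: (_ < _ <= _); rewrite ?mul1r// mul0r powR_ge0.
    apply: le_trans (powR_le_inv _ ru (ltW b0)) _; first by lra.
    rewrite -powR_inv1// -powRrM -[leRHS]powRr1//.
    by apply: ler_powR; lra.
  rewrite integral_ind_cst; last by rewrite lerDl ltW.
  rewrite lee_fin.
  rewrite addrC addKr mulrC /C1.
  have : rho <= rho `^ (b + 1).
    rewrite -{1}(powRr1 (ltW r0)); apply: ger_powR; last by lra.
    by rewrite r0 r1.
  have : 0 <= 4 * K `^ (b + 1) / (b + 1) by rewrite divr_ge0 ?mulr_ge0 ?powR_ge0// ltW.
  move: (4 * _ / _) (rho `^ _) => A B A0 B0; nra.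
have rE : rho `^ (b + 1) = rho * rho `^ b.
  rewrite powRD; last by rewrite gt_eqF// implybT.
  by rewrite mulrC (powRr1 (ltW r0)).
have : (rho%:E * Int g <= rho%:E * ((2 ^+ (n + n) * C1 * rho `^ b)%:E * Vol S'))%E.
  apply: le_trans step1 _.
  apply: (@le_trans _ _ ((2 ^+ (n + n))%:E * ((C1 * rho `^ (b + 1))%:E * Vol S'))%E).
    by apply: lee_wpmul2l => //; rewrite lee_fin exprn_ge0.
  rewrite !muleA -!EFinM rE (_ : 2 ^+ (n + n) * (C1 * (rho * rho `^ b)) = rho * (2 ^+ (n + n) * C1 * rho `^ b))//.
  by ring.
by rewrite lee_pmul2l.
Qed.

End boundary_layers.

(** * Caps and the Forelli-Rudin estimate *)

Section kernel_estimates.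
Context {R : realType} {n : nat}.
Notation mu := (@lebesgue_measure R).
Notation T := (measurableTypeR R).
Notation Tn := ((n + n).-tuple (measurableTypeR R)).
Notation toC := (@complex_of_tuple R n).
Notation V := (fine (@volume_unit_ball R n)).
Implicit Types (z w a v : Cvec R n).

Lemma powR_comparable (c x y e : R) : 1 <= c -> 0 < x -> 0 < y ->
  x <= c * y -> y <= c * x -> x `^ e <= c `^ `|e| * y `^ e.
Proof.
move=> c1 x0 y0 xy yx; have c0 : 0 < c by lra.
have [e0|e0] := leP 0 e.
  rewrite ger0_norm// -(powRM e (ltW c0) (ltW y0)).
  by apply: ge0_ler_powR => //; rewrite nnegrE ltW// mulr_gt0.
have h : y / c <= x by rewrite ler_pdivrMr// mulrC.
have yc : 0 < y / c by rewrite divr_gt0.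
apply: le_trans (powR_le_inv yc h (ltW e0)) _.
rewrite (powRM e (ltW y0)); last by rewrite invr_ge0 ltW.
by rewrite ltr0_norm// -(powR_inv1 (ltW c0)) -powRrM mulN1r mulrC.
Qed.

Lemma V_gt0 : 0 < V.
Proof.
by rewrite fine_gt0// volume_unit_ball_gt0 volume_unit_ball_lty.
Qed.

Lemma VolE_fine : (@volume_unit_ball R n = V%:E).
Proof. by rewrite fineK// volume_unit_ball_fin. Qed.

Lemma Vol_translation (b : Cvec R n -> bool) w : Cmeasurable b ->
  Vol (fun z => b (z + w)) = Vol b.
Proof.
move=> mb; apply: (Int_translation (f := fun z => (ind (b z))%:E)).
  exact: Cmeasurable_ind.
by move=> z; rewrite lee_fin ind_ge0.
Qed.

Lemma Cmeasurable_ball_at w (r : R) : Cmeasurable (fun z => hnorm (z - w) < r).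
Proof.
apply: measurable_fun_ltr; last exact: measurable_cst.
by apply: vec_measurable_hnorm; apply: vec_measurableD; [exact: vec_measurable_id|exact: vec_measurable_cst].
Qed.

Lemma Vol_ball_at w (r : R) : 0 < r ->
  Vol (fun z => hnorm (z - w) < r) = (r ^+ (n + n) * V)%:E.
Proof.
move=> r0; rewrite (@Vol_translation (fun z => hnorm z < r) (- w)); last exact: Cmeasurable_ball.
by rewrite (@Vol_ball R n r r0) VolE_fine -EFinM.
Qed.

(** With rho = 1 - |v|, multiplication by t in [1 - rho, 1] moves a point by at most
    rho, so boundary_layer applies with a slightly larger ball, whose volume is of
    order rho^(2n). *)
Lemma ball_layer (b : R) : -1 < b -> exists2 C : R, 0 <= C &
  forall v, hnorm v < 1 ->
  (Int (fun z => (ind ((hnorm z < 1)%R && (hnorm (z - v) <= 3 * (1 - hnorm v))%R) * (1 - hnorm z) `^ b)%:E) <=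
   (C * ((1 - hnorm v) `^ b * (1 - hnorm v) ^+ (n + n)))%:E)%E.
Proof.
move=> b1; have [C C0 HC] := @boundary_layer R n b 4 b1 (ltr0n _ 4).
exists (C * (5 ^+ (n + n) * V)).
  by rewrite mulr_ge0// mulr_ge0// ltW// V_gt0.
move=> v v1; set rho := 1 - hnorm v.
have r0 : 0 < rho by rewrite subr_gt0.
have r1 : rho <= 1 by rewrite gerBl hnorm_ge0.
have := HC rho (fun z => (hnorm z < 1) && (hnorm (z - v) <= 3 * rho)) (fun z => hnorm (z - v) < 5 * rho).
rewrite r0 r1 => /(_ isT) h; apply: le_trans (h _ _ _ _) _.
- apply: measurable_and; first exact: Cmeasurable_ball.
  apply: measurable_fun_ler; last exact: measurable_cst.
  by apply: vec_measurable_hnorm; apply: vec_measurableD; [exact: vec_measurable_id|exact: vec_measurable_cst].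
- exact: Cmeasurable_ball_at.
- move=> z /andP[z1 zv]; split=> //.
  by have := hnorm_ge_sub v z; rewrite hnorm_subC; rewrite /rho in zv *; lra.
- move=> z t /andP[z1 zv] /andP[t1 t2].
  have -> : t%:C *: z - v = (z - v) + (t - 1)%:C *: z.
    by rewrite rmorphB scalerBl scale1r [RHS]addrC -addrA addKr.
  apply: (le_lt_trans (hnorm_add _ _)); rewrite hnorm_scale normc_real distrC.
  rewrite ger0_norm ?subr_ge0//.
  by have := hnorm_ge0 z; nra.
- rewrite Vol_ball_at ?mulr_gt0// -EFinM lee_fin exprMn le_eqVlt; apply/orP; left.
  by apply/eqP; ring.
Qed.

(** Its square root is the nonisotropic (Koranyi) distance on the sphere, which
    explains the anisotropic tubes. *)
Definition koranyi a z : R := normc (1 - ip z a).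

Lemma vec_measurable_koranyi d (S : measurableType d) (H : S -> Cvec R n) a :
  vec_measurable H -> measurable_fun setT (fun x => koranyi a (H x)).
Proof.
move=> mH; apply: cplx_measurable_normc.
rewrite (_ : (fun x => _) = fun x => 1 + (-1) * ip (H x) a).
  apply: cplx_measurableD; first exact: cplx_measurable_cst.
  by apply: cplx_measurableM; [exact: cplx_measurable_cst|exact: vec_measurable_ip].
by apply/funext => x; rewrite mulN1r.
Qed.

Lemma koranyi_ge a z : 1 - hnorm z * hnorm a <= koranyi a z.
Proof.
have h1 := normcD (1 - ip z a) (ip z a); rewrite subrK normc1 in h1.
by have := ip_le z a; rewrite /koranyi; lra.
Qed.

Lemma koranyi_ge_l a z : hnorm a <= 1 -> 1 - hnorm z <= koranyi a z.
Proof. by move=> a1; have := koranyi_ge a z; have := hnorm_ge0 z; nra. Qed.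

Lemma koranyi_ge_r a z : hnorm z <= 1 -> 1 - hnorm a <= koranyi a z.
Proof. by move=> a1; have := koranyi_ge a z; have := hnorm_ge0 a; nra. Qed.

Lemma koranyi_le2 a z : hnorm a <= 1 -> hnorm z <= 1 -> koranyi a z <= 2.
Proof.
move=> a1 z1; have h1 := normcD 1 (- ip z a); rewrite normcN normc1 in h1.
have := ip_le z a; have := hnorm_ge0 z; have := hnorm_ge0 a; rewrite /koranyi; nra.
Qed.

(** The lower bound |1 - <z,a>| >= 1 - |z| makes this Lipschitz bound a
    comparison of the values at points closer to each other than to the sphere. *)
Lemma koranyi_lip a z w : hnorm a <= 1 -> koranyi a z <= koranyi a w + hnorm (z - w).
Proof.
move=> a1; rewrite /koranyi.
have -> : 1 - ip z a = (1 - ip w a) + - ip (z - w) a.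
  by rewrite (ipDl z (- w) a) (ipNl w a); ring.
apply: le_trans (normcD _ _) _; rewrite normcN lerD2l.
by apply: le_trans (ip_le _ _) _; rewrite ler_piMr// hnorm_ge0.
Qed.

Lemma unit_direction a : (0 < n)%N ->
  exists2 zeta : Cvec R n, hnorm zeta = 1 & a = (hnorm a)%:C *: zeta.
Proof.
move=> n0; have [a0|a0] := eqVneq (hnorm a) 0.
  exists (delta_mx 0 (Ordinal n0)); first exact: hnorm_delta.
  by rewrite a0 scale0r; exact: hnorm_eq0.
have ap : 0 < hnorm a by rewrite lt_def a0 hnorm_ge0.
exists ((hnorm a)^-1%:C *: a).
  by rewrite hnorm_realscale ?invr_ge0 ?hnorm_ge0// mulVf.
by rewrite scalerA -rmorphM /= mulfV// scale1r.
Qed.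

Lemma Cmeasurable_koranyi a : Cmeasurable (koranyi a).
Proof. exact: vec_measurable_koranyi vec_measurable_id. Qed.

(** The cap lies in the translate by zeta = a / |a| of a tube of width rho along
    zeta and sqrt rho across it. *)
Lemma Vol_cap_le a (rho : R) : (0 < n)%N -> hnorm a < 1 -> 0 < rho -> 1 - hnorm a <= rho ->
  (Vol (fun w => (hnorm w < 1)%R && (koranyi a w < 2 * rho)%R) <=
   (2 * 32 ^+ n * V * rho ^+ n.+1)%:E)%E.
Proof.
move=> n0 a1 r0 ar.
have [zeta u1 aE] := unit_direction a n0.
have zz : ip zeta zeta = 1 by rewrite ipzz -hnorm_sqr u1 expr1n.
pose s := Num.sqrt (8 * rho).
have s0 : 0 < s by rewrite sqrtr_gt0 mulr_gt0.
have s2 : s ^+ 2 = 8 * rho by rewrite sqr_sqrtr// ltW// mulr_gt0.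
have d0 : 0 < 4 * rho by rewrite mulr_gt0.
have sub : (Vol (fun w => (hnorm w < 1)%R && (koranyi a w < 2 * rho)%R) <= Vol (tube zeta s (4 * rho)))%E.
  rewrite -(Vol_translation (- zeta) (Cmeasurable_tube zeta s (4 * rho))).
  apply: Vol_le => w /andP[w1 wr].
  have wz : normc (1 - ip w zeta) < 3 * rho.
    have -> : 1 - ip w zeta = (1 - ip w a) + ((hnorm a)%:C - 1) * ip w zeta.
      rewrite [in ip w a]aE (ipZr (hnorm a)%:C zeta w) (_ : conjc (hnorm a)%:C = (hnorm a)%:C); last first.
        by apply: complex_ext; rewrite /= ?oppr0.
      by ring.
    apply: (le_lt_trans (normcD _ _)); rewrite ComplexField.Normc.normcM.
    rewrite (_ : (hnorm a)%:C - 1 = (hnorm a - 1)%:C); last by rewrite rmorphB.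
    rewrite normc_real distrC ger0_norm; last by rewrite subr_ge0 ltW.
    have := ip_le w zeta; rewrite u1 mulr1.
    have := normc_ge0 (ip w zeta); rewrite -/(koranyi a w).
    move: (normc _) (koranyi a w) wr => A B; nra.
  rewrite /tube; apply/andP; split.
    rewrite -scaleN1r (perp_shift w (-1) u1) s2 /perp -hnorm_sqr.
    have h1 := normcD (1 - ip w zeta) (ip w zeta); rewrite subrK normc1 in h1.
    have h2 := ip_le w zeta; rewrite u1 mulr1 in h2.
    rewrite subr_sqr; have p0 := normc_ge0 (ip w zeta).
    move: h1 h2 wz p0; move: (normc (ip w zeta)) (normc (1 - ip w zeta)) => B A h1 h2 wz p0.
    have h3 : hnorm w - B < 3 * rho by lra.
    have h4 : (hnorm w - B) * (hnorm w + B) <= (hnorm w - B) * 2 by apply: ler_wpM2l; lra.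
    lra.
  rewrite (ipDl w (- zeta) zeta) (ipNl zeta zeta) zz normcB; lra.
apply: le_trans sub _.
have h := tube_volume_le u1 s0 d0.
have sE : (2 * s) ^+ (n + n) = (2 ^+ 2) ^+ n * (8 * rho) ^+ n.
  by rewrite addnn -muln2 mulnC exprM (exprMn 2 2 s) s2 exprMn.
rewrite sE s2 VolE_fine -EFinM in h.
have k0 : 0 < 8 * rho by rewrite mulr_gt0.
have E : (4 * rho) ^+ 2 * ((2 ^+ 2) ^+ n * (8 * rho) ^+ n) * V =
    (8 * rho) * (2 * 32 ^+ n * V * rho ^+ n.+1).
  by rewrite (_ : 32 = 2 ^+ 2 * 8)//; [rewrite !exprMn !exprS; ring|rewrite -!natrX -natrM].
by rewrite E (EFinM (8 * rho)) lee_pmul2l in h.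
Qed.

(** The radial layers of a cap stay in a cap of twice the size, so for
    rho between 1 - |a| and 1 boundary_layer reduces the weighted volume to
    Vol_cap_le. A smaller cap is empty, a larger one is compared with the ball. *)
Lemma cap_layer (b : R) : (0 < n)%N -> -1 < b -> exists2 C : R, 0 <= C &
  forall a (rho : R), hnorm a < 1 -> 0 < rho ->
  (Int (fun z => (ind ((hnorm z < 1)%R && (koranyi a z < rho)%R) * (1 - hnorm z) `^ b)%:E) <=
   (C * rho `^ (b + n.+1%:R))%:E)%E.
Proof.
move=> n0 b1; have [C C0 HC] := @boundary_layer R n b 1 b1 ltr01.
exists (C * (2 * 32 ^+ n * V + V)).
  by rewrite mulr_ge0// addr_ge0 ?mulr_ge0 ?exprn_ge0// ltW// V_gt0.
have bn : 0 <= b + n.+1%:R by rewrite -natr1; have := ler0n R n; lra.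
move=> a rho a1 r0.
have mS : Cmeasurable (fun z => (hnorm z < 1) && (koranyi a z < rho)).
  apply: measurable_and; first exact: Cmeasurable_ball.
  by apply: measurable_fun_ltr; [exact: Cmeasurable_koranyi|exact: measurable_cst].
have [r1|r1] := leP rho 1; last first.
  have := HC 1 (fun z => (hnorm z < 1) && (koranyi a z < rho)) (fun z => hnorm z < 1).
  rewrite ltr01 lexx => /(_ isT mS (Cmeasurable_ball 1)) h; apply: le_trans (h _ _) _.
  - by move=> z /andP[z1 _]; split=> //; rewrite mul1r gerBl hnorm_ge0.
  - move=> z t /andP[z1 _]; rewrite subrr => /andP[t0 t1].
    by rewrite (hnorm_realscale _ t0); have := hnorm_ge0 z; nra.
  rewrite Vol_unit_ball VolE_fine powR1 mulr1 -EFinM lee_fin -mulrA ler_wpM2l//.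
  have h1 : 1 <= rho `^ (b + n.+1%:R).
    by rewrite -{1}(powRr0 rho); apply: ler_powR => //; exact: ltW.
  have V0 := V_gt0; have k0 : 0 <= 2 * 32 ^+ n * V.
    by rewrite mulr_ge0 ?mulr_ge0 ?exprn_ge0// ltW.
  nra.
have [ar|ar] := ltP rho (1 - hnorm a).
  rewrite (_ : Int _ = 0%E).
    by rewrite lee_fin mulr_ge0 ?powR_ge0// mulr_ge0// addr_ge0 ?mulr_ge0 ?exprn_ge0// ltW// V_gt0.
  apply: integral0_eq => t _; rewrite /ind.
  case: (boolP (hnorm (toC t) < 1)) => [z1|_]; last by rewrite mul0r.
  rewrite ltNge (le_trans (ltW ar)) ?mul0r// koranyi_ge_r// ltW//.
have := HC rho (fun z => (hnorm z < 1) && (koranyi a z < rho)) (fun z => (hnorm z < 1) && (koranyi a z < 2 * rho)).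
rewrite r0 r1 => /(_ isT mS) h; apply: le_trans (h _ _ _) _.
- apply: measurable_and; first exact: Cmeasurable_ball.
  by apply: measurable_fun_ltr; [exact: Cmeasurable_koranyi|exact: measurable_cst].
- move=> z /andP[z1 zr]; split=> //; rewrite mul1r.
  by apply: le_trans (ltW zr); apply: koranyi_ge_l; exact: ltW.
- move=> z t /andP[z1 zr] /andP[t1 t2].
  have t0 : 0 <= t by lra.
  rewrite (hnorm_realscale _ t0); apply/andP; split; first by have := hnorm_ge0 z; nra.
  apply: (le_lt_trans (koranyi_lip _ z (ltW a1))).
  have -> : t%:C *: z - z = (t - 1)%:C *: z by rewrite rmorphB scalerBl scale1r.
  rewrite hnorm_scale normc_real distrC ger0_norm ?subr_ge0//.
  by have := hnorm_ge0 z; nra.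
have k0 : 0 <= C * rho `^ b by rewrite mulr_ge0 ?powR_ge0.
apply: (@le_trans _ _ ((C * rho `^ b)%:E * (2 * 32 ^+ n * V * rho ^+ n.+1)%:E)%E).
  by apply: lee_wpmul2l; [rewrite lee_fin|exact: Vol_cap_le].
have rn0 : rho != 0 by rewrite gt_eqF.
rewrite -EFinM lee_fin powRD ?rn0 ?implybT// (powR_mulrn n.+1 (ltW r0)).
have := powR_ge0 rho b; have := exprn_ge0 n.+1 (ltW r0); have V0 := V_gt0.
move: (rho `^ b) (rho ^+ n.+1) (2 * 32 ^+ n) => A B D B0 A0.
rewrite (_ : C * A * (D * V * B) = C * (D * V) * (A * B)); last by ring.
apply: ler_wpM2r; first exact: mulr_ge0.
by apply: ler_wpM2l => //; rewrite lerDl ltW.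
Qed.

(** On the dyadic shell where |1 - <z,a>| is about 2^J (1 - |a|) the kernel is
    constant up to a factor and cap_layer bounds the weighted volume; the shells
    contribute a geometric series of ratio 2^(-g). *)
Lemma forelli_rudin (b g : R) : (0 < n)%N -> -1 < b -> 0 < g -> exists2 C : R, 0 <= C &
  forall a, hnorm a < 1 ->
  (Int (fun z => (ind (hnorm z < 1)%R * ((1 - hnorm z) `^ b * koranyi a z `^ (- (g + n.+1%:R + b))))%:E) <=
   (C * (1 - hnorm a) `^ (- g))%:E)%E.
Proof.
move=> n0 b1 g0; have [C C0 HC] := cap_layer n0 b1.
pose x : R := 2 `^ (- g); pose e := b + n.+1%:R.
have e0 : 0 < e by rewrite /e -natr1; have := ler0n R n; lra.
have x0 : 0 < x by exact: powR_gt0.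
have x1 : x < 1.
  have g2 : 1 < 2 `^ g :> R.
    have := @gt0_ltr_powR R g g0 1 2; rewrite powR1.
    by apply; rewrite ?nnegrE ?ler01// ltr1n.
  by rewrite /x powRN invf_lt1// powR_gt0.
pose C2 := C * 2 `^ e.
have C20 : 0 <= C2 by rewrite mulr_ge0 ?powR_ge0.
exists (C2 / (1 - x)); first by rewrite divr_ge0// subr_ge0 ltW.
move=> a a1; set t := 1 - hnorm a.
have t0 : 0 < t by rewrite subr_gt0.
have mX := Cmeasurable_koranyi a.
pose w z : R := (1 - hnorm z) `^ b.
have mw : Cmeasurable w.
  apply: measurable_powR_comp; apply: measurable_funB; first exact: measurable_cst.
  exact: Cmeasurable_hnorm.
have mcap (r : R) : Cmeasurable (fun z => (hnorm z < 1) && (koranyi a z < r)).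
  apply: measurable_and; first exact: Cmeasurable_ball.
  by apply: measurable_fun_ltr; [exact: Cmeasurable_koranyi|exact: measurable_cst].
pose f J z : \bar R := (ind ((hnorm z < 1) && (koranyi a z < 2 ^+ J * t)) *
  (w z * koranyi a z `^ (- (g + n.+1%:R + b))))%:E.
have f0 J z : (0 <= f J z)%E by rewrite lee_fin mulr_ge0 ?ind_ge0// mulr_ge0 ?powR_ge0.
have mf J : Cmeasurable (f J).
  apply/measurable_EFinP; apply: measurable_funM; first by apply: measurable_ind; exact: mcap.
  by apply: measurable_funM => //; exact: measurable_powR_comp.
have key J : (Int (f J) <= (C2 * t `^ (- g) * ((1 - x ^+ J) / (1 - x)))%:E)%E.
  elim: J => [|J IH].
    rewrite expr0 subrr mul0r mulr0 (_ : Int _ = 0%E)//.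
    apply: integral0_eq => s _; rewrite /f expr0 mul1r /ind.
    case: (boolP (hnorm (toC s) < 1)) => [z1|_]; last by rewrite mul0r.
    by rewrite ltNge (koranyi_ge_r _ (ltW z1)) mul0r.
  pose r := 2 ^+ J * t.
  have r0 : 0 < r by rewrite mulr_gt0 ?exprn_gt0.
  have r20 : 0 < 2 * r by rewrite mulr_gt0.
  pose k := r `^ (- (g + e)).
  have k0 : 0 <= k by exact: powR_ge0.
  pose h z : \bar R := (ind ((hnorm z < 1) && (koranyi a z < 2 * r)) * w z)%:E.
  have h0 z : (0 <= h z)%E by rewrite lee_fin mulr_ge0 ?ind_ge0// powR_ge0.
  have mh : Cmeasurable h.
    by apply/measurable_EFinP; apply: measurable_funM => //; apply: measurable_ind; exact: mcap.
  apply: (@le_trans _ _ (Int (f J) + k%:E * Int h)%E).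
    rewrite -(IntZ mh h0 k0) -(IntD (mf J) (f0 J)); last 2 first.
    - by apply: measurable_funeM.
    - by move=> z; rewrite mule_ge0.
    apply: Int_le => // z; rewrite /f /h -EFinM -EFinD lee_fin.
    case: (boolP (hnorm z < 1)) => [z1|_]; last by rewrite /ind !mul0r mulr0 addr0.
    rewrite exprS -mulrA -/r /=.
    have w0 : 0 <= w z by exact: powR_ge0.
    have [Xr|Xr] := ltP (koranyi a z) r.
      have -> : koranyi a z < 2 * r by lra.
      by rewrite lerDl mulr_ge0// mulr_ge0// ind_ge0.
    rewrite /ind mul0r add0r.
    case: (koranyi a z < 2 * r); rewrite ?mul0r ?mulr0// !mul1r mulrC ler_wpM2r//.
    rewrite (_ : g + n.+1%:R + b = g + e); last by rewrite /e; ring.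
    by apply: powR_le_inv => //; lra.
  have H := HC a (2 * r) a1 r20.
  have kE : k * (C * (2 * r) `^ e) = C2 * t `^ (- g) * x ^+ J.
    rewrite /k /C2 (powRM e (ler0n _ 2) (ltW r0)) opprD powRD; last by rewrite (gt_eqF r0) implybT.
    have h1 : r `^ (- e) * r `^ e = 1 by rewrite powRN mulVf// gt_eqF// powR_gt0.
    have h2 : r `^ (- g) = x ^+ J * t `^ (- g).
      rewrite /r (powRM (- g) (exprn_ge0 _ (ler0n _ 2)) (ltW t0)) /x.
      by rewrite -(powR_mulrn J (ler0n _ 2)) -(powR_mulrn J (powR_ge0 2 (- g))) powRAC.
    rewrite h2.
    rewrite (_ : _ * (C * _) = x ^+ J * t `^ (- g) * C * 2 `^ e * (r `^ (- e) * r `^ e)); last by ring.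
    by rewrite h1; ring.
  apply: (@le_trans _ _ ((C2 * t `^ (- g) * ((1 - x ^+ J) / (1 - x)))%:E + k%:E * (C * (2 * r) `^ e)%:E)%E).
    by apply: leeD => //; apply: lee_wpmul2l; rewrite ?lee_fin.
  rewrite -EFinM kE -EFinD lee_fin -mulrDr le_eqVlt; apply/orP; left; apply/eqP.
  congr (_ * _); rewrite exprS; field.
  by rewrite gt_eqF// subr_gt0.
have [J hJ] : exists J : nat, 2 < 2 ^+ J * t.
  have [N hN] : exists N : nat, 2 / t < N%:R.
    by exists (Num.truncn (2 / t)).+1; exact: truncnS_gt.
  exists N; rewrite -ltr_pdivrMr//; apply: (lt_le_trans hN).
  by rewrite -natrX ler_nat ltnW// ltn_expl.
apply: (@le_trans _ _ (Int (f J))).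
  apply: Int_le => z; first by rewrite lee_fin mulr_ge0 ?ind_ge0// mulr_ge0 ?powR_ge0.
  rewrite /f; case: (boolP (hnorm z < 1)) => [z1|_] //=.
  by rewrite (le_lt_trans (koranyi_le2 (ltW a1) (ltW z1)) hJ).
apply: le_trans (key J) _; rewrite lee_fin.
rewrite (_ : C2 / (1 - x) * t `^ (- g) = C2 * t `^ (- g) * (1 / (1 - x))); last by ring.
apply: ler_wpM2l; first by rewrite mulr_ge0 ?powR_ge0.
apply: ler_wpM2r; first by rewrite invr_ge0 subr_ge0 ltW.
by rewrite gerBl exprn_ge0// ltW.
Qed.

End kernel_estimates.

(** * Jensen's inequality *)

Section jensen.
Context {R : realType}.

Lemma young_powR (p h y : R) : 1 <= p -> 0 <= h -> 0 <= y ->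
  p * (h * y `^ (p - 1)) <= h `^ p + (p - 1) * y `^ p.
Proof.
move=> p1 h0 y0; have p0 : 0 < p by lra.
have [->|pn1] := eqVneq p 1.
  by rewrite subrr powRr0 mul0r addr0 mul1r mulr1 powRr1.
have pm : 0 < p - 1 by rewrite subr_gt0 lt_def pn1.
have q0 : 0 < p / (p - 1) by rewrite divr_gt0.
have pq : p^-1 + (p / (p - 1))^-1 = 1 by field; rewrite !gt_eqF.
have := conjugate_powR h0 (powR_ge0 y (p - 1)) p0 q0 pq.
rewrite -powRrM (_ : (p - 1) * (p / (p - 1)) = p); last by field; rewrite gt_eqF.
rewrite -(ler_pM2l p0) => /le_trans; apply.
rewrite le_eqVlt; apply/orP; left; apply/eqP; field.
by rewrite !gt_eqF.
Qed.

(** Integrate young_powR at y = I / K: this is the supporting line of the convex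
    function x^p at the mean value. *)
Lemma jensen_le d (X : measurableType d) (m : {measure set X -> \bar R})
    (h k : X -> R) (p K I : R) : 1 <= p -> 0 < K -> 0 <= I ->
  measurable_fun setT h -> measurable_fun setT k ->
  (forall x, 0 <= h x) -> (forall x, 0 <= k x) ->
  (\int[m]_x (k x)%:E <= K%:E)%E -> (I%:E <= \int[m]_x (h x * k x)%:E)%E ->
  ((I `^ p)%:E <= (K `^ (p - 1))%:E * \int[m]_x (h x `^ p * k x)%:E)%E.
Proof.
move=> p1 K0 I0 mh mk h0 k0 kK Ihk; have p0 : 0 < p by lra.
have Mge0 : (0 <= \int[m]_x (h x `^ p * k x)%:E)%E.
  by apply: integral_ge0 => x _; rewrite lee_fin mulr_ge0 ?powR_ge0.
have [->|In0] := eqVneq I 0.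
  by rewrite powR0 ?gt_eqF// mule_ge0// lee_fin powR_ge0.
have Ip : 0 < I by rewrite lt_def In0.
pose y := I / K; have y0 : 0 < y by rewrite divr_gt0.
pose A := y `^ (p - 1); have A0 : 0 <= A by exact: powR_ge0.
have yp : y `^ p * K = A * I.
  by rewrite -(mulr_powRB1 (ltW y0) p0) -/A /y; field; rewrite gt_eqF.
have mhk : measurable_fun setT (fun x => (h x * k x)%:E).
  by apply/measurable_EFinP; exact: measurable_funM.
have mhp : measurable_fun setT (fun x => (h x `^ p * k x)%:E).
  by apply/measurable_EFinP; apply: measurable_funM => //; exact: measurable_powR_comp.
have mk' : measurable_fun setT (fun x => (k x)%:E) by exact/measurable_EFinP.
have s1 : ((p * A)%:E * I%:E <= \int[m]_x (h x `^ p * k x)%:E + ((p - 1) * y `^ p)%:E * K%:E)%E.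
  apply: (@le_trans _ _ ((p * A)%:E * \int[m]_x (h x * k x)%:E)%E).
    by apply: lee_wpmul2l => //; rewrite lee_fin mulr_ge0// ltW.
  apply: (@le_trans _ _ (\int[m]_x (h x `^ p * k x)%:E + ((p - 1) * y `^ p)%:E * \int[m]_x (k x)%:E)%E); last first.
    by apply: leeD => //; apply: lee_wpmul2l => //; rewrite lee_fin mulr_ge0 ?powR_ge0// subr_ge0.
  rewrite -!ge0_integralZl//; first last.
  - by rewrite lee_fin mulr_ge0// ltW.
  - by move=> x _; rewrite lee_fin mulr_ge0.
  - by rewrite lee_fin mulr_ge0 ?powR_ge0// subr_ge0.
  - by move=> x _; rewrite lee_fin.
  rewrite -ge0_integralD//; first last.
  - exact: measurable_funeM.
  - by move=> x _; rewrite mule_ge0// lee_fin ?mulr_ge0 ?powR_ge0// subr_ge0.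
  - by move=> x _; rewrite lee_fin mulr_ge0 ?powR_ge0.
  apply: integral_monotone => x; first by rewrite mule_ge0// lee_fin ?mulr_ge0// ltW.
  rewrite -!EFinM -EFinD lee_fin.
  have := young_powR p1 (h0 x) (ltW y0); rewrite -/A => H.
  rewrite (_ : p * A * (h x * k x) = p * (h x * A) * k x); last by ring.
  by rewrite -mulrDl; exact: ler_wpM2r.
have s2 : ((A * I)%:E <= \int[m]_x (h x `^ p * k x)%:E)%E.
  move: s1; rewrite -!EFinM -mulrA -(mulrA (p - 1)) yp.
  case: (\int[m]_x _)%E Mge0 => [r||//] _; last by move=> _; exact: leey.
  by rewrite -EFinD !lee_fin => ?; lra.
apply: le_trans (lee_wpmul2l _ s2); last by rewrite lee_fin powR_ge0.
rewrite -EFinM lee_fin mulrA /A -powRM; [|exact: ltW|exact: ltW].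
have -> : K * y = I by rewrite /y; field; rewrite gt_eqF.
by rewrite [leRHS]mulrC (mulr_powRB1 (ltW Ip) p0).
Qed.

End jensen.

(** * Measurability of holomorphic functions *)

Section measurability_on_ball.
Context {R : realType}.
Notation T := (measurableTypeR R).

(** An open set is the union of the cubes with rational centre and radius that
    it contains. *)
Lemma measurable_open_tuple m (U : set (m.-tuple T)) :
  (forall t, U t -> exists2 e : R, 0 < e &
    forall s : m.-tuple T, (forall i, `|(tnth s i : R) - tnth t i| < e) -> U s) ->
  measurable U.
Proof.
move=> Uo.
pose cube (x : {ffun 'I_m -> rat} * nat) : set (m.-tuple T) :=
  [set t | forall i, [set` `](ratr (x.1 i) - x.2.+1%:R^-1 : R), (ratr (x.1 i) + x.2.+1%:R^-1)[] (tnth t i)].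
pose F x := if `[< cube x `<=` U >] then cube x else set0.
have -> : U = \bigcup_x F x.
  apply/seteqP; split => t; last first.
    by move=> [x _]; rewrite /F; case: ifPn => // /asboolP; exact.
  move=> /Uo[e e0 eU].
  have [N hN] : exists N : nat, 2 / e < N%:R.
    by exists (Num.truncn (2 / e)).+1; exact: truncnS_gt.
  have N1 : N.+1%:R^-1 < e / 2.
    rewrite -[ltRHS]invrK ltf_pV2 ?posrE// ?invr_gt0 ?divr_gt0// invf_div.
    by apply: lt_trans hN _; rewrite ltr_nat.
  have rt i : exists q : rat, ratr q \in `](tnth t i : R) - N.+1%:R^-1, (tnth t i : R) + N.+1%:R^-1[.
    by apply: rat_in_itvoo; rewrite ltrD2l gtrN// invr_gt0.
  pose q := [ffun i => xchoose (rt i)].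
  have qP i : `|(tnth t i : R) - ratr (q i)| < N.+1%:R^-1.
    by have := xchooseP (rt i); rewrite in_itv/= ffunE ltr_distlC.
  exists (q, N) => //; rewrite /F ifT.
    by move=> i /=; rewrite in_itv/= -ltr_distl.
  apply/asboolP => s sq; apply: eU => i.
  have := sq i; rewrite /= in_itv/= -ltr_distl => h1.
  apply: (le_lt_trans (ler_distD (ratr (q i)) _ _)).
  by rewrite (splitr e) ltrD// (lt_trans _ N1)// distrC.
apply: countable_bigcupT_measurable; first exact: countableP.
move=> x; rewrite /F; case: ifPn => _; last exact: measurable0.
by apply: (@measurable_tuple_box _ _ _ (fun i => [set` `](ratr (x.1 i) - x.2.+1%:R^-1 : R), (ratr (x.1 i) + x.2.+1%:R^-1)[])) => i; exact: measurable_itv.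
Qed.

Context {n : nat}.
Notation Tn := ((n + n).-tuple (measurableTypeR R)).
Notation toC := (@complex_of_tuple R n).

Lemma hnorm_tuple_lt (t s : Tn) (e : R) : 0 < e ->
  (forall i, `|(tnth s i : R) - tnth t i| < e / (2 * n.+1%:R)) -> hnorm (toC s - toC t) < e.
Proof.
move=> e0 h; apply: (le_lt_trans (hnorm_le_sum _)).
have n1 : 0 < n.+1%:R :> R by rewrite ltr0n.
apply: (@le_lt_trans _ _ (\sum_(k < n) (e / n.+1%:R))); last first.
  rewrite sumr_const card_ord -(mulr_natr (e / n.+1%:R)) mulrAC ltr_pdivrMr// ltr_pM2l//.
  by rewrite ltr_nat.
apply: ler_sum => k _; apply: (le_trans (normc_le _)).
have -> : e / n.+1%:R = e / (2 * n.+1%:R) + e / (2 * n.+1%:R) by field; rewrite nat1r gt_eqF.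
rewrite !mxE !cReD !cImD !cReN !cImN /=.
by apply: lerD; apply: ltW.
Qed.

Lemma Cmeasurable_on_ball (h : Cvec R n -> R) : (forall z, 0 <= h z) ->
  (forall z, hnorm z < 1 -> forall e : R, 0 < e ->
     exists2 d, 0 < d & forall w, hnorm (w - z) < d -> `|h w - h z| < e) ->
  Cmeasurable (fun z => ind (hnorm z < 1) * h z).
Proof.
move=> h0 hc; apply: (measurability _ (RGenOInfty.measurableE R)).
move=> /= _ [_ [a ->]] <-; apply: measurableI => //.
have [a0|a0] := ltP a 0.
  rewrite (_ : _ @^-1` _ = setT)//; apply/seteqP; split => // t _ /=.
  by rewrite in_itv/= andbT (lt_le_trans a0)// mulr_ge0 ?ind_ge0.
apply: measurable_open_tuple => t; rewrite /= in_itv/= andbT.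
case: (boolP (hnorm (toC t) < 1)) => [t1|_]; last by rewrite /ind mul0r ltNge a0.
rewrite /ind mul1r => ta.
have e0 : 0 < h (toC t) - a by rewrite subr_gt0.
have [d d0 hd] := hc _ t1 _ e0.
have t10 : 0 < 1 - hnorm (toC t) by rewrite subr_gt0.
have [r [r0 rd rt]] : exists r, [/\ 0 < r, r <= d & r <= 1 - hnorm (toC t)].
  by exists (Num.min d (1 - hnorm (toC t))); rewrite lt_min d0 t10 !ge_min !lexx orbT.
exists (r / (2 * n.+1%:R)); first by rewrite divr_gt0// mulr_gt0.
move=> s /(hnorm_tuple_lt r0) st; rewrite in_itv/= andbT.
have s1 : hnorm (toC s) < 1.
  by have := hnorm_ge_sub (toC s) (toC t); lra.
rewrite s1 mul1r.
by have := hd _ (lt_le_trans st rd); rewrite ltr_norml => /andP[]; lra.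
Qed.

Lemma Cmeasurable_holo_norm (f : Cvec R n -> R[i]^o) : (forall z, hnorm z < 1 -> differentiable f z) ->
  Cmeasurable (fun z => ind (hnorm z < 1) * normc (f z)).
Proof.
move=> fd; apply: Cmeasurable_on_ball => [z|z z1 e e0]; first exact: normc_ge0.
have [d d0 hd] := hdiff_cont (pdP (fd z z1)) e0.
exists d => // w /hd; apply: le_lt_trans.
have h1 := normcD (f w - f z) (f z); rewrite subrK in h1.
have h2 := normcD (f z - f w) (f w); rewrite subrK (normcB (f z)) in h2.
by rewrite ler_norml; apply/andP; split; lra.
Qed.

End measurability_on_ball.

(** * The sub-mean value property *)

Section submean.
Context {R : realType} {n : nat}.
Notation mu := (@lebesgue_measure R).
Notation T := (measurableTypeR R).
Notation Tn := ((n + n).-tuple (measurableTypeR R)).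
Notation toC := (@complex_of_tuple R n).
Implicit Types (z w a v : Cvec R n).

Lemma cint_norm_le (g : R -> R[i]) : (forall x, 0 <= x <= 1 -> ccont g x) ->
  ((normc (cint 0 1 g))%:E <= 2%:E * \int[mu]_t (ind (0 <= t <= 1) * normc (g t))%:E)%E.
Proof.
move=> gc; have [g1 g2] := ccont_integrable gc.
have key (h : R -> R) : mu.-integrable `[0, 1] (EFin \o h) ->
    (forall t, `|h t| <= normc (g t)) ->
    (`|\int[mu]_(t in `[0%R, 1%R]) h t|%:E <= \int[mu]_t (ind (0 <= t <= 1) * normc (g t))%:E)%E.
  move=> ih hg.
  apply: (@le_trans _ _ (\int[mu]_(t in `[0%R, 1%R]) `|h t|)%:E).
    by rewrite lee_fin; exact: le_normr_Rintegral.
  rewrite /Rintegral fineK; last by apply: integrable_fin_num => //; exact: integrable_norm.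
  rewrite integral_ind; apply: integral_monotone => t; first by rewrite lee_fin mulr_ge0 ?ind_ge0.
  by rewrite lee_fin ler_wpM2l ?ind_ge0.
apply: (@le_trans _ _ (`|complex.Re (cint 0 1 g)|%:E + `|complex.Im (cint 0 1 g)|%:E)%E).
  by rewrite -EFinD lee_fin normc_le.
rewrite (_ : 2%:E = 1 + 1)%E// ge0_muleDl// !mul1e.
by apply: leeD; apply: key => // t; [exact: Re_le_normc|exact: Im_le_normc].
Qed.

Lemma integral_ind01 : (\int[mu]_y (ind (0 <= y <= 1)%R)%:E = 1)%E.
Proof.
have := @integral_ind_cst R 0 1 1 ler01; rewrite subr0 mulr1 => E.
by rewrite -[RHS]E; apply: eq_integral => y _; rewrite mulr1.
Qed.

Lemma integral_unit_ind (K : \bar R) : (0 <= K)%E ->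
  (\int[mu]_y ((ind (0 <= y <= 1)%R)%:E * K) = K)%E.
Proof.
move=> K0; rewrite ge0_integralZr//; last 2 first.
- by apply/measurable_EFinP/measurable_ind; apply: measurable_and; apply: measurable_fun_ler.
- by move=> y _; rewrite lee_fin ind_ge0.
by rewrite integral_ind01 mul1e.
Qed.

Lemma measurable_unitc : cplx_measurable (fun y : T => unitc (y : R)).
Proof.
have m1 : measurable_fun setT (fun y : T => (2 * pi * y : R)).
  by apply: measurable_funM => //; exact: measurable_cst.
split.
  apply: (measurableT_comp (f := (cos : T -> T)) _ m1).
  by apply: continuous_measurable_fun; exact: continuous_cos.
apply: (measurableT_comp (f := (sin : T -> T)) _ m1).
by apply: continuous_measurable_fun; exact: continuous_sin.
Qed.

(** The cutoff makes the function measurable on the whole space: nothing is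
    known of f outside the ball. *)
Definition Fpow (p : R) (f : Cvec R n -> R[i]^o) z : R :=
  (ind (hnorm z < 1) * normc (f z)) `^ p.

Lemma Fpow_ge0 p f z : 0 <= Fpow p f z.
Proof. exact: powR_ge0. Qed.

Lemma FpowE p f z : hnorm z < 1 -> Fpow p f z = normc (f z) `^ p.
Proof. by rewrite /Fpow => ->; rewrite /ind mul1r. Qed.

Lemma Cmeasurable_Fpow p f : (forall z, hnorm z < 1 -> differentiable f z) -> Cmeasurable (Fpow p f).
Proof. by move=> fd; apply: measurable_powR_comp; exact: Cmeasurable_holo_norm. Qed.

(** circle_mean for f on the complex line through w, and Jensen. The mean value
    property on the unit circle needs a larger disc in the ball, hence the bound 2. *)
Lemma submean_circle p f w v : 1 <= p ->
  (forall z, hnorm z < 1 -> differentiable f z) ->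
  (forall c, normc c < 2 -> hnorm (w + c *: v) < 1) ->
  ((Fpow p f w)%:E <=
   (2 `^ p)%:E * \int[mu]_y (ind (0 <= y <= 1) * Fpow p f (w + unitc y *: v))%:E)%E.
Proof.
move=> p1 fd wv; have p0 : 0 < p by lra.
have w1 : hnorm w < 1 by have := wv 0; rewrite normc0 scale0r addr0; apply.
pose g c : R[i] := f (w + c *: v).
have gD c : normc c < 2 -> exists D, cdiff g c D.
  move=> c2; exists (clinear (pd f (w + c *: v)) v).
  by apply: hdiff_line; apply: pdP; apply: fd; exact: wv.
have gh : holo_punctured g 2 by move=> c /andP[_]; exact: gD.
have r12 : 0 < (1 : R) < 2 by rewrite ltr01 ltr1n.
have gM : f w = cint 0 1 (fun y => g (1%:C * unitc y)).
  apply: (circle_mean gh r12) => e e0.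
  have [D gD0] : exists D, cdiff g 0 D by apply: gD; rewrite normc0.
  have [d d0 dP] := cdiff_cont gD0 e0.
  exists d => // z /andP[_ /dP]; rewrite add0r {2}/g scale0r addr0.
  exact.
have gc y : 0 <= y <= 1 -> ccont (fun y => g (1%:C * unitc y)) y.
  by move=> _; exact: ccont_circle gh r12.
have u1 y : hnorm (w + unitc y *: v) < 1 by apply: wv; rewrite normc_unitc ltr1n.
pose h (y : R) := 2 * (ind (hnorm (w + unitc y *: v) < 1) * normc (f (w + unitc y *: v))).
have mh : measurable_fun setT h.
  apply: measurable_funM => //.
  apply: (Cmeasurable_comp (Cmeasurable_holo_norm fd)); apply: vec_measurableD; first exact: vec_measurable_cst.
  by apply: vec_measurable_scale; [exact: measurable_unitc|exact: vec_measurable_cst].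
pose k (y : R) : R := ind (0 <= y <= 1)%R.
have mk : measurable_fun setT k.
  by apply: measurable_ind; apply: measurable_and; apply: measurable_fun_ler.
have h0 y : 0 <= h y by rewrite mulr_ge0// mulr_ge0 ?ind_ge0// normc_ge0.
have k0 y : 0 <= k y by exact: ind_ge0.
have kK : (\int[mu]_y (k y)%:E <= 1%:E)%E.
  by rewrite integral_ind01.
have Ihk : ((normc (f w))%:E <= \int[mu]_y (h y * k y)%:E)%E.
  rewrite gM; apply: le_trans (cint_norm_le gc) _.
  rewrite -ge0_integralZl//; first last.
  - by move=> y _; rewrite lee_fin mulr_ge0 ?ind_ge0 ?normc_ge0.
  - apply/measurable_EFinP; apply: measurable_funM => //.
    rewrite (_ : (fun y => _) = fun y => 2^-1 * h y); first exact: measurable_funM.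
    by apply/funext => y; rewrite /h u1 /g mul1r /ind mul1r mulKf.
  apply: integral_monotone => y.
    by rewrite mule_ge0// lee_fin mulr_ge0 ?ind_ge0 ?normc_ge0.
  rewrite -EFinM lee_fin /h /g mul1r u1 (_ : ind true = 1 :> R)// mul1r.
  by rewrite mulrCA mulrC.
have := @jensen_le R _ T mu h k p 1 _ p1 ltr01 (normc_ge0 _) mh mk h0 k0 kK Ihk.
rewrite powR1 mul1e (FpowE _ _ w1) => /le_trans; apply.
have m2 : measurable_fun setT (fun y : T => (ind (0 <= y <= 1) * Fpow p f (w + unitc y *: v))%:E).
  apply/measurable_EFinP; apply: measurable_funM => //.
  rewrite (_ : (fun y => _) = fun y => (2^-1 * h y) `^ p).
    by apply: measurable_powR_comp; exact: measurable_funM.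
  by apply/funext => y; rewrite /Fpow /h mulKf.
rewrite -ge0_integralZl//; first last.
- by move=> y _; rewrite lee_fin mulr_ge0 ?ind_ge0 ?Fpow_ge0.
apply: integral_monotone => y; first by rewrite lee_fin mulr_ge0 ?powR_ge0.
rewrite -EFinM lee_fin /h powRM//; last by rewrite mulr_ge0 ?ind_ge0 ?normc_ge0.
by rewrite -/(Fpow p f (w + unitc y *: v)) mulrAC mulrA.
Qed.

(** Averaging submean_circle over v in D and exchanging the integrations: D is
    invariant under rotation, so each rotation contributes the same integral. *)
Lemma submean_set p f w (D : Cvec R n -> bool) : 1 <= p ->
  (forall z, hnorm z < 1 -> differentiable f z) -> Cmeasurable D ->
  (forall c v, normc c = 1 -> D (c *: v) = D v) ->
  (forall v c, D v -> normc c < 2 -> hnorm (w + c *: v) < 1) ->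
  ((Fpow p f w)%:E * Vol D <=
   (2 `^ p)%:E * Int (fun v => (ind (D (v - w)) * Fpow p f v)%:E))%E.
Proof.
move=> p1 fd mD Dc Dw.
have mF := Cmeasurable_Fpow p fd.
pose G v (y : R) : \bar R := (ind (D v) * (ind (0 <= y <= 1) * Fpow p f (w + unitc y *: v)))%:E.
have G0 v y : (0 <= G v y)%E by rewrite lee_fin !mulr_ge0 ?ind_ge0 ?Fpow_ge0.
have mG : measurable_fun setT (fun x : Tn * T => G (toC x.1) x.2).
  apply/measurable_EFinP; apply: measurable_funM.
    by apply: measurable_ind; exact: (measurableT_comp mD measurable_fst).
  apply: measurable_funM.
    apply: measurable_ind; apply: measurable_and; apply: measurable_fun_ler => //;
    exact: measurable_snd.
  apply: (Cmeasurable_comp mF); apply: vec_measurableD; first exact: vec_measurable_cst.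
  apply: vec_measurable_scale; last exact: (vec_measurable_comp vec_measurable_id measurable_fst).
  have [c1 c2] := measurable_unitc.
  by split; [exact: (measurableT_comp c1 measurable_snd)|exact: (measurableT_comp c2 measurable_snd)].
pose H v : \bar R := (ind (D v) * Fpow p f (w + v))%:E.
have H0 v : (0 <= H v)%E by rewrite lee_fin mulr_ge0 ?ind_ge0 ?Fpow_ge0.
have mH : Cmeasurable H.
  apply/measurable_EFinP; apply: measurable_funM; first exact: measurable_ind.
  by apply: (Cmeasurable_comp mF); apply: vec_measurableD; [exact: vec_measurable_cst|exact: vec_measurable_id].
have mID : Cmeasurable (fun v => (ind (D v))%:E : \bar R) by exact: Cmeasurable_ind.
apply: (@le_trans _ _ (Int (fun v => (2 `^ p)%:E * \int[mu]_y G v y))%E).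
  rewrite /Vol -IntZ//; last first.
  - exact: Fpow_ge0.
  - by move=> v; rewrite lee_fin ind_ge0.
  apply: Int_le => v; first by rewrite mule_ge0// lee_fin ?Fpow_ge0 ?ind_ge0.
  rewrite /G; case: (boolP (D v)) => [Dv|_]; last first.
    by rewrite mule0 mule_ge0 ?lee_fin ?powR_ge0//; apply: integral_ge0 => y _; rewrite lee_fin mul0r.
  rewrite mule1; apply: le_trans (submean_circle p1 fd (fun c => Dw v c Dv)) _.
  by under [in leRHS]eq_integral do rewrite [ind true]/(1%:R) mul1r.
rewrite IntZ; last 3 first.
- exact: Cmeasurable_IntR mG G0.
- by move=> v; apply: integral_ge0.
- exact: powR_ge0.
apply: lee_wpmul2l; first by rewrite lee_fin powR_ge0.
rewrite (Int_swapR mG G0).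
have HE : Int H = Int (fun v => (ind (D (v - w)) * Fpow p f v)%:E).
  rewrite -(Int_translation (- w) mH H0); apply: eq_integral => t _.
  by rewrite /H addrCA subrr addr0.
rewrite -HE.
apply: (@le_trans _ _ (\int[mu]_y ((ind (0 <= y <= 1)%R)%:E * Int H))%E).
  apply: integral_monotone => y; first exact: Int_ge0.
  rewrite le_eqVlt; apply/orP; left; apply/eqP.
  have u1 := normc_unitc y.
  transitivity ((ind (0 <= y <= 1)%R)%:E * Int (fun v => H (unitc y *: v)))%E; last first.
    by rewrite (Int_rotation u1 mH H0).
  rewrite -IntZ; last 3 first.
  - apply: (Cmeasurable_comp mH); apply: vec_measurable_scale; [exact: cplx_measurable_cst|exact: vec_measurable_id].
  - by move=> v; exact: H0.
  - exact: ind_ge0.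
  by apply: eq_integral => t _; rewrite /G /H (Dc _ _ u1) -EFinM mulrCA.
by rewrite (integral_unit_ind (Int_ge0 H0)).
Qed.

End submean.

(** * Growth of functions of finite norm *)

Section growth.
Context {R : realType} {n : nat}.
Notation mu := (@lebesgue_measure R).
Notation T := (measurableTypeR R).
Notation Tn := ((n + n).-tuple (measurableTypeR R)).
Notation toC := (@complex_of_tuple R n).
Notation V := (fine (@volume_unit_ball R n)).
Implicit Types (z w a v : Cvec R n) (f : Cvec R n -> R[i]^o).

(** Up to constants the density of the norm: 1 - |z| replaces 1 - |z|^2. *)
Definition weight (al sg : R) a z : R :=
  (1 - hnorm z) `^ al * ((1 - hnorm a) `^ sg * koranyi a z `^ (- (2 * sg))).

Lemma weight_ge0 al sg a z : 0 <= weight al sg a z.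
Proof. by rewrite !mulr_ge0 ?powR_ge0. Qed.

Lemma Cmeasurable_dist_powR (e : R) : Cmeasurable (fun z => (1 - hnorm z) `^ e).
Proof.
apply: measurable_powR_comp; apply: measurable_funB; first exact: measurable_cst.
exact: Cmeasurable_hnorm.
Qed.

Lemma Cmeasurable_weight al sg a : Cmeasurable (weight al sg a).
Proof.
apply: measurable_funM; first exact: Cmeasurable_dist_powR.
apply: measurable_funM; first exact: measurable_cst.
by apply: measurable_powR_comp; exact: Cmeasurable_koranyi.
Qed.

Lemma tubeZ zeta (r d : R) v c : hnorm zeta = 1 -> tube zeta r d v -> normc c < 2 ->
  tube zeta (2 * r) (2 * d) (c *: v).
Proof.
move=> u1 /andP[v1 v2] c2; have c0 := normc_ge0 c.
rewrite /tube perpZ (ipZl c v zeta) ComplexField.Normc.normcM exprMn.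
have p0 := normc_ge0 (ip v zeta).
apply/andP; split; last by nra.
have c4 : normc c ^+ 2 <= 2 ^+ 2 by rewrite ler_pXn2r ?nnegrE// ltW.
by apply: (@le_lt_trans _ _ (2 ^+ 2 * perp zeta v));
  [apply: ler_wpM2r => //; exact: perp_ge0|rewrite ltr_pM2l// exprn_gt0].
Qed.

Lemma hnorm_tube_shift (zeta : Cvec R n) (r e : R) (u : Cvec R n) : hnorm zeta = 1 -> 0 <= r ->
  normc (ip u zeta) <= e ->
  sqnorm (r%:C *: zeta + u) <= perp zeta u + (r + e) ^+ 2.
Proof.
move=> u1 r0 ue.
have zz : ip zeta zeta = 1 by rewrite ipzz -hnorm_sqr u1 expr1n.
have e0 : 0 <= e := le_trans (normc_ge0 _) ue.
have -> : sqnorm (r%:C *: zeta + u) = perp zeta (u + r%:C *: zeta) + normc (ip (u + r%:C *: zeta) zeta) ^+ 2.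
  by rewrite /perp subrK addrC.
rewrite (perp_shift u r%:C u1) lerD2l ler_pXn2r ?nnegrE ?normc_ge0 ?addr_ge0//.
rewrite (ipDl u (r%:C *: zeta) zeta) (ipZl r%:C zeta zeta) zz mulr1.
apply: (le_trans (normcD _ _)); rewrite normc_real ger0_norm// addrC lerD2l//.
Qed.

(** With delta = 1 - |w|, the tube has width of order delta along w and
    sqrt delta across w. By Pythagoras a displacement across w only enters
    |w + v| through its square, so the translated tube stays at distance of
    order delta from the sphere. *)
Lemma tube_in_ball (zeta w : Cvec R n) (v : Cvec R n) c : hnorm zeta = 1 -> hnorm w < 1 ->
  w = (hnorm w)%:C *: zeta ->
  tube zeta (Num.sqrt ((1 - hnorm w) / 16)) ((1 - hnorm w) / 8) v -> normc c < 2 ->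
  hnorm (w + c *: v) < 1.
Proof.
move=> u1 w1 wE Dv c2; have /andP[c1 c3] := tubeZ u1 Dv c2.
have t0 : 0 < 1 - hnorm w by rewrite subr_gt0.
have s2 : Num.sqrt ((1 - hnorm w) / 16) ^+ 2 = (1 - hnorm w) / 16 by rewrite sqr_sqrtr// ltW// divr_gt0.
apply/unit_ballP; rewrite /unit_ball /=.
have h := hnorm_tube_shift u1 (hnorm_ge0 w) (ltW c3).
rewrite -wE in h; apply: (le_lt_trans h).
move: c1 (hnorm_ge0 w) w1; rewrite exprMn s2; clear.
move: (perp _ _) (hnorm w) => P h; nra.
Qed.

Lemma tube_comparable (zeta w : Cvec R n) (v : Cvec R n) : hnorm zeta = 1 -> hnorm w < 1 ->
  w = (hnorm w)%:C *: zeta ->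
  tube zeta (Num.sqrt ((1 - hnorm w) / 16)) ((1 - hnorm w) / 8) v ->
  [/\ 1 - hnorm w <= 4 * (1 - hnorm (w + v)), 1 - hnorm (w + v) <= 4 * (1 - hnorm w),
      1 - hnorm w <= 4 * koranyi w (w + v) & koranyi w (w + v) <= 4 * (1 - hnorm w)].
Proof.
move=> u1 w1 wE Dv; have /andP[c1 c2] := Dv.
have w0 := hnorm_ge0 w.
have t0 : 0 < 1 - hnorm w by rewrite subr_gt0.
rewrite sqr_sqrtr in c1; last by rewrite ltW// divr_gt0.
have E : ip w zeta = (hnorm w)%:C.
  by rewrite [w in ip w _]wE (ipZl (hnorm w)%:C zeta zeta) ipzz -hnorm_sqr u1 expr1n mulr1.
have P0 := perp_ge0 v u1.
have h1 := hnorm_tube_shift u1 w0 (ltW c2).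
rewrite -wE -hnorm_sqr in h1.
have h3 : hnorm w - normc (ip v zeta) <= hnorm (w + v).
  have := ip_le (w + v) zeta; rewrite u1 mulr1; apply: le_trans.
  have h := normcD (ip (w + v) zeta) (- ip v zeta).
  by rewrite (ipDl w v zeta) addrK normcN E normc_real ger0_norm// in h; rewrite (ipDl w v zeta) E lerBlDr.
have E' : 1 - ip (w + v) w = (1 - hnorm w ^+ 2)%:C - ip v w.
  by rewrite (ipDl w v w) ipzz hnorm_sqr rmorphB rmorph1; ring.
have p0 := normc_ge0 (ip v zeta).
have hv : normc (ip v w) <= normc (ip v zeta).
  rewrite [in leLHS]wE (ipZr (hnorm w)%:C zeta v) ComplexField.Normc.normcM normc_conj normc_real ger0_norm//.
  by apply: ler_piMl => //; exact: ltW.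
have w2 : 0 <= 1 - hnorm w ^+ 2 by rewrite subr_ge0 expr_le1// ltW.
have x1 : koranyi w (w + v) <= 1 - hnorm w ^+ 2 + normc (ip v zeta).
  by rewrite /koranyi E'; apply: (le_trans (normcD _ _)); rewrite normcN normc_real ger0_norm ?lerD2l.
have x2 : 1 - hnorm w ^+ 2 - normc (ip v zeta) <= koranyi w (w + v).
  rewrite /koranyi E'; have h := normcD ((1 - hnorm w ^+ 2)%:C - ip v w) (ip v w).
  rewrite subrK normc_real ger0_norm// in h.
  by rewrite lerBlDr; apply: (le_trans h); rewrite lerD2l.
have wv0 := hnorm_ge0 (w + v).
move: w0 w1 c1 c2 P0 p0 h1 h3 x1 x2 wv0; clear.
move: (hnorm (w + v)) (hnorm w) (perp _ _) (normc _) (koranyi _ _) => u h P q X.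
move=> h0 h1 P1 q1 P0 q0 u2 u1 X1 X2 u0.
split; [|lra|nra|nra].
rewrite leNgt; apply/negP => c.
(* otherwise |w + v| > 1 - (1 - |w|) / 4, against the bound of its square *)
have : (1 - (1 - h) / 4) ^+ 2 < u ^+ 2.
  by rewrite ltr_pXn2r ?nnegrE//; lra.
nra.
Qed.

(** Take a = w: on the tube of tube_comparable the weight is of order
    (1 - |w|)^(al - sg), the tube has volume of order (1 - |w|)^(n + 1), and
    submean_set compares |f w|^p with the mean over the tube. *)
Lemma growth_estimate (p al sg : R) : (0 < n)%N -> 1 <= p -> 0 < sg ->
  exists2 C : R, 0 <= C & forall f (N : R), 0 <= N ->
  (forall z, hnorm z < 1 -> differentiable f z) ->
  (forall a, hnorm a < 1 -> (Int (fun z => (Fpow p f z * weight al sg a z)%:E) <= N%:E)%E) ->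
  forall w, hnorm w < 1 ->
    normc (f w) `^ p <= C * N * (1 - hnorm w) `^ (- (al - sg + n.+1%:R)).
Proof.
move=> n0 p1 s0; have V0 := @V_gt0 R n.
pose K : R := 4 `^ `|al| * 4 `^ `|- (2 * sg)|.
have K0 : 0 <= K by rewrite mulr_ge0 ?powR_ge0.
exists (2 `^ p * K * (16 ^+ n.+1 / V)).
  by rewrite mulr_ge0// ?divr_ge0 ?exprn_ge0 ?mulr_ge0 ?powR_ge0// ltW.
move=> f N N0 fd HN w w1.
have [zeta u1 wE] := unit_direction w n0.
set t := 1 - hnorm w.
have t0 : 0 < t by rewrite subr_gt0.
have t1 : t <= 1 by rewrite gerBl hnorm_ge0.
have w0 := hnorm_ge0 w.
pose s := Num.sqrt (t / 16); pose d := t / 8.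
have s_gt0 : 0 < s by rewrite sqrtr_gt0 divr_gt0.
have s2 : s ^+ 2 = t / 16 by rewrite sqr_sqrtr// ltW// divr_gt0.
have d0 : 0 < d by rewrite divr_gt0.
pose D := tube zeta s d.
have hw : hnorm w = 1 - t by rewrite /t; ring.
have Dsub v c : D v -> normc c < 2 -> hnorm (w + c *: v) < 1 by exact: tube_in_ball.
have Dc c v : normc c = 1 -> D (c *: v) = D v.
  move=> c1; rewrite /D /tube perpZ (ipZl c v zeta) ComplexField.Normc.normcM.
  by rewrite c1 expr1n !mul1r.
have Dest v : D v -> _ := tube_comparable u1 w1 wE (v := v).
have mD : Cmeasurable D by exact: Cmeasurable_tube.
pose k := t `^ (al - sg).
have k0 : 0 < k by exact: powR_gt0.
have mF := Cmeasurable_Fpow p fd.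
have mDw : Cmeasurable (fun v => D (v - w)).
  by apply: (Cmeasurable_comp mD); apply: vec_measurableD; [exact: vec_measurable_id|exact: vec_measurable_cst].
have mDF : Cmeasurable (fun v => (ind (D (v - w)) * Fpow p f v)%:E : \bar R).
  by apply/measurable_EFinP; apply: measurable_funM => //; exact: measurable_ind.
have mFW : Cmeasurable (fun z => (Fpow p f z * weight al sg w z)%:E : \bar R).
  by apply/measurable_EFinP; apply: measurable_funM => //; exact: Cmeasurable_weight.
have DF0 v : (0 <= (ind (D (v - w)) * Fpow p f v)%:E :> \bar R)%E.
  by rewrite lee_fin mulr_ge0 ?ind_ge0 ?Fpow_ge0.
have step : (k%:E * Int (fun v => (ind (D (v - w)) * Fpow p f v)%:E) <= (K * N)%:E)%E.
  apply: (@le_trans _ _ (K%:E * Int (fun z => (Fpow p f z * weight al sg w z)%:E))%E); last first.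
    by rewrite (EFinM K N); apply: lee_wpmul2l; [rewrite lee_fin|exact: HN].
  rewrite -(IntZ mDF DF0 (ltW k0)) -(IntZ mFW _ K0); last first.
    by move=> z; rewrite lee_fin mulr_ge0 ?Fpow_ge0 ?weight_ge0.
  apply: Int_le => v; first by rewrite mule_ge0// lee_fin ltW.
  rewrite -!EFinM lee_fin.
  case: (boolP (D (v - w))) => [Dv|_]; last first.
    rewrite (_ : ind false = 0 :> R)// mul0r mulr0; apply: mulr_ge0; first exact: K0.
    by apply: mulr_ge0; [exact: Fpow_ge0|exact: weight_ge0].
  rewrite (_ : ind true = 1 :> R)// mul1r mulrC mulrCA; apply: ler_wpM2l; first exact: Fpow_ge0.
  have := Dest _ Dv; rewrite (addrC w) subrK => -[e1 e2 e3 e4].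
  have x0 : 0 < koranyi w v by lra.
  have y0 : 0 < 1 - hnorm v by lra.
  have f1 := powR_comparable al (ler1n R 4) t0 y0 e1 e2.
  have f2 := powR_comparable (- (2 * sg)) (ler1n R 4) t0 x0 e3 e4.
  have -> : k = t `^ al * (t `^ sg * t `^ (- (2 * sg))).
    rewrite -!powRD ?(gt_eqF t0) ?implybT// /k; congr (_ `^ _); ring.
  rewrite /weight /K.
  have A0 := powR_ge0 t al; have B0 := powR_ge0 t (- (2 * sg)); have C0 := powR_ge0 t sg.
  rewrite -/t [leRHS](_ : _ = (4 `^ `|al| * (1 - hnorm v) `^ al) *
     (t `^ sg * (4 `^ `|- (2 * sg)| * koranyi w v `^ (- (2 * sg))))); last by ring.
  by apply: ler_pM => //; [exact: mulr_ge0|apply: ler_wpM2l].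
have sub := submean_set p1 fd mD Dc Dsub.
have vol := tube_volume_ge u1 s_gt0 d0.
have vol2 : (((t / 16) ^+ n.+1 * V)%:E <= Vol D)%E.
  have q0 : 0 < t / 16 by rewrite divr_gt0.
  have E : (d / 2) ^+ 2 * s ^+ (n + n) = (t / 16) * (t / 16) ^+ n.+1.
    by rewrite addnn -muln2 mulnC exprM s2 (_ : d / 2 = t / 16) ?expr2 ?exprS ?mulrA// /d; field.
  rewrite E s2 VolE_fine -EFinM in vol.
  move: (t / 16) q0 vol => q q0; rewrite -mulrA (EFinM q) => vol.
  by rewrite lee_pmul2l in vol.
have F0 := Fpow_ge0 p f w.
have tot : ((k * (Fpow p f w * ((t / 16) ^+ n.+1 * V)))%:E <= (2 `^ p * (K * N))%:E)%E.
  rewrite (EFinM k) (EFinM (Fpow p f w)).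
  apply: (@le_trans _ _ (k%:E * ((2 `^ p)%:E * Int (fun v => (ind (D (v - w)) * Fpow p f v)%:E)))%E).
    apply: lee_wpmul2l; first by rewrite lee_fin ltW.
    apply: le_trans sub; apply: lee_wpmul2l => //; by rewrite lee_fin.
  by rewrite muleCA (EFinM (2 `^ p)); apply: lee_wpmul2l => //; rewrite lee_fin powR_ge0.
rewrite lee_fin in tot.
rewrite -(FpowE p f w1).
have E : t `^ (- (al - sg + n.+1%:R)) * (k * t ^+ n.+1) = 1.
  rewrite -(powR_mulrn n.+1 (ltW t0)) /k -!powRD ?(gt_eqF t0) ?implybT//.
  by rewrite addNr powRr0.
have E2 : k * (Fpow p f w * ((t / 16) ^+ n.+1 * V)) = Fpow p f w * (k * t ^+ n.+1) * (V / 16 ^+ n.+1).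
  by rewrite exprMn exprVn; ring.
rewrite E2 in tot.
have c0 : 0 < V / 16 ^+ n.+1 by rewrite divr_gt0// exprn_gt0.
have kt : 0 < k * t ^+ n.+1 by rewrite mulr_gt0// exprn_gt0.
have -> : t `^ (- (al - sg + n.+1%:R)) = (k * t ^+ n.+1)^-1.
  by apply: (mulIf (lt0r_neq0 kt)); rewrite E mulVf// lt0r_neq0.
rewrite ler_pdivlMr// -(ler_pM2r c0); apply: le_trans tot _.
rewrite le_eqVlt; apply/orP; left; apply/eqP; field.
by rewrite !gt_eqF// exprn_gt0.
Qed.

End growth.

(** * Estimates of the derivatives *)

Section derivative_estimates.
Context {R : realType} {n : nat}.
Notation mu := (@lebesgue_measure R).
Notation T := (measurableTypeR R).
Notation Tn := ((n + n).-tuple (measurableTypeR R)).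
Notation toC := (@complex_of_tuple R n).
Notation V := (fine (@volume_unit_ball R n)).
Implicit Types (z w a v : Cvec R n) (f : Cvec R n -> R[i]^o).

Lemma powRK (p A : R) : 0 < p -> 0 <= A -> (A `^ p^-1) `^ p = A.
Proof. by move=> p0 A0; rewrite -powRrM mulVf ?gt_eqF// powRr1. Qed.

Lemma le_root (p x A : R) : 0 < p -> 0 <= x -> x `^ p <= A -> x <= A `^ p^-1.
Proof.
move=> p0 x0 h.
have A0 : 0 <= A := le_trans (powR_ge0 _ _) h.
have -> : x = (x `^ p) `^ p^-1 by rewrite -powRrM mulfV ?gt_eqF// powRr1.
by apply: ge0_ler_powR => //; rewrite ?nnegrE ?powR_ge0// invr_ge0 ltW.
Qed.

(** Cauchy's estimate on the ball of radius (1 - |w|) / 4 around w, raised to the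
    power p. *)
Lemma cauchy_pow (p A : R) f w k : 0 < p -> hnorm w < 1 -> 0 <= A ->
  (forall z, hnorm z < 1 -> differentiable f z) ->
  (forall z, hnorm (z - w) <= (1 - hnorm w) / 4 -> normc (f z) `^ p <= A) ->
  (1 - hnorm w) `^ p * normc (pd f w k) `^ p <= 16 `^ p * A.
Proof.
move=> p0 w1 A0 fd fA; set t := 1 - hnorm w.
have t0 : 0 < t by rewrite subr_gt0.
have rr : 0 < t / 4 < t / 2 by lra.
have fB z : hnorm (z - w) <= t / 4 -> normc (f z) <= A `^ p^-1.
  by move=> /fA h; apply: le_root => //; exact: normc_ge0.
have fd' z : hnorm (z - w) < t / 2 -> differentiable f z.
  by move=> zw; apply: fd; have := hnorm_ge_sub z w; rewrite /t in t0 zw *; lra.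
have := hdiff_cauchy (delta_mx 0 k) rr fd' fB.
rewrite clinear_delta hnorm_delta mulr1 => h.
rewrite -powRM ?normc_ge0 ?(ltW t0)//.
have h2 : t * normc (pd f w k) <= 16 * A `^ p^-1.
  have -> : 16 * A `^ p^-1 = t * (4 * A `^ p^-1 / (t / 4)) by field; rewrite gt_eqF.
  by apply: ler_wpM2l => //; exact: ltW.
apply: (@le_trans _ _ ((16 * A `^ p^-1) `^ p)).
  apply: ge0_ler_powR => //; first exact: ltW.
    by rewrite nnegrE mulr_ge0 ?normc_ge0// ltW.
  by rewrite nnegrE mulr_ge0 ?powR_ge0.
by rewrite powRM ?powR_ge0// powRK.
Qed.

Lemma derivative_growth (p q : R) : 1 <= p -> exists2 C : R, 0 <= C &
  forall f (M : R), 0 <= M -> (forall z, hnorm z < 1 -> differentiable f z) ->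
  (forall w, hnorm w < 1 -> normc (f w) `^ p <= M * (1 - hnorm w) `^ (- q)) ->
  forall k w, hnorm w < 1 ->
    (1 - hnorm w) `^ p * normc (pd f w k) `^ p <= C * M * (1 - hnorm w) `^ (- q).
Proof.
move=> p1; exists (16 `^ p * 2 `^ `|- q|); first by rewrite mulr_ge0 ?powR_ge0.
move=> f M M0 fd fM k w w1; set t := 1 - hnorm w.
have t0 : 0 < t by rewrite subr_gt0.
rewrite (_ : _ * M * _ = 16 `^ p * (M * (2 `^ `|- q| * t `^ (- q)))); last by ring.
apply: cauchy_pow => //; first by lra.
  by rewrite mulr_ge0// mulr_ge0 ?powR_ge0.
move=> z zw.
have h1 := hnorm_ge_sub z w; have h2 := hnorm_ge_sub w z; rewrite hnorm_subC in h2.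
have h3 : 1 - hnorm z <= 2 * t by rewrite /t in zw *; lra.
have h4 : t <= 2 * (1 - hnorm z) by rewrite /t in zw *; lra.
have z0 : 0 < 1 - hnorm z by lra.
apply: le_trans (fM z _) _; first by lra.
apply: ler_wpM2l => //; apply: powR_comparable => //; by lra.
Qed.

(** Cauchy's estimate needs a bound of |f| on a ball; submean_set gives it in terms
    of the integral over a larger ball. *)
Lemma derivative_local (p : R) : 1 <= p -> exists2 C : R, 0 <= C &
  forall f, (forall z, hnorm z < 1 -> differentiable f z) ->
  forall k w, hnorm w < 1 ->
    (((1 - hnorm w) `^ p * normc (pd f w k) `^ p)%:E <=
     (C * (1 - hnorm w) ^- (n + n))%:E *
     Int (fun v => (ind (hnorm (v - w) < (1 - hnorm w) / 2) * Fpow p f v)%:E))%E.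
Proof.
move=> p1; have V0 := @V_gt0 R n; have p0 : 0 < p by lra.
exists (16 `^ p * (2 `^ p * (8 ^+ (n + n) / V) + 1)).
  rewrite mulr_ge0 ?powR_ge0// addr_ge0// mulr_ge0 ?powR_ge0// divr_ge0 ?exprn_ge0//.
  exact: ltW.
move=> f fd k w w1; set t := 1 - hnorm w.
have t0 : 0 < t by rewrite subr_gt0.
have mF := Cmeasurable_Fpow p fd.
pose h (r : R) u v : \bar R := (ind (hnorm (v - u) < r) * Fpow p f v)%:E.
have h0 r u v : (0 <= h r u v)%E by rewrite lee_fin mulr_ge0 ?ind_ge0 ?Fpow_ge0.
have Ige0 := Int_ge0 (h0 (t / 2) w).
rewrite -/(h (t / 2) w).
have c0 : 0 < 16 `^ p * (2 `^ p * (8 ^+ (n + n) / V) + 1) * t ^- (n + n).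
  rewrite mulr_gt0 ?invr_gt0 ?exprn_gt0// mulr_gt0 ?powR_gt0// ltr_wpDl//.
  by rewrite mulr_ge0 ?powR_ge0// divr_ge0 ?exprn_ge0// ltW.
case E : (Int (h (t / 2) w)) Ige0 => [M||//]; last first.
  by rewrite gt0_muley ?leey// lte_fin.
rewrite lee_fin => M0; rewrite -EFinM lee_fin.
apply: (@le_trans _ _ (16 `^ p * (2 `^ p * (8 ^+ (n + n) / V) * t ^- (n + n) * M))); last first.
  have := powR_ge0 16 p; have : 0 <= t ^- (n + n) by rewrite invr_ge0 exprn_ge0// ltW.
  move: (16 `^ p) (t ^- _) (2 `^ p * _) => A B D B0 A0.
  by rewrite -!mulrA ler_wpM2l// mulrDl mul1r lerDl mulr_ge0.
apply: cauchy_pow => //.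
  rewrite mulr_ge0// mulr_ge0 ?invr_ge0 ?exprn_ge0 ?(ltW t0)//.
  by rewrite mulr_ge0 ?powR_ge0// divr_ge0 ?exprn_ge0// ltW.
move=> z zw.
have h1 := hnorm_ge_sub z w.
have z1 : hnorm z < 1 by rewrite /t in t0 zw; lra.
have r0 : 0 < t / 8 by rewrite divr_gt0.
have sub := @submean_set R n p f z (fun v => hnorm v < t / 8) p1 fd (Cmeasurable_ball _).
have : ((Fpow p f z)%:E * Vol (fun v => (hnorm v < t / 8)%R) <= (2 `^ p)%:E * M%:E)%E.
  apply: le_trans (sub _ _) _.
  - by move=> c v c1; rewrite hnorm_scale c1 mul1r.
  - move=> v c vt c2; apply: (le_lt_trans (hnorm_add _ _)); rewrite hnorm_scale.
    have := normc_ge0 c; have := hnorm_ge0 v; rewrite /t in t0 zw vt *.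
    move=> v0 c0'; have : normc c * hnorm v <= 2 * hnorm v by apply: ler_wpM2r => //; exact: ltW.
    lra.
  - apply: lee_wpmul2l; first by rewrite lee_fin powR_ge0.
    rewrite -E; apply: Int_le => v; first exact: h0.
    rewrite lee_fin; apply: ler_wpM2r; first exact: Fpow_ge0.
    rewrite /ind; case: (boolP (hnorm (v - z) < t / 8)) => [vz|_]; last exact: ler0n.
    rewrite (_ : hnorm (v - w) < t / 2)//.
    have -> : v - w = (v - z) + (z - w) by rewrite addrA subrK.
    rewrite -/t in zw; apply: (le_lt_trans (hnorm_add _ _)); lra.
rewrite (@Vol_ball R n _ r0) VolE_fine -!EFinM lee_fin (FpowE p f z1).
have vt : 0 < (t / 8) ^+ (n + n) * V by rewrite mulr_gt0// exprn_gt0.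
rewrite -ler_pdivlMr// => /le_trans; apply.
rewrite le_eqVlt; apply/orP; left; apply/eqP.
rewrite exprMn exprVn; field.
by rewrite !gt_eqF// exprn_gt0.
Qed.

End derivative_estimates.

(** * Averages along rays *)

Section ray_estimates.
Context {R : realType} {n : nat}.
Notation mu := (@lebesgue_measure R).
Notation T := (measurableTypeR R).
Notation Tn := ((n + n).-tuple (measurableTypeR R)).
Notation toC := (@complex_of_tuple R n).
Implicit Types (z w a v : Cvec R n) (f : Cvec R n -> R[i]^o).

(** The p-th power of (1 - |w|) |d_k f w|, the derivative at its natural scale;
    it satisfies the same estimates as |f w|^p. *)
Definition Dpow (p : R) f k w : R :=
  (1 - hnorm w) `^ p * Fpow p (fun w => pd f w k) w.

Lemma Dpow_ge0 p f k w : 0 <= Dpow p f k w.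
Proof. by rewrite mulr_ge0 ?powR_ge0. Qed.

Lemma dist_ray z (t : R) : hnorm z < 1 -> 0 <= t <= 1 ->
  [/\ 0 < 1 - hnorm (t%:C *: z), 1 - hnorm z <= 1 - hnorm (t%:C *: z) &
      1 - t <= 1 - hnorm (t%:C *: z)].
Proof.
move=> z1 /andP[t0 t1]; rewrite (hnorm_realscale _ t0); have := hnorm_ge0 z.
by split; nra.
Qed.

(** Jensen for the kernel (1 - |t z|)^(- 1 - eta / p), whose integral along the ray
    is of order (1 - |z|)^(- eta / p). The factors (1 - |t z|) in Dpow and in the
    kernel leave the exponent eta - 1. *)
Lemma ray_jensen (p eta : R) : 1 <= p -> 0 < eta -> exists2 C : R, 0 <= C &
  forall f k z, holo f -> hnorm z < 1 ->
  ((normc (ray_average (fun w => pd f w k : R[i]^o) z) `^ p)%:E <=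
   (C * (1 - hnorm z) `^ (- eta))%:E *
   \int[mu]_t (ind (0 <= t <= 1) * ((1 - hnorm (t%:C *: z)) `^ (eta - 1) * Dpow p f k (t%:C *: z)))%:E)%E.
Proof.
move=> p1 eta0; have p0 : 0 < p by lra.
pose g := eta / p; have g0 : 0 < g by rewrite divr_gt0.
pose K0 : R := 2 `^ (1 + g) / g.
have K00 : 0 < K0 by rewrite divr_gt0// powR_gt0.
exists (K0 `^ (p - 1) * 2 `^ p); first by rewrite mulr_ge0 ?powR_ge0.
move=> f k z fh z1; set d := 1 - hnorm z.
have d0 : 0 < d by rewrite subr_gt0.
have Fh := holo_pd k fh; have [Fd _] := Fh.
pose dt (t : R) : R := 1 - hnorm (t%:C *: z).
have mtz : vec_measurable (fun t : T => (t : R)%:C *: z).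
  apply: vec_measurable_scale; last exact: vec_measurable_cst.
  by apply: cplx_measurable_real; exact: measurable_id.
have mdt e : measurable_fun setT (fun t : T => dt t `^ e).
  by exact: (Cmeasurable_comp (Cmeasurable_dist_powR e) mtz).
pose i01 (t : R) : R := ind (0 <= t <= 1)%R.
have mi : measurable_fun setT (i01 : T -> R).
  by apply: measurable_ind; apply: measurable_and; apply: measurable_fun_ler.
pose F (t : R) : R := ind (hnorm (t%:C *: z) < 1) * normc (pd f (t%:C *: z) k).
have mF : measurable_fun setT (F : T -> R) by exact: (Cmeasurable_comp (Cmeasurable_holo_norm Fd) mtz).
pose h (t : R) : R := 2 * F t * dt t `^ (1 + g).
pose kk (t : R) : R := i01 t * dt t `^ (- 1 - g).
have F0 t : 0 <= F t by rewrite mulr_ge0 ?ind_ge0 ?normc_ge0.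
have h0 t : 0 <= h t by rewrite mulr_ge0 ?powR_ge0// mulr_ge0.
have k0 t : 0 <= kk t by rewrite mulr_ge0 ?powR_ge0// ind_ge0.
have mh : measurable_fun setT (h : T -> R).
  by apply: measurable_funM => //; apply: measurable_funM.
have mk : measurable_fun setT (kk : T -> R) by apply: measurable_funM.
have i01P t : (0 <= t <= 1 /\ i01 t = 1) \/ i01 t = 0.
  by rewrite /i01 /ind; case: (boolP (0 <= t <= 1)) => ?; [left|right].
have FE t : 0 <= t <= 1 -> F t = normc (pd f (t%:C *: z) k).
  move=> t01; have [c1 _ _] := dist_ray z1 t01.
  by rewrite /F (_ : hnorm _ < 1) /ind ?mul1r// -subr_gt0.
have Kp : 0 < K0 * d `^ (- g) by rewrite mulr_gt0// powR_gt0.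
have kK : (\int[mu]_t (kk t)%:E <= (K0 * d `^ (- g))%:E)%E.
  apply: le_trans (ray_kernel_le g0 d0).
  apply: integral_monotone => t; first by rewrite lee_fin.
  rewrite lee_fin /kk -/(i01 t); have [[t01 ->]|->] := i01P t; last by rewrite !mul0r.
  rewrite !mul1r; have [c1 c2 c3] := dist_ray z1 t01.
  apply: powR_le_inv; first by rewrite lt_max d0 orbT.
    by rewrite ge_max c3 c2.
  by lra.
have Ihk : ((normc (ray_average (fun w => pd f w k : R[i]^o) z))%:E <= \int[mu]_t (h t * kk t)%:E)%E.
  apply: (le_trans (cint_norm_le (fun t => @holo_ccont R n _ z t Fh z1))).
  rewrite -ge0_integralZl//; first last.
  - by move=> t _; rewrite lee_fin mulr_ge0 ?ind_ge0 ?normc_ge0.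
  - apply/measurable_EFinP.
    rewrite (_ : (fun t => _) = fun t => i01 t * F t); first exact: measurable_funM.
    apply/funext => t; rewrite -/(i01 t).
    by have [[t01 ->]|->] := i01P t; rewrite ?mul0r// FE.
  apply: integral_monotone => t.
    by rewrite mule_ge0// lee_fin mulr_ge0 ?ind_ge0 ?normc_ge0.
  rewrite -EFinM lee_fin /h /kk -/(i01 t).
  have [[t01 ->]|->] := i01P t; last by rewrite !mul0r !mulr0.
  have [c1 c2 c3] := dist_ray z1 t01; rewrite FE// !mul1r -/(dt t) in c1 *.
  rewrite -mulrA -powRD; last by rewrite (gt_eqF c1) implybT.
  by rewrite (_ : 1 + g + (- 1 - g) = 0) ?powRr0 ?mulr1//; ring.
have := @jensen_le R _ T mu h kk p _ _ p1 Kp (normc_ge0 _) mh mk h0 k0 kK Ihk.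
move=> /le_trans; apply.
have E1 : (K0 * d `^ (- g)) `^ (p - 1) = K0 `^ (p - 1) * d `^ (- (g * (p - 1))).
  by rewrite powRM ?powR_ge0 ?(ltW K00)// -powRrM mulNr.
have gp : g * p = eta by rewrite /g mulfVK// gt_eqF.
have DE t : i01 t * (dt t `^ (eta - 1) * Dpow p f k (t%:C *: z)) =
    i01 t * (dt t `^ (eta - 1) * (dt t `^ p * F t `^ p)).
  by [].
have mJ : measurable_fun setT (fun t : T => (i01 t * (dt t `^ (eta - 1) * Dpow p f k (t%:C *: z)))%:E).
  apply/measurable_EFinP; under eq_fun do rewrite DE.
  apply: measurable_funM => //; apply: measurable_funM => //.
  by apply: measurable_funM => //; exact: measurable_powR_comp.
have c0 : 0 <= 2 `^ p * d `^ (- g) by rewrite mulr_ge0 ?powR_ge0.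
have step : (\int[mu]_t (h t `^ p * kk t)%:E <= (2 `^ p * d `^ (- g))%:E *
    \int[mu]_t (i01 t * (dt t `^ (eta - 1) * Dpow p f k (t%:C *: z)))%:E)%E.
  rewrite -ge0_integralZl//; last first.
    by move=> t _; rewrite lee_fin mulr_ge0 ?ind_ge0// mulr_ge0 ?powR_ge0 ?Dpow_ge0.
  apply: integral_monotone => t; first by rewrite lee_fin mulr_ge0 ?powR_ge0.
  rewrite -EFinM lee_fin DE /kk.
  have [[t01 ->]|->] := i01P t; last by rewrite !mul0r !mulr0.
  have [c1 c2 c3] := dist_ray z1 t01; rewrite -/(dt t) in c1 c2 c3.
  rewrite !mul1r /h powRM ?powR_ge0//; last by rewrite mulr_ge0.
  rewrite powRM// -powRrM.
  have E2 : dt t `^ ((1 + g) * p) * dt t `^ (- 1 - g) = dt t `^ (eta - 1) * dt t `^ p * dt t `^ (- g).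
    rewrite -!powRD ?(gt_eqF c1) ?implybT//; congr (_ `^ _).
    by rewrite mulrDl mul1r gp; ring.
  rewrite -mulrA E2.
  have := powR_le_inv d0 c2 _; move=> /(_ (- g)); rewrite oppr_le0 => /(_ (ltW g0)).
  have A0 := powR_ge0 (dt t) (eta - 1); have B0 := powR_ge0 (dt t) p.
  have C0 := powR_ge0 (F t) p; have D0 := powR_ge0 2 p.
  move: (dt t `^ (eta - 1)) (dt t `^ p) (F t `^ p) (2 `^ p) (dt t `^ (- g)) (d `^ (- g)) A0 B0 C0 D0.
  move=> A B C D X Y A0 B0 C0 D0 XY.
  rewrite (_ : D * C * (A * B * X) = D * (A * (B * C)) * X); last by ring.
  rewrite (_ : D * Y * (A * (B * C)) = D * (A * (B * C)) * Y); last by ring.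
  by apply: ler_wpM2l => //; rewrite !mulr_ge0.
apply: (@le_trans _ _ ((K0 `^ (p - 1) * d `^ (- (g * (p - 1))))%:E *
  ((2 `^ p * d `^ (- g))%:E *
    \int[mu]_t (i01 t * (dt t `^ (eta - 1) * Dpow p f k (t%:C *: z)))%:E))%E).
  by rewrite E1; apply: lee_wpmul2l => //; rewrite lee_fin mulr_ge0 ?powR_ge0.
rewrite muleA -EFinM (_ : _ * (2 `^ p * _) = K0 `^ (p - 1) * 2 `^ p * d `^ (- eta))//.
rewrite -mulrA (mulrCA _ (2 `^ p)) -powRD; last by rewrite (gt_eqF d0) implybT.
rewrite mulrA; congr (_ * _ `^ _); rewrite -gp; ring.
Qed.

End ray_estimates.

(** * Integration of the ray averages against the weight *)

Section norm_estimate.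
Context {R : realType} {n : nat}.
Notation mu := (@lebesgue_measure R).
Notation T := (measurableTypeR R).
Notation Tn := ((n + n).-tuple (measurableTypeR R)).
Notation toC := (@complex_of_tuple R n).
Implicit Types (z w a v : Cvec R n) (f : Cvec R n -> R[i]^o).

(** When |v - t z| < (1 - |t z|) / 2 and t z is closer to the sphere than
    |1 - <z,a>|, |1 - <v,a>| is at most a multiple of |1 - <z,a>|, so the
    weight at z is bounded by that at v, up to powers of the distance to the sphere. *)
Lemma near_kernel (al sg eta e : R) : 0 < sg -> exists2 K : R, 0 <= K &
  forall a z v (t : R), hnorm a < 1 -> hnorm z < 1 -> 0 <= t <= 1 ->
  1 - hnorm (t%:C *: z) < koranyi a z ->
  hnorm (v - t%:C *: z) < (1 - hnorm (t%:C *: z)) / 2 ->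
  [/\ hnorm v < 1, (1 - hnorm z) `^ (- eta) * weight al sg a z * (1 - hnorm (t%:C *: z)) `^ e <=
     K * (weight al sg a v * (1 - hnorm v) `^ (e - al) * (1 - hnorm z) `^ (al - eta)),
     1 - 2 * (1 - hnorm v) <= t & hnorm (z - v) <= 3 * (1 - hnorm v)].
Proof.
move=> s0; exists (2 `^ `|e| * (2 / 5) `^ (- (2 * sg))); first by rewrite mulr_ge0 ?powR_ge0.
move=> a z v t a1 z1 t01; have [] := dist_ray z1 t01.
set w := t%:C *: z; set dt := 1 - hnorm w => d0 d1 d2 dX vw.
have h1 := hnorm_ge_sub v w; have h2 := hnorm_ge_sub w v; rewrite hnorm_subC in h2.
have v1 : hnorm v < 1 by rewrite /dt in d0 d1 d2 vw; lra.
set dv := 1 - hnorm v.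
have e1 : dt <= 2 * dv by rewrite /dv /dt in d0 d1 d2 vw *; lra.
have e2 : dv <= 2 * dt by rewrite /dv /dt in d0 d1 d2 vw *; lra.
have dv0 : 0 < dv by lra.
have zv : hnorm (z - v) <= 3 / 2 * dt.
  have -> : z - v = (1 - t)%:C *: z + (w - v).
    by rewrite rmorphB rmorph1 scalerBl scale1r addrA subrK.
  apply: (le_trans (hnorm_add _ _)); rewrite (hnorm_subC w v).
  have /andP[t0 t1] := t01.
  rewrite hnorm_realscale ?subr_ge0//.
  have : (1 - t) * hnorm z <= 1 - t by apply: ler_piMr; rewrite ?subr_ge0// ltW.
  lra.
split=> //; [|lra|lra].
have x0 : 0 < koranyi a z by lra.
have Xv : 2 / 5 * koranyi a v <= koranyi a z.
  by have := koranyi_lip v z (ltW a1); rewrite hnorm_subC; lra.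
have Xv0 : 0 < koranyi a v by have := koranyi_ge_l v (ltW a1); rewrite -/dv; lra.
have f1 := powR_comparable e (ler1n R 2) d0 dv0 e1 e2.
have c25 : 0 < 2 / 5 * koranyi a v by rewrite mulr_gt0.
have f2 : koranyi a z `^ (- (2 * sg)) <= (2 / 5) `^ (- (2 * sg)) * koranyi a v `^ (- (2 * sg)).
  rewrite -powRM ?divr_ge0// ?(ltW Xv0)//; apply: powR_le_inv => //.
  by rewrite oppr_le0 mulr_ge0// ltW.
have z0 : 0 < 1 - hnorm z by rewrite subr_gt0.
have E1 : (1 - hnorm z) `^ (al - eta) = (1 - hnorm z) `^ (- eta) * (1 - hnorm z) `^ al.
  by rewrite -powRD ?(gt_eqF z0) ?implybT// (addrC al).
have E2 : dv `^ al * dv `^ (e - al) = dv `^ e.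
  by rewrite -powRD ?(gt_eqF dv0) ?implybT// addrC subrK.
rewrite /weight -/dv E1.
have A0 := powR_ge0 (1 - hnorm z) (- eta); have B0 := powR_ge0 (1 - hnorm z) al.
have C0 := powR_ge0 (1 - hnorm a) sg; have D0 := powR_ge0 (koranyi a z) (- (2 * sg)).
have E0 := powR_ge0 dt e.
move: ((1 - hnorm z) `^ (- eta)) ((1 - hnorm z) `^ al) ((1 - hnorm a) `^ sg) A0 B0 C0 => A B C A0 B0 C0.
rewrite (_ : A * (B * (C * _)) * _ = (A * B * C) * (koranyi a z `^ (- (2 * sg)) * dt `^ e)); last by ring.
rewrite [leRHS](_ : _ = (A * B * C) * (((2 / 5) `^ (- (2 * sg)) * koranyi a v `^ (- (2 * sg))) *
  (2 `^ `|e| * (dv `^ al * dv `^ (e - al))))); last by ring.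
rewrite E2; apply: ler_wpM2l; first by rewrite !mulr_ge0.
by apply: ler_pM.
Qed.

Section measurable_pieces.
Context (p : R) (f : Cvec R n -> R[i]^o) (k : 'I_n) (fh : holo f).

Lemma Cmeasurable_Dpow : Cmeasurable (Dpow p f k).
Proof.
apply: measurable_funM; first exact: Cmeasurable_dist_powR.
by apply: Cmeasurable_Fpow; have [] := holo_pd k fh.
Qed.

(** The integrand of ray_jensen, cut where the distance of t z to the sphere
    passes |1 - <z,a>|: b = true is the part closer to the sphere, b = false the
    part closer to the origin. *)
Definition ray_part (b : bool) (eta : R) a z (t : R) : R :=
  ind (0 <= t <= 1) * (ind ((1 - hnorm (t%:C *: z) < koranyi a z) == b) *
  ((1 - hnorm (t%:C *: z)) `^ (eta - 1) * Dpow p f k (t%:C *: z))).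

Lemma ray_part_ge0 b eta a z t : 0 <= ray_part b eta a z t.
Proof. by rewrite !mulr_ge0 ?ind_ge0 ?powR_ge0. Qed.

Lemma vec_measurable_ray : vec_measurable (fun x : Tn * T => (x.2 : R)%:C *: toC x.1).
Proof.
apply: vec_measurable_scale; first by apply: cplx_measurable_real; exact: measurable_snd.
exact: (vec_measurable_comp vec_measurable_id measurable_fst).
Qed.

Lemma measurable_eqb d (X : measurableType d) (c : X -> bool) (b : bool) :
  measurable_fun setT c -> measurable_fun setT (fun x => c x == b).
Proof.
move=> mc; case: b; first by under eq_fun do rewrite eqb_id.
by under eq_fun do rewrite eqbF_neg; exact: measurable_neg.
Qed.

Lemma measurable_ray_part b eta a :
  measurable_fun setT (fun x : Tn * T => ray_part b eta a (toC x.1) x.2).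
Proof.
apply: measurable_funM.
  apply: measurable_ind; apply: measurable_and; apply: measurable_fun_ler => //;
    exact: measurable_snd.
apply: measurable_funM.
  apply: measurable_ind; apply: measurable_eqb; apply: measurable_fun_ltr.
    by apply: measurable_funB => //; exact: (vec_measurable_hnorm vec_measurable_ray).
  exact: (Cmeasurable_comp (Cmeasurable_koranyi a) (vec_measurable_comp vec_measurable_id measurable_fst)).
apply: measurable_funM.
  exact: (Cmeasurable_comp (Cmeasurable_dist_powR (eta - 1)) vec_measurable_ray).
exact: (Cmeasurable_comp Cmeasurable_Dpow vec_measurable_ray).
Qed.

Lemma measurable_ray_part_t b eta a z :
  measurable_fun setT (fun t : T => ray_part b eta a z t).
Proof.
have := measurableT_comp (measurable_ray_part b eta a) (measurable_pair1 (tuple_of_complex z)).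
set u := _ \o _; have -> : (fun t : T => ray_part b eta a z t) = u.
  by apply/funext => t; rewrite /u /= tuple_of_complexK.
exact.
Qed.

End measurable_pieces.

Lemma Fpow_out p f z : 0 < p -> ~~ (hnorm z < 1) -> Fpow p f z = 0.
Proof. by move=> p0 /negbTE z1; rewrite /Fpow z1 /ind mul0r powR0// gt_eqF. Qed.

Definition ray_weight (al sg eta : R) a z : R :=
  ind (hnorm z < 1) * ((1 - hnorm z) `^ (- eta) * weight al sg a z).

Lemma ray_weight_ge0 al sg eta a z : 0 <= ray_weight al sg eta a z.
Proof. by rewrite mulr_ge0 ?ind_ge0// mulr_ge0 ?powR_ge0 ?weight_ge0. Qed.

(** Bound the derivative by its growth. Integrating along the part of the ray where
    1 - |t z| >= |1 - <z,a>| leaves a negative power of |1 - <z,a>|, and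
    forelli_rudin integrates the result over z; its exponent sg cancels the factor
    (1 - |a|)^sg of the weight. *)
Lemma far_estimate (p al sg eta : R) : (0 < n)%N -> 0 < sg -> 0 < eta ->
  -1 < al - eta -> eta < al - sg + n.+1%:R -> exists2 C : R, 0 <= C &
  forall f k (M : R) a, 0 <= M -> hnorm a < 1 ->
  (forall w, hnorm w < 1 -> Dpow p f k w <= M * (1 - hnorm w) `^ (- (al - sg + n.+1%:R))) ->
  (Int (fun z => (ray_weight al sg eta a z)%:E *
     \int[mu]_t (ray_part p f k false eta a z t)%:E) <= (C * M)%:E)%E.
Proof.
move=> n0 s0 eta0 b1; set q := al - sg + n.+1%:R => etaq.
have [C C0 HC] := forelli_rudin n0 b1 s0.
have g0 : 0 < q - eta by rewrite subr_gt0.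
pose C1 : R := 2 `^ (1 + (q - eta)) / (q - eta).
have C10 : 0 <= C1 by rewrite divr_ge0 ?powR_ge0// ltW.
exists (C1 * C); first exact: mulr_ge0.
move=> f k M a M0 a1 HM.
have t0 : 0 < 1 - hnorm a by rewrite subr_gt0.
have ray z : hnorm z < 1 -> (\int[mu]_t (ray_part p f k false eta a z t)%:E <=
    (M * (C1 * koranyi a z `^ (- (q - eta))))%:E)%E.
  move=> z1.
  have X0 : 0 < koranyi a z by have := koranyi_ge_l z (ltW a1); lra.
  apply: (@le_trans _ _ (M%:E * \int[mu]_t (ind (0 <= t <= 1)%R * (Num.max (1 - t) (koranyi a z)) `^ (- 1 - (q - eta)))%:E)%E); last first.
    by rewrite (EFinM M); apply: lee_wpmul2l; [rewrite lee_fin|exact: ray_kernel_le].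
  rewrite -ge0_integralZl//; first last.
  - by move=> t _; rewrite lee_fin mulr_ge0 ?ind_ge0 ?powR_ge0.
  - apply/measurable_EFinP; apply: measurable_funM.
      by apply: measurable_ind; apply: measurable_and; apply: measurable_fun_ler.
    by apply: measurable_powR_comp; apply: measurable_maxr => //; exact: measurable_funB.
  apply: integral_monotone => t; first by rewrite lee_fin ray_part_ge0.
  rewrite -EFinM lee_fin /ray_part.
  case: (boolP (0 <= t <= 1)) => [t01|_]; last by rewrite (_ : ind false = 0 :> R)// !mul0r mulr0.
  rewrite (_ : ind true = 1 :> R)// !mul1r.
  have [c1 c2 c3] := dist_ray z1 t01.
  case: ltP => [_|Xt]; first by rewrite (_ : ind (true == false) = 0 :> R)// mul0r mulr_ge0 ?powR_ge0.
  rewrite (_ : ind (false == false) = 1 :> R)// mul1r.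
  have w1 : hnorm (t%:C *: z) < 1 by rewrite -subr_gt0.
  apply: (@le_trans _ _ (M * (1 - hnorm (t%:C *: z)) `^ (- 1 - (q - eta)))).
    apply: (@le_trans _ _ ((1 - hnorm (t%:C *: z)) `^ (eta - 1) * (M * (1 - hnorm (t%:C *: z)) `^ (- q)))).
      by apply: ler_wpM2l; [exact: powR_ge0|exact: HM].
    rewrite mulrCA -powRD; last by rewrite (gt_eqF c1) implybT.
    by rewrite (_ : eta - 1 + - q = - 1 - (q - eta))//; ring.
  apply: ler_wpM2l => //; apply: powR_le_inv; first by rewrite lt_max X0 orbT.
    by rewrite ge_max c3 Xt.
  by lra.
pose h z : \bar R := (ind (hnorm z < 1)%R * ((1 - hnorm z) `^ (al - eta) *
  koranyi a z `^ (- (sg + n.+1%:R + (al - eta)))))%:E.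
have h0 z : (0 <= h z)%E by rewrite lee_fin mulr_ge0 ?ind_ge0// mulr_ge0 ?powR_ge0.
have mh : Cmeasurable h.
  apply/measurable_EFinP; apply: measurable_funM.
    by apply: measurable_ind; exact: Cmeasurable_ball.
  by apply: measurable_funM; [exact: Cmeasurable_dist_powR|apply: measurable_powR_comp; exact: Cmeasurable_koranyi].
pose c := M * C1 * (1 - hnorm a) `^ sg.
have c0 : 0 <= c by rewrite mulr_ge0 ?powR_ge0// mulr_ge0.
apply: (@le_trans _ _ (Int (fun z => c%:E * h z))%E).
  apply: Int_le => z.
    rewrite mule_ge0// ?lee_fin ?ray_weight_ge0//.
    by apply: integral_ge0 => t _; rewrite lee_fin ray_part_ge0.
  rewrite /ray_weight /h.
  case: (boolP (hnorm z < 1)) => z1; last by rewrite (_ : ind false = 0 :> R)// !mul0r mul0e mule0.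
  rewrite (_ : ind true = 1 :> R)// !mul1r.
  have X0 : 0 < koranyi a z by have := koranyi_ge_l z (ltW a1); lra.
  have z0 : 0 < 1 - hnorm z by rewrite subr_gt0.
  apply: (@le_trans _ _ (((1 - hnorm z) `^ (- eta) * weight al sg a z)%:E *
      (M * (C1 * koranyi a z `^ (- (q - eta))))%:E)%E).
    by apply: lee_wpmul2l; [rewrite lee_fin mulr_ge0 ?powR_ge0 ?weight_ge0|exact: ray].
  rewrite -!EFinM lee_fin le_eqVlt; apply/orP; left; apply/eqP.
  have E1 : (1 - hnorm z) `^ (al - eta) = (1 - hnorm z) `^ (- eta) * (1 - hnorm z) `^ al.
    by rewrite -powRD ?(gt_eqF z0) ?implybT// (addrC al).
  have E2 : koranyi a z `^ (- (sg + n.+1%:R + (al - eta))) = koranyi a z `^ (- (2 * sg)) * koranyi a z `^ (- (q - eta)).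
    rewrite -powRD ?(gt_eqF X0) ?implybT//; congr (_ `^ _); rewrite /q; ring.
  by rewrite E1 E2 /weight /c; ring.
rewrite (IntZ mh h0 c0).
apply: (@le_trans _ _ (c%:E * (C * (1 - hnorm a) `^ (- sg))%:E)%E).
  by apply: lee_wpmul2l; [rewrite lee_fin|exact: HC].
rewrite -EFinM lee_fin /c powRN.
have p0 : 0 < (1 - hnorm a) `^ sg by exact: powR_gt0.
rewrite le_eqVlt; apply/orP; left; apply/eqP; field.
by rewrite gt_eqF.
Qed.

(** derivative_local bounds the derivative at t z by the integral of |f|^p over a
    ball around t z, and near_kernel moves all the weights to the points v of that
    ball. *)
Lemma near_pointwise (p al sg eta : R) : 1 <= p -> 0 < sg -> exists2 C : R, 0 <= C &
  forall f k a z (t : R), holo f -> hnorm a < 1 ->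
  ((ray_weight al sg eta a z * ray_part p f k true eta a z t)%:E <=
   Int (fun v => (C * (Fpow p f v * weight al sg a v *
     (1 - hnorm v) `^ (eta - 1 - (n + n)%:R - al)) *
     (ind (1 - 2 * (1 - hnorm v) <= t <= 1) *
      (ind ((hnorm z < 1)%R && (hnorm (z - v) <= 3 * (1 - hnorm v))%R) *
       (1 - hnorm z) `^ (al - eta))))%:E))%E.
Proof.
move=> p1 s0; have [Cl Cl0 HCl] := @derivative_local R n p p1.
have p0 : 0 < p by lra.
set e := eta - 1 - (n + n)%:R.
have [K K0 HK] := near_kernel al eta e s0.
exists (K * Cl); first exact: mulr_ge0.
move=> f k a z t fh a1; have [fd _] := fh.
set G := (X in Int X).
have G0 v : (0 <= G v)%E.
  rewrite lee_fin; apply: mulr_ge0; last by rewrite !mulr_ge0 ?ind_ge0 ?powR_ge0.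
  by rewrite !mulr_ge0 ?powR_ge0 ?Fpow_ge0.
have Z (x : R) : x = 0 -> (x%:E <= Int G)%E by move=> ->; exact: Int_ge0.
rewrite /ray_weight /ray_part.
case: (boolP (hnorm z < 1)) => z1; last by apply: Z; rewrite (_ : ind false = 0 :> R)// !mul0r.
case: (boolP (0 <= t <= 1)) => t01; last by apply: Z; rewrite (_ : ind false = 0 :> R)// !mul0r mulr0.
case: ltP => [Xt|_]; last by apply: Z; rewrite (_ : ind (false == true) = 0 :> R)// mul0r !mulr0.
rewrite (_ : ind (true == true) = 1 :> R)// !mul1r.
have [c1 c2 c3] := dist_ray z1 t01.
set w := t%:C *: z in c1 c2 c3 Xt *; set dt := 1 - hnorm w in c1 c2 c3 Xt *.
have w1 : hnorm w < 1 by rewrite -subr_gt0.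
have mF := Cmeasurable_Fpow p fd.
pose h v : \bar R := (ind (hnorm (v - w) < dt / 2) * Fpow p f v)%:E.
have h0 v : (0 <= h v)%E by rewrite lee_fin mulr_ge0 ?ind_ge0 ?Fpow_ge0.
have mh : Cmeasurable h.
  apply/measurable_EFinP; apply: measurable_funM => //; apply: measurable_ind.
  exact: Cmeasurable_ball_at.
have hC : ((Dpow p f k w)%:E <= (Cl * dt ^- (n + n))%:E * Int h)%E.
  by rewrite /Dpow FpowE//; exact: HCl.
pose c := (1 - hnorm z) `^ (- eta) * weight al sg a z * dt `^ (eta - 1).
have c0 : 0 <= c by rewrite mulr_ge0 ?powR_ge0// mulr_ge0 ?powR_ge0 ?weight_ge0.
pose c' := c * (Cl * dt ^- (n + n)).
have c'0 : 0 <= c' by rewrite mulr_ge0// mulr_ge0// invr_ge0 exprn_ge0// ltW.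
apply: (@le_trans _ _ (Int (fun v => c'%:E * h v))%E).
  rewrite (IntZ mh h0 c'0) mulrA -/c (EFinM c) (EFinM c) -muleA.
  by apply: lee_wpmul2l => //; rewrite lee_fin.
apply: Int_le => v; first by rewrite mule_ge0.
rewrite /h; case: (boolP (hnorm (v - w) < dt / 2)) => vw; last by rewrite (_ : ind false = 0 :> R)// mul0r mule0.
rewrite (_ : ind true = 1 :> R)// mul1r -EFinM lee_fin.
have [v1 H1 H2 H3] := HK a z v t a1 z1 t01 Xt vw.
have /andP[t0 t1] := t01.
rewrite H2 t1 z1 H3 (_ : ind (true && true) = 1 :> R)// !mul1r.
have cE : c' = Cl * ((1 - hnorm z) `^ (- eta) * weight al sg a z * dt `^ e).
  have -> : dt `^ e = dt `^ (eta - 1) * dt ^- (n + n).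
    by rewrite -(powR_invn (n + n) (ltW c1)) -powRD// (gt_eqF c1) implybT.
  by rewrite /c' /c; ring.
rewrite cE [leRHS](_ : _ = Cl * (K * (weight al sg a v * (1 - hnorm v) `^ (e - al) *
   (1 - hnorm z) `^ (al - eta))) * Fpow p f v); last by ring.
by apply: ler_wpM2r; [exact: Fpow_ge0|apply: ler_wpM2l].
Qed.

(** Integrate near_pointwise over t, over z and finally over v. The t-integral
    contributes 1 - |v|, the z-integral is given by ball_layer, and the powers of
    1 - |v| cancel, which leaves the weighted integral of |f|^p. *)
Lemma near_estimate (p al sg eta : R) : 1 <= p -> 0 < sg -> -1 < al - eta ->
  exists2 C : R, 0 <= C & forall f k (N : R) a, 0 <= N -> holo f -> hnorm a < 1 ->
  (Int (fun z => (Fpow p f z * weight al sg a z)%:E) <= N%:E)%E ->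
  (Int (fun z => (ray_weight al sg eta a z)%:E *
     \int[mu]_t (ray_part p f k true eta a z t)%:E) <= (C * N)%:E)%E.
Proof.
move=> p1 s0 b1; have p0 : 0 < p by lra.
have [C1 C10 H1] := @near_pointwise p al sg eta p1 s0.
have [C2 C20 H2] := @ball_layer R n (al - eta) b1.
exists (C1 * 2 * C2); first by rewrite !mulr_ge0.
move=> f k N a N0 fh a1 HN; have [fd _] := fh.
set e := eta - 1 - (n + n)%:R - al in H1.
have mF := Cmeasurable_Fpow p fd; have mW := Cmeasurable_weight al sg a.
pose A v := C1 * (Fpow p f v * weight al sg a v * (1 - hnorm v) `^ e).
have A0 v : 0 <= A v by rewrite !mulr_ge0 ?powR_ge0 ?Fpow_ge0.
have mA : Cmeasurable A.
  apply: measurable_funM => //; apply: measurable_funM; last exact: Cmeasurable_dist_powR.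
  exact: measurable_funM.
pose B z v : R := ind ((hnorm z < 1) && (hnorm (z - v) <= 3 * (1 - hnorm v))) * (1 - hnorm z) `^ (al - eta).
have B0 z v : 0 <= B z v by rewrite mulr_ge0 ?ind_ge0 ?powR_ge0.
pose i v (t : R) : R := ind (1 - 2 * (1 - hnorm v) <= t <= 1).
have i0 v t : 0 <= i v t by exact: ind_ge0.
have mi : measurable_fun setT (fun x : Tn * T => i (toC x.1) x.2).
  have mv1 : measurable_fun setT (fun x : Tn * T => hnorm (toC x.1)).
    exact: (vec_measurable_hnorm (vec_measurable_comp vec_measurable_id measurable_fst)).
  apply: measurable_ind; apply: measurable_and; apply: measurable_fun_ler => //;
    try exact: measurable_snd.
  by apply: measurable_funB => //; apply: measurable_funM => //; apply: measurable_funB.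
have mBz z : Cmeasurable (B z).
  apply: measurable_funM; last exact: measurable_cst.
  apply: measurable_ind; apply: measurable_and; first exact: measurable_cst.
  apply: measurable_fun_ler.
    apply: vec_measurable_hnorm; apply: vec_measurableD; first exact: vec_measurable_cst.
    by apply: vec_measurableN; exact: vec_measurable_id.
  by apply: measurable_funM => //; apply: measurable_funB => //; exact: Cmeasurable_hnorm.
have m1 := vec_measurable_comp (@vec_measurable_id R n) (@measurable_fst _ _ Tn Tn).
have m2 := vec_measurable_comp (@vec_measurable_id R n) (@measurable_snd _ _ Tn Tn).
have mB : measurable_fun setT (fun x : Tn * Tn => B (toC x.1) (toC x.2)).
  apply: measurable_funM; last exact: (Cmeasurable_comp (Cmeasurable_dist_powR _) m1).
  apply: measurable_ind; apply: measurable_and.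
    exact: (Cmeasurable_comp (Cmeasurable_ball 1) m1).
  apply: measurable_fun_ler.
    by apply: vec_measurable_hnorm; apply: vec_measurableD => //; exact: vec_measurableN.
  by apply: measurable_funM => //; apply: measurable_funB => //; exact: vec_measurable_hnorm.
(* for fixed z and v the parameters t fill an interval of length at most
   2 (1 - |v|) *)
have S1 z : ((ray_weight al sg eta a z)%:E * \int[mu]_t (ray_part p f k true eta a z t)%:E <=
    Int (fun v => (A v * (2 * (1 - hnorm v)) * B z v)%:E))%E.
  rewrite -ge0_integralZl//; first last.
  - by rewrite lee_fin ray_weight_ge0.
  - by move=> t _; rewrite lee_fin ray_part_ge0.
  - by apply/measurable_EFinP; exact: measurable_ray_part_t.
  pose H v (t : R) : \bar R := (A v * (i v t * B z v))%:E.
  have H0 v t : (0 <= H v t)%E by rewrite lee_fin mulr_ge0// mulr_ge0.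
  have mH : measurable_fun setT (fun x : Tn * T => H (toC x.1) x.2).
    apply/measurable_EFinP; apply: measurable_funM; first exact: (measurableT_comp mA measurable_fst).
    by apply: measurable_funM => //; exact: (measurableT_comp (mBz z) measurable_fst).
  apply: (@le_trans _ _ (\int[mu]_t Int (H^~ t))%E).
    apply: integral_monotone => t.
      by rewrite mule_ge0// lee_fin ?ray_weight_ge0 ?ray_part_ge0.
    by rewrite -EFinM; exact: H1.
  rewrite -(Int_swapR mH H0); apply: Int_le => v; first by apply: integral_ge0.
  case: (boolP (hnorm v < 1)) => v1; last first.
    rewrite (_ : A v = 0); last by rewrite /A Fpow_out// !mul0r mulr0.
    rewrite !mul0r (_ : (\int[mu]_t H v t)%E = 0%E)//.
    by apply: integral0_eq => t _; rewrite /H /A Fpow_out// !mul0r mulr0 mul0r.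
  have -> : (\int[mu]_t H v t = \int[mu]_t (ind (1 - 2 * (1 - hnorm v) <= t <= 1)%R * (A v * B z v))%:E)%E.
    by apply: eq_integral => t _; rewrite /H mulrCA.
  rewrite integral_ind_cst; last by lra.
  by rewrite lee_fin le_eqVlt; apply/orP; left; apply/eqP; ring.
apply: (@le_trans _ _ (Int (fun z => Int (fun v => (A v * (2 * (1 - hnorm v)) * B z v)%:E)))%E).
  apply: Int_le => z //; rewrite mule_ge0 ?lee_fin ?ray_weight_ge0//.
  by apply: integral_ge0 => t _; rewrite lee_fin ray_part_ge0.
have mAv : Cmeasurable (fun v => A v * (2 * (1 - hnorm v))).
  apply: measurable_funM => //; apply: measurable_funM => //; apply: measurable_funB => //.
  exact: Cmeasurable_hnorm.
pose J z v : \bar R := (A v * (2 * (1 - hnorm v)) * B z v)%:E.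
have AF v : ~~ (hnorm v < 1) -> A v = 0 by move=> v1; rewrite /A Fpow_out// !mul0r mulr0.
have A20 v : 0 <= A v * (2 * (1 - hnorm v)).
  case: (boolP (hnorm v < 1)) => v1; last by rewrite AF// mul0r.
  by rewrite mulr_ge0// mulr_ge0// subr_ge0 ltW.
have J0 z v : (0 <= J z v)%E by rewrite lee_fin mulr_ge0.
have mJ : measurable_fun setT (fun x : Tn * Tn => J (toC x.1) (toC x.2)).
  apply/measurable_EFinP; apply: measurable_funM => //.
  exact: (measurableT_comp mAv measurable_snd).
have mBv v : Cmeasurable (fun z => (B z v)%:E).
  apply/measurable_EFinP; apply: measurable_funM; last exact: Cmeasurable_dist_powR.
  apply: measurable_ind; apply: measurable_and; first exact: Cmeasurable_ball.
  apply: measurable_fun_ler; last exact: measurable_cst.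
  by apply: vec_measurable_hnorm; apply: vec_measurableD; [exact: vec_measurable_id|exact: vec_measurable_cst].
rewrite -/J (Int_swap mJ J0).
pose W v : \bar R := (Fpow p f v * weight al sg a v)%:E.
have W0 v : (0 <= W v)%E by rewrite lee_fin mulr_ge0 ?Fpow_ge0 ?weight_ge0.
have mW' : Cmeasurable W by apply/measurable_EFinP; exact: measurable_funM.
have c0 : 0 <= C1 * 2 * C2 by rewrite !mulr_ge0.
apply: (@le_trans _ _ (Int (fun v => (C1 * 2 * C2)%:E * W v))%E); last first.
  by rewrite (IntZ mW' W0 c0) (EFinM _ N); apply: lee_wpmul2l; rewrite ?lee_fin.
apply: Int_le => v; first exact: Int_ge0.
case: (boolP (hnorm v < 1)) => v1; last first.
  rewrite (_ : Int _ = 0%E) ?mule_ge0//.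
  by apply: integral0_eq => t _; rewrite /J AF// !mul0r.
have E1 : Int (J^~ v) = ((A v * (2 * (1 - hnorm v)))%:E * Int (fun z => (B z v)%:E))%E.
  by rewrite -(IntZ (mBv v) _ (A20 v))// => z; rewrite lee_fin.
rewrite E1; apply: (@le_trans _ _ ((A v * (2 * (1 - hnorm v)))%:E *
    (C2 * ((1 - hnorm v) `^ (al - eta) * (1 - hnorm v) ^+ (n + n)))%:E)%E).
  by apply: lee_wpmul2l; [rewrite lee_fin|exact: H2].
rewrite -!EFinM lee_fin le_eqVlt; apply/orP; left; apply/eqP.
have v0 : 0 < 1 - hnorm v by rewrite subr_gt0.
(* the exponents e, 1, al - eta and 2n add up to 0 *)
have E2 : (1 - hnorm v) `^ e * (1 - hnorm v) * ((1 - hnorm v) `^ (al - eta) * (1 - hnorm v) ^+ (n + n)) = 1.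
  rewrite -{2}(powRr1 (ltW v0)) -(powR_mulrn (n + n) (ltW v0)) -!powRD ?(gt_eqF v0) ?implybT//.
  by rewrite (_ : e + 1 + _ = 0) ?powRr0// /e; ring.
transitivity (C1 * 2 * C2 * (Fpow p f v * weight al sg a v) * ((1 - hnorm v) `^ e *
  (1 - hnorm v) * ((1 - hnorm v) `^ (al - eta) * (1 - hnorm v) ^+ (n + n)))).
  by rewrite /A; ring.
by rewrite E2 mulr1.
Qed.

Lemma holo_of_growth (p q M : R) f : 0 < p -> 0 <= q -> 0 <= M ->
  (forall z, hnorm z < 1 -> differentiable f z) ->
  (forall w, hnorm w < 1 -> normc (f w) `^ p <= M * (1 - hnorm w) `^ (- q)) -> holo f.
Proof.
move=> p0 q0 M0 fd fM; split=> // rho rho1.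
exists ((M * (1 - rho) `^ (- q)) `^ p^-1) => z zr.
have z1 : hnorm z < 1 by exact: le_lt_trans zr rho1.
apply: le_root => //; first exact: normc_ge0.
apply: le_trans (fM z z1) _; apply: ler_wpM2l => //.
apply: powR_le_inv; [by rewrite subr_gt0|by rewrite lerD2l lerN2|by rewrite oppr_le0].
Qed.

(** A small eta > 0 is spent in ray_jensen: it must leave the exponent al - eta
    of the weight above -1, and be smaller than the growth exponent
    al - sg + n + 1, so that the far part converges. *)
Lemma ray_average_estimate (p al sg : R) : (0 < n)%N -> 1 <= p -> 0 < sg ->
  -1 < al -> 0 < al - sg + n.+1%:R -> exists2 C : R, 0 <= C &
  forall f (N : R), 0 <= N -> (forall z, hnorm z < 1 -> differentiable f z) ->
  (forall a, hnorm a < 1 -> (Int (fun z => (Fpow p f z * weight al sg a z)%:E) <= N%:E)%E) ->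
  holo f /\ forall k a, hnorm a < 1 ->
  (Int (fun z => (Fpow p (ray_average (fun w => pd f w k : R[i]^o)) z * weight al sg a z)%:E) <=
   (C * N)%:E)%E.
Proof.
move=> n0 p1 s0 al1 q0; have p0 : 0 < p by lra.
have [eta [eta0 etaq b1]] : exists eta : R,
    [/\ 0 < eta, eta < al - sg + n.+1%:R & -1 < al - eta].
  have [h|h] := leP (al + 1) (al - sg + n.+1%:R).
    by exists ((al + 1) / 2); split; lra.
  by exists ((al - sg + n.+1%:R) / 2); split; lra.
have [Cg Cg0 Hg] := @growth_estimate R n p al sg n0 p1 s0.
have [Cd Cd0 Hd] := @derivative_growth R n p (al - sg + n.+1%:R) p1.
have [Cf Cf0 Hf] := @far_estimate p al sg eta n0 s0 eta0 b1 etaq.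
have [Cn Cn0 Hn] := @near_estimate p al sg eta p1 s0 b1.
have [Cj Cj0 Hj] := @ray_jensen R n p eta p1 eta0.
exists (Cj * (Cn + Cf * (Cd * Cg))); first by rewrite mulr_ge0// addr_ge0// !mulr_ge0.
move=> f N N0 fd HN.
have fgrow := Hg f N N0 fd HN.
have CgN0 : 0 <= Cg * N by exact: mulr_ge0.
have fh : holo f := holo_of_growth p0 (ltW q0) CgN0 fd fgrow.
split=> // k a a1.
have HM w : hnorm w < 1 -> Dpow p f k w <= Cd * (Cg * N) * (1 - hnorm w) `^ (- (al - sg + n.+1%:R)).
  by move=> w1; rewrite /Dpow FpowE//; exact: Hd.
have M0 : 0 <= Cd * (Cg * N) by exact: mulr_ge0.
have far := Hf f k _ a M0 a1 HM.
have near := Hn f k N a N0 fh a1 (HN a a1).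
pose P b z : \bar R := ((ray_weight al sg eta a z)%:E * \int[mu]_t (ray_part p f k b eta a z t)%:E)%E.
have rp0 b z t : (0 <= (ray_part p f k b eta a z t)%:E)%E by rewrite lee_fin ray_part_ge0.
have P0 b z : (0 <= P b z)%E.
  by rewrite mule_ge0// ?lee_fin ?ray_weight_ge0//; apply: integral_ge0 => t _; exact: rp0.
have mP b : Cmeasurable (P b).
  apply: emeasurable_funM.
    apply/measurable_EFinP; apply: measurable_funM.
      by apply: measurable_ind; exact: Cmeasurable_ball.
    by apply: measurable_funM; [exact: Cmeasurable_dist_powR|exact: Cmeasurable_weight].
  apply: (Cmeasurable_IntR (f := fun z (t : R) => (ray_part p f k b eta a z t)%:E)) => //.
  by apply/measurable_EFinP; exact: measurable_ray_part.
have pw z : ((Fpow p (ray_average (fun w => pd f w k : R[i]^o)) z * weight al sg a z)%:E <=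
    Cj%:E * (P true z + P false z))%E.
  case: (boolP (hnorm z < 1)) => z1; last first.
    by rewrite Fpow_out// mul0r mule_ge0// adde_ge0.
  rewrite FpowE// mulrC EFinM.
  apply: (@le_trans _ _ ((weight al sg a z)%:E * ((Cj * (1 - hnorm z) `^ (- eta))%:E *
     (\int[mu]_t (ray_part p f k true eta a z t)%:E +
      \int[mu]_t (ray_part p f k false eta a z t)%:E)))%E).
    apply: lee_wpmul2l; first by rewrite lee_fin weight_ge0.
    rewrite -ge0_integralD//; first last.
    - by apply/measurable_EFinP; exact: measurable_ray_part_t.
    - by apply/measurable_EFinP; exact: measurable_ray_part_t.
    apply: le_trans (Hj f k z fh z1) _.
    apply: lee_wpmul2l; first by rewrite lee_fin mulr_ge0 ?powR_ge0.
    apply: integral_monotone => t.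
      by rewrite lee_fin mulr_ge0 ?ind_ge0// mulr_ge0 ?powR_ge0 ?Dpow_ge0.
    rewrite -EFinD lee_fin /ray_part -mulrDr -mulrDl.
    set c := (_ < _); rewrite (_ : ind (c == true) + ind (c == false) = 1 :> R) ?mul1r//.
    by case: c; rewrite /ind ?addr0 ?add0r.
  rewrite /P -ge0_muleDr; last 2 first.
  - by apply: integral_ge0 => t _; exact: rp0.
  - by apply: integral_ge0 => t _; exact: rp0.
  rewrite !muleA -!EFinM /ray_weight z1 (_ : ind true = 1 :> R)// mul1r.
  by rewrite (_ : weight al sg a z * _ = Cj * ((1 - hnorm z) `^ (- eta) * weight al sg a z))//; ring.
apply: (@le_trans _ _ (Int (fun z => Cj%:E * (P true z + P false z)))%E).
  by apply: Int_le => // z; rewrite lee_fin mulr_ge0 ?Fpow_ge0 ?weight_ge0.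
rewrite IntZ//; last 2 first.
- by apply: emeasurable_funD; exact: mP.
- by move=> z; rewrite adde_ge0.
rewrite IntD//.
apply: (@le_trans _ _ (Cj%:E * ((Cn * N)%:E + (Cf * (Cd * (Cg * N)))%:E))%E).
  by apply: lee_wpmul2l; [rewrite lee_fin|exact: leeD].
rewrite -EFinD -!EFinM lee_fin le_eqVlt; apply/orP; left; apply/eqP; ring.
Qed.

End norm_estimate.

(** * The function space *)

Section function_space.
Context {R : realType} {n : nat}.
Notation Tn := ((n + n).-tuple (measurableTypeR R)).
Notation toC := (@complex_of_tuple R n).
Notation V := (fine (@volume_unit_ball R n)).
Implicit Types (z w a : Cvec R n) (f : Cvec R n -> R[i]^o).

Lemma powR_one_sub_sqnorm z (e : R) : hnorm z < 1 ->
  (1 - sqnorm z) `^ e <= 2 `^ `|e| * (1 - hnorm z) `^ e /\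
  (1 - hnorm z) `^ e <= 2 `^ `|e| * (1 - sqnorm z) `^ e.
Proof.
move=> z1; have z0 := hnorm_ge0 z.
have E : 1 - sqnorm z = (1 - hnorm z) * (1 + hnorm z).
  by rewrite -hnorm_sqr -subr_sqr expr1n.
have d0 : 0 < 1 - hnorm z by rewrite subr_gt0.
have d1 : 0 < 1 - sqnorm z by rewrite E mulr_gt0//; lra.
have h1 : 1 - sqnorm z <= 2 * (1 - hnorm z) by rewrite E; nra.
have h2 : 1 - hnorm z <= 2 * (1 - sqnorm z) by rewrite E; nra.
by split; apply: powR_comparable; rewrite ?ler1n.
Qed.

(** The density in the definition of the norm after sqnorm_Phi, with
    al = q + ns - n - 1 and sg = ns. *)
Definition density (al sg : R) a z : R :=
  (1 - sqnorm z) `^ al * ((1 - sqnorm a) `^ sg * koranyi a z `^ (- (2 * sg))).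

Lemma density_weight (al sg : R) a z : hnorm a < 1 -> hnorm z < 1 ->
  density al sg a z <= 2 `^ `|al| * 2 `^ `|sg| * weight al sg a z /\
  weight al sg a z <= 2 `^ `|al| * 2 `^ `|sg| * density al sg a z.
Proof.
move=> a1 z1; have [h1 h2] := powR_one_sub_sqnorm al z1.
have [h3 h4] := powR_one_sub_sqnorm sg a1.
have key (A B C D X k l : R) : 0 <= A -> 0 <= C -> 0 <= X -> A <= k * B -> C <= l * D ->
    A * (C * X) <= k * l * (B * (D * X)).
  move=> A0 C0 X0 AB CD; rewrite [leRHS](_ : _ = (k * B) * ((l * D) * X)); last by ring.
  by apply: ler_pM => //; [exact: mulr_ge0|apply: ler_wpM2r].
have P := powR_ge0; split.
  exact: (key _ _ _ _ _ _ _ (P _ _ _) (P _ _ _) (P _ _ _) h1 h3).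
exact: (key _ _ _ _ _ _ _ (P _ _ _) (P _ _ _) (P _ _ _) h2 h4).
Qed.

Let density_identity (A D X F q sg : R) (m : nat) : 0 < A -> 0 < D -> 0 < X ->
  F * D `^ q * (A * D / X ^+ 2) `^ sg / D ^+ m =
  F * (D `^ (q + sg - m%:R) * (A `^ sg * X `^ (- (2 * sg)))).
Proof.
move=> A0 D0 X0.
have -> : (A * D / X ^+ 2) `^ sg = A `^ sg * D `^ sg * X `^ (- (2 * sg)).
  rewrite powRM; [|by rewrite mulr_ge0// ltW|by rewrite invr_ge0 exprn_ge0// ltW].
  rewrite powRM; [|exact: ltW|exact: ltW].
  by congr (_ * _); rewrite -(powR_invn 2 (ltW X0)) -powRrM mulNr.
have -> : D `^ (q + sg - m%:R) = D `^ q * D `^ sg / D ^+ m.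
  by rewrite -(powR_invn m (ltW D0)) -!powRD// (gt_eqF D0) implybT.
by ring.
Qed.

Lemma NintegralE (p q s : R) f a : 0 < p -> hnorm a < 1 ->
  (forall z, hnorm z < 1 -> differentiable f z) ->
  Nintegral p q s f a =
  (V^-1%:E * Int (fun z => (Fpow p f z *
     density (q + n%:R * s - n.+1%:R) (n%:R * s) a z)%:E))%E.
Proof.
move=> p0 a1 fd; set al := q + n%:R * s - n.+1%:R; set sg := n%:R * s.
rewrite /Nintegral integral_mkcond.
have main z : hnorm z < 1 -> normc (f z) `^ p * (1 - sqnorm z) `^ q *
    (1 - sqnorm (Phi a z)) `^ sg / (1 - sqnorm z) ^+ n.+1 = Fpow p f z * density al sg a z.
  move=> z1; have ua : unit_ball a by exact/unit_ballP.
  have uz : unit_ball z by exact/unit_ballP.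
  rewrite [X in _ * X `^ sg / _](sqnorm_Phi ua uz) (FpowE p f z1).
  apply: density_identity; [by rewrite subr_gt0; exact: ua|by rewrite subr_gt0; exact: uz|].
  by have := koranyi_ge_l z (ltW a1); apply: lt_le_trans; rewrite subr_gt0.
have E t : ((fun t : Tn => (normc (f (toC t)) `^ p * (1 - sqnorm (toC t)) `^ q *
     (1 - sqnorm (Phi a (toC t))) `^ sg / (1 - sqnorm (toC t)) ^+ n.+1)%:E) \_ (toC @^-1` unit_ball)) t =
   (Fpow p f (toC t) * density al sg a (toC t))%:E.
  rewrite /patch; case: (boolP (hnorm (toC t) < 1)) => z1; last first.
    rewrite ifF; first by rewrite Fpow_out// mul0r.
    by apply/negbTE; rewrite notin_setE /=; move/unit_ballP; apply/negP.
  rewrite ifT; last by rewrite inE /=; exact/unit_ballP.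
  by rewrite main.
transitivity (\int[dV]_t (Fpow p f (toC t) * density al sg a (toC t))%:E)%E.
  by apply: eq_integral => t _; exact: E.
rewrite /dV ge0_integral_mscale//.
- apply/measurable_EFinP; apply: measurable_funM; first exact: Cmeasurable_Fpow.
  apply: measurable_funM.
    apply: measurable_powR_comp; apply: measurable_funB => //.
    exact: (vec_measurable_sqnorm vec_measurable_id).
  by apply: measurable_funM => //; apply: measurable_powR_comp; exact: Cmeasurable_koranyi.
- by move=> t _; rewrite lee_fin mulr_ge0 ?Fpow_ge0// !mulr_ge0 ?powR_ge0.
Qed.

Lemma Cmeasurable_density al sg a : Cmeasurable (density al sg a).
Proof.
apply: measurable_funM.
  apply: measurable_powR_comp; apply: measurable_funB; first exact: measurable_cst.
  exact: (vec_measurable_sqnorm vec_measurable_id).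
apply: measurable_funM; first exact: measurable_cst.
by apply: measurable_powR_comp; exact: Cmeasurable_koranyi.
Qed.

Lemma density_ge0 al sg a z : 0 <= density al sg a z.
Proof. by rewrite mulr_ge0 ?powR_ge0// mulr_ge0 ?powR_ge0. Qed.

Lemma Int_scale_le (k : R) (g h : Cvec R n -> R) : 0 <= k -> Cmeasurable h ->
  (forall z, 0 <= g z) -> (forall z, 0 <= h z) -> (forall z, g z <= k * h z) ->
  (Int (fun z => (g z)%:E) <= k%:E * Int (fun z => (h z)%:E))%E.
Proof.
move=> k0 mh g0 h0 gh; rewrite -IntZ//; first last.
- exact/measurable_EFinP.
by apply: Int_le => z; rewrite ?lee_fin// -EFinM lee_fin.
Qed.

Lemma Fpow_le_scale (p k : R) f (g h : Cvec R n -> R) : 0 < p ->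
  (forall z, hnorm z < 1 -> g z <= k * h z) ->
  forall z, Fpow p f z * g z <= k * (Fpow p f z * h z).
Proof.
move=> p0 gh z; case: (boolP (hnorm z < 1)) => z1; last by rewrite Fpow_out// !mul0r mulr0.
by rewrite mulrCA; apply: ler_wpM2l; [exact: Fpow_ge0|exact: gh].
Qed.

Lemma Nnormp_ge0 (p q s : R) f : (0 <= Nnormp p q s f)%E.
Proof.
apply: (@le_trans _ _ (Nintegral p q s f 0)).
  apply: integral_ge0 => t /unit_ballP t1.
  have d0 : 0 <= 1 - sqnorm (toC t).
    by rewrite subr_ge0 -hnorm_sqr expr_le1 ?hnorm_ge0// ltW.
  by rewrite lee_fin divr_ge0 ?exprn_ge0// mulr_ge0 ?powR_ge0// mulr_ge0 ?powR_ge0.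
apply: ereal_sup_ubound; exists 0 => //; apply/unit_ballP.
by rewrite hnorm0.
Qed.

Lemma Nspace_weighted (p q s : R) : 0 < p -> exists2 C : R, 0 <= C &
  forall f, Nspace p q s f -> forall a, hnorm a < 1 ->
  (Int (fun z => (Fpow p f z * weight (q + n%:R * s - n.+1%:R) (n%:R * s) a z)%:E) <=
   (C * fine (Nnormp p q s f))%:E)%E.
Proof.
move=> p0; set al := q + n%:R * s - n.+1%:R; set sg := n%:R * s.
have V0 := @V_gt0 R n.
pose k : R := 2 `^ `|al| * 2 `^ `|sg|.
have k0 : 0 <= k by rewrite mulr_ge0 ?powR_ge0.
exists (k * V); first by rewrite mulr_ge0// ltW.
move=> f [fd fN] a a1.
have fd' z : hnorm z < 1 -> differentiable f z by move=> /unit_ballP; exact: fd.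
have Nfin : Nnormp p q s f \is a fin_num by rewrite ge0_fin_numE// Nnormp_ge0.
have mFd : Cmeasurable (fun z => Fpow p f z * density al sg a z).
  by apply: measurable_funM; [exact: Cmeasurable_Fpow|exact: Cmeasurable_density].
apply: (@le_trans _ _ (k%:E * Int (fun z => (Fpow p f z * density al sg a z)%:E))%E).
  apply: Int_scale_le => // [z|z|].
  - by rewrite mulr_ge0 ?Fpow_ge0 ?weight_ge0.
  - by rewrite mulr_ge0 ?Fpow_ge0 ?density_ge0.
  - by apply: Fpow_le_scale => // z z1; have [] := density_weight al sg a1 z1.
have NE := NintegralE q s p0 a1 fd'; rewrite -/al -/sg in NE.
have -> : Int (fun z => (Fpow p f z * density al sg a z)%:E) = (V%:E * Nintegral p q s f a)%E.
  by rewrite NE muleA -EFinM mulfV ?gt_eqF// mul1e.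
rewrite muleA -EFinM (EFinM (k * V)); apply: lee_wpmul2l.
  by rewrite lee_fin mulr_ge0// ltW.
rewrite fineK//; apply: ereal_sup_ubound; exists a => //; exact/unit_ballP.
Qed.

Lemma Nspace_of_weighted (p q s : R) : 0 < p -> exists2 C : R, 0 <= C &
  forall f (N : R), 0 <= N -> (forall z, hnorm z < 1 -> differentiable f z) ->
  (forall a, hnorm a < 1 ->
  (Int (fun z => (Fpow p f z * weight (q + n%:R * s - n.+1%:R) (n%:R * s) a z)%:E) <= N%:E)%E) ->
  Nspace p q s f /\ fine (Nnormp p q s f) <= C * N.
Proof.
move=> p0; set al := q + n%:R * s - n.+1%:R; set sg := n%:R * s.
have V0 := @V_gt0 R n.
pose k : R := 2 `^ `|al| * 2 `^ `|sg|.
have k0 : 0 <= k by rewrite mulr_ge0 ?powR_ge0.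
exists (V^-1 * k); first by rewrite mulr_ge0// invr_ge0 ltW.
move=> f N N0 fd HN.
have bound : (Nnormp p q s f <= (V^-1 * k * N)%:E)%E.
  apply: ge_ereal_sup => _ [a /unit_ballP a1 <-].
  rewrite NintegralE// -/al -/sg -mulrA (EFinM V^-1); apply: lee_wpmul2l.
    by rewrite lee_fin invr_ge0 ltW.
  apply: (@le_trans _ _ (k%:E * Int (fun z => (Fpow p f z * weight al sg a z)%:E))%E).
    apply: Int_scale_le => // [|z|z|].
    - by apply: measurable_funM; [exact: Cmeasurable_Fpow|exact: Cmeasurable_weight].
    - by rewrite mulr_ge0 ?Fpow_ge0 ?density_ge0.
    - by rewrite mulr_ge0 ?Fpow_ge0 ?weight_ge0.
    - by apply: Fpow_le_scale => // z z1; have [] := density_weight al sg a1 z1.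
  by rewrite (EFinM k); apply: lee_wpmul2l; [rewrite lee_fin|exact: HN].
have Nlt : (Nnormp p q s f < +oo)%E by apply: le_lt_trans bound _; rewrite ltry.
split; first by split=> // z /unit_ballP; exact: fd.
by rewrite -lee_fin fineK// ge0_fin_numE// Nnormp_ge0.
Qed.

End function_space.

Theorem proposition6p12 (R : realType) (n : nat) (p q s : R)
    (n_gt0 : (0 < n)%N) (p_ge1 : 1 <= p) (q_gt0 : 0 < q)
    (s_gt : Num.max 0 (1 - q / n%:R) < s) :
  exists A : 'I_n -> (Cvec R n -> R[i]^o) -> Cvec R n -> R[i]^o,
    [/\ forall k,
          bounded_linear_operator (Nspace p q s) (Nnorm p q s) (A k),
        forall f, Nspace p q s f -> forall z, unit_ball z ->
          f z - f 0 = \sum_(k < n) z 0 k * A k f z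
      & forall k f, Nspace p q s f -> forall z, unit_ball z ->
          A k f z =
          integral01 (fun t => partial_derivative k f (t%:C *: z))].
Proof.
have p0 : 0 < p by lra.
have nR : 0 < n%:R :> R by rewrite ltr0n.
have /andP[s0 s1] : (0 < s) && (1 - q / n%:R < s) by rewrite -gt_max.
pose al := q + n%:R * s - n.+1%:R; pose sg := n%:R * s.
have sg0 : 0 < sg by exact: mulr_gt0.
have al1 : -1 < al.
  have : n%:R * (1 - q / n%:R) < n%:R * s by rewrite ltr_pM2l.
  rewrite mulrBr mulr1 mulrCA mulfV ?mulr1 ?gt_eqF// /al -natr1; lra.
(* the two hypotheses on s say sg > 0 and al > -1; the growth exponent is q *)
have qE : al - sg + n.+1%:R = q by rewrite /al /sg; ring.
have q1 : 0 < al - sg + n.+1%:R by rewrite qE.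
have [C1 C10 H1] := @Nspace_weighted R n p q s p0.
have [C2 C20 H2] := @Nspace_of_weighted R n p q s p0.
rewrite -/al -/sg in H1 H2.
have [C3 C30 H3] := @ray_average_estimate R n p al sg n_gt0 p_ge1 sg0 al1 q1.
have H (f : Cvec R n -> R[i]^o) : Nspace p q s f -> holo f /\ forall k,
    Nspace p q s (ray_average (fun w => pd f w k : R[i]^o)) /\
    fine (Nnormp p q s (ray_average (fun w => pd f w k : R[i]^o))) <=
      C2 * (C3 * (C1 * fine (Nnormp p q s f))).
  move=> fN; have [fd _] := fN.
  have fd' z : hnorm z < 1 -> differentiable f z by move=> /unit_ballP; exact: fd.
  have N0 : 0 <= C1 * fine (Nnormp p q s f).
    by rewrite mulr_ge0// fine_ge0// Nnormp_ge0.
  have [fh Hk] := H3 f _ N0 fd' (H1 f fN); split; [exact: fh|move=> k].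
  apply: H2; first exact: mulr_ge0.
    by have [] := holo_ray_average (holo_pd k fh).
  exact: Hk.
exists (fun k f => ray_average (fun w => pd f w k : R[i]^o)); split.
- move=> k; split.
  + move=> f g [fd _] _ fg z /unit_ballP z1; apply: ray_average_ext z1 _ => w w1.
    have fw : differentiable f w by apply: fd; exact/unit_ballP.
    have fg' u : hnorm u < 1 -> f u = g u by move=> u1; apply: fg; exact/unit_ballP.
    by have -> := pd_ext w1 fw fg'.
  + by move=> f fN; have [_ Hk] := H f fN; have [] := Hk k.
  + move=> c f g fN gN z /unit_ballP z1.
    have [fh _] := H f fN; have [gh _] := H g gN.
    rewrite -(ray_average_ZD c (holo_pd k fh) (holo_pd k gh) z1).
    apply: ray_average_ext z1 _ => w w1.
    by have [fd _] := fh; have [gd _] := gh; have -> := pd_ZD c (fd w w1) (gd w w1).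
  + exists ((C2 * (C3 * C1)) `^ p^-1) => f fN; have [_ /(_ k)[_ h]] := H f fN.
    rewrite /Nnorm -powRM; last 2 first.
    * by rewrite !mulr_ge0.
    * by rewrite fine_ge0// Nnormp_ge0.
    apply: ge0_ler_powR; rewrite ?nnegrE ?invr_ge0 ?fine_ge0 ?Nnormp_ge0//; first exact: ltW.
      by rewrite mulr_ge0 ?fine_ge0 ?Nnormp_ge0// !mulr_ge0.
    by apply: le_trans h _; rewrite !mulrA.
- move=> f fN z /unit_ballP z1; have [fh _] := H f fN; exact: holo_ray_formula.
- by move=> k f _ z _; reflexivity.
Qed.
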